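(* Let $c\in\mathbb{R}$ with $|c|<1$ and let $\pi_c=(c-x_3)\,\pi$ be the corresponding necklace Poisson structure on the unit sphere $S^2\subset\mathbb{R}^3$. Then the Poisson cohomology of $(S^2,\pi_c)$ is given by $$H^0_{\pi_c}(S^2)=\mathbb{R}=\mathrm{span}\{1\},\qquad H^1_{\pi_c}(S^2)=\mathbb{R}=\mathrm{span}\{\Delta_\omega\},\qquad H^2_{\pi_c}(S^2)=\mathbb{R}^2=\mathrm{span}\{\pi_c,\pi\},$$ that is, these real vector spaces have dimensions $1,1,2$ and are spanned by the cohomology classes of, respectively, the constant function $1$; the modular vector field $\Delta_\omega$ of $\pi_c$ with respect to the area form $\omega=\pi^{-1}$; and the bivector fields $\pi_c$ and $\pi$.
   Context: Let $S^2=\{x_1^2+x_2^2+x_3^2=1\}\subset\mathbb{R}^3$. Let $\pi$ be the rotation-invariant ($SU(2)$-invariant) nondegenerate Poisson bivector field on $S^2$ such that $-\pi$ is the restriction to $S^2$ of $x_1\,\partial_{x_2}\wedge\partial_{x_3}+x_2\,\partial_{x_3}\wedge\partial_{x_1}+x_3\,\partial_{x_1}\wedge\partial_{x_2}$. In the stereographic coordinate $w=x+iy=(x_1-ix_2)/(1+x_3)$ on $S^2\setminus\{(0,0,-1)\}$ one has $\pi=\frac14(1+x^2+y^2)^2\,\partial_x\wedge\partial_y$ and $x_3=\frac{1-x^2-y^2}{1+x^2+y^2}$. Let $\omega$ be the rotation-invariant area form inverse to $\pi$, $\omega=\frac{4\,dx\wedge dy}{(1+x^2+y^2)^2}$. For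 $c\in\mathbb{R}$ put $\pi_c=(c-x_3)\pi$; every bivector field on a surface is Poisson. For $|c|<1$, $\pi_c$ vanishes exactly on the circle $\{x_3=c\}$ and is called a necklace Poisson structure. For a Poisson manifold $(P,\pi_P)$, the Poisson cohomology $H^\bullet_{\pi_P}(P)$ is the cohomology of the complex $(\mathfrak{X}^\bullet(P),d_{\pi_P}=[\pi_P,\cdot])$, where $\mathfrak{X}^k(P)$ is the space of smooth $k$-vector fields on $P$ and $[\cdot,\cdot]$ is the Schouten bracket. The modular vector field $\Delta_\omega$ of $\pi_c$ with respect to the volume form $\omega$ is the vector field defined by $L_{X_f}\omega=\Delta_\omega(f)\,\omega$ for all $f\in C^\infty(S^2)$, where $X_f=\{\cdot,f\}$ is the Hamiltonian vector field of $f$ with respect to $\pi_c$. It is a Poisson vector field, i.e. $[\pi_c,\Delta_\omega]=0$. *)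

(* Defs.v *)
From HB Require Import structures.
From mathcomp Require Import all_boot all_order all_algebra all_fingroup.
From mathcomp Require Import ring lra.
From mathcomp Require Import all_classical all_reals all_analysis.

Set Implicit Arguments.
Unset Strict Implicit.
Unset Printing Implicit Defensive.

Import Order.TTheory GRing.Theory Num.Theory.
Import numFieldNormedType.Exports.

Local Open Scope classical_set_scope.
Local Open Scope ring_scope.

Definition pd (R : realType) (l : 'I_2) (f : 'rV[R]_2 -> R) (w : 'rV[R]_2) : R :=
  'D_(delta_mx 0 l : 'rV[R]_2) f w.

Fixpoint Ck (R : realType) (k : nat) (f : 'rV[R]_2 -> R) : Prop :=
  if k is k'.+1
  then (forall w, differentiable f w) /\ (forall l, Ck k' (pd l f))
  else continuous f.

Definition smooth (R : realType) (f : 'rV[R]_2 -> R) : Prop :=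
  forall k, Ck k f.

(** A [k]-vector field [1/k! \sum A^{i_1 ... i_k} d_{i_1} /\ ... /\ d_{i_k}] is
    encoded by its components: [A w [:: i_1; ...; i_k]] is
    [A(dx_{i_1}, ..., dx_{i_k})] at [w].  A field of degree [k] is required
    (in [is_mvf] below) to vanish on the sequences of length other than [k], so
    that equality of fields is equality of functions. *)
Definition tensor (R : realType) := 'rV[R]_2 -> seq 'I_2 -> R.

Definition permute (T : Type) (s : seq T) (g : 'S_(size s)) : seq T :=
  [seq tnth (in_tuple s) (g i) | i <- enum 'I_(size s)].
Arguments permute {T} s g.

(** For [A] of degree [p] and [B] of degree [q], regarded as alternating
    multiderivations, this is
    [\sum_g (-1)^g A (B (f_{g 1}, ..., f_{g q}), f_{g (q+1)}, ...)]
    over the [(q, p-1)]-shuffles [g], evaluated on coordinate functions.  The sum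
    runs over all permutations and is divided by [q! (p-1)!] instead. *)
Definition circ (R : realType) (p q : nat) (A B : tensor R) : tensor R :=
  fun w s =>
    ((q`! * p.-1`!)%:R)^-1 *
    \sum_(g : 'S_(size s)) (-1) ^+ g *
      \sum_l A w (l :: drop q (permute s g)) *
             pd l (fun v => B v (take q (permute s g))) w.

(** [[A, B] = A o B - (-1)^((p-1)(q-1)) B o A]; the exponent is written so that
    its parity is right for [p = 0] or [q = 0] too. *)
Definition schouten (R : realType) (p q : nat) (A B : tensor R) : tensor R :=
  fun w s => circ p q A B w s - (-1) ^+ (p.+1 * q.+1) * circ q p B A w s.

(** [X_f = {., f}] *)
Definition hamiltonian (R : realType) (P f : tensor R) : tensor R :=
  fun w s =>
    if s is [:: i]
    then \sum_j P w [:: i; j] * pd j (fun v => f v [::]) w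
    else 0.

Definition form2 (R : realType) := 'rV[R]_2 -> 'I_2 -> 'I_2 -> R.

Definition lie_form2 (R : realType) (X : tensor R) (o : form2 R) : form2 R :=
  fun w i j =>
    \sum_l (X w [:: l] * pd l (fun v => o v i j) w
            + pd i (fun v => X v [:: l]) w * o w l j
            + pd j (fun v => X v [:: l]) w * o w i l).

Definition sphere (R : realType) : set 'rV[R]_3 :=
  [set p | \sum_(i < 3) p 0 i ^+ 2 = 1].
Arguments sphere : clear implicits.

Definition sqn (R : realType) (w : 'rV[R]_2) : R := w 0 0 ^+ 2 + w 0 1 ^+ 2.

(** [embed false] is the inverse of [(x1 - i x2) / (1 + x3)], defined away from
    the south pole, and [embed true] the inverse of [(x1 + i x2) / (1 - x3)],
    defined away from the north pole.  Both charts have the whole plane as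
    image, and they are related by [w |-> 1 / w]. *)
Definition embed (R : realType) (b : bool) (w : 'rV[R]_2) : 'rV[R]_3 :=
  \row_(i < 3) tnth [tuple 2 * w 0 0 / (1 + sqn w);
                           - (-1) ^+ b * (2 * w 0 1) / (1 + sqn w);
                           (-1) ^+ b * (1 - sqn w) / (1 + sqn w)] i.

Definition transition (R : realType) (w : 'rV[R]_2) : 'rV[R]_2 :=
  \row_(i < 2) ((-1) ^+ i * w 0 i / sqn w).

(** A field on the sphere, given by its components in the two charts. *)
Definition mvfield (R : realType) := bool -> tensor R.

(** Smooth [k]-vector fields on the sphere; for [k = 0], smooth functions. *)
Record is_mvf (R : realType) (k : nat) (A : mvfield R) : Prop := IsMvf {
  mvf_degree : forall b w s, size s != k -> A b w s = 0;
  mvf_alternating : forall b w s (g : 'S_(size s)),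
    A b w (permute s g) = (-1) ^+ g * A b w s;
  mvf_smooth : forall b s, smooth (fun w => A b w s);
  mvf_compatible : forall b w s, w != 0 ->
    A (~~ b) (transition w) s =
    \sum_(t : (size s).-tuple 'I_2)
      (\prod_(i < size s)
         pd (tnth t i) (fun v => transition v 0 (tnth (in_tuple s) i)) w)
      * A b w t }.

Definition d_poisson (R : realType) (P : mvfield R) (k : nat) (A : mvfield R) :
  mvfield R := fun b => schouten 2 k (P b) (A b).

Definition cocycle (R : realType) (P : mvfield R) (k : nat) (A : mvfield R) : Prop :=
  is_mvf k A /\ d_poisson P k A = (fun _ _ _ => 0).

Definition coboundary (R : realType) (P : mvfield R) (k : nat) (A : mvfield R) :
  Prop :=
  if k is k'.+1 then exists2 B, is_mvf k' B & A = d_poisson P k' B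
  else A = (fun _ _ _ => 0).

(** The classes of [e_1, ..., e_m] form a basis of the quotient of the real
    vector space of [k]-cocycles by that of [k]-coboundaries. *)
Definition cohomology_basis (R : realType) (P : mvfield R) (k m : nat)
    (e : m.-tuple (mvfield R)) : Prop :=
  (forall i, cocycle P k (tnth e i)) /\
  (forall A, cocycle P k A ->
     exists! t : 'rV[R]_m,
       coboundary P k
         (fun b w s => A b w s - \sum_(i < m) t 0 i * tnth e i b w s)).

(** [L_{X_f} o = D(f) o] for all smooth functions [f] on the sphere *)
Definition is_modular (R : realType) (P : mvfield R) (o : bool -> form2 R)
    (D : mvfield R) : Prop :=
  is_mvf 1 D /\
  forall f, is_mvf 0 f -> forall b w i j,
    lie_form2 (hamiltonian (P b) (f b)) (o b) w i j =
    (\sum_l D b w [:: l] * pd l (fun v => f b v [::]) w) * o b w i j.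

Definition one_field (R : realType) : mvfield R :=
  fun _ _ s => if s is [::] then 1 else 0.

Definition eps (R : realType) (s : seq 'I_2) : R :=
  (s == [:: 0; 1])%:R - (s == [:: 1; 0])%:R.

(** [1/4 (1 + x^2 + y^2)^2 d_x /\ d_y]; the expression is the same in both charts
    because [|w|^4] times the square of [1 + |1/w|^2] is that of [1 + |w|^2]. *)
Definition pi_sphere (R : realType) : mvfield R :=
  fun _ w s => (1 + sqn w) ^+ 2 / 4 * eps R s.

Definition area (R : realType) : bool -> form2 R :=
  fun _ w i j => 4 / (1 + sqn w) ^+ 2 * eps R [:: i; j].

Definition necklace (R : realType) (c : R) : mvfield R :=
  fun b w s => (c - embed b w 0 ord_max) * @pi_sphere R b w s.

Arguments one_field : clear implicits.
Arguments pi_sphere : clear implicits.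
Arguments area : clear implicits.

Lemma sqn_ge0 (R : realType) (w : 'rV[R]_2) : 0 <= sqn w.
Proof. by rewrite addr_ge0 ?sqr_ge0. Qed.

Lemma sqn1_neq0 (R : realType) (w : 'rV[R]_2) : 1 + sqn w != 0.
Proof. by rewrite lt0r_neq0// ltr_pwDl ?sqn_ge0. Qed.

Lemma sqn_eq0 (R : realType) (w : 'rV[R]_2) : (sqn w == 0) = (w == 0).
Proof.
rewrite paddr_eq0 ?sqr_ge0// !sqrf_eq0; apply/andP/eqP => [[/eqP h0 /eqP h1]|->].
  apply/rowP => i; rewrite mxE; case: i => [[|[|//]] hi].
    by rewrite (_ : Ordinal hi = 0)//; exact/val_inj.
  by rewrite (_ : Ordinal hi = 1)//; exact/val_inj.
by rewrite !mxE eqxx.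
Qed.

Lemma embedE (R : realType) (b : bool) (w : 'rV[R]_2) :
  [/\ embed b w 0 0 = 2 * w 0 0 / (1 + sqn w),
      embed b w 0 1 = - (-1) ^+ b * (2 * w 0 1) / (1 + sqn w) &
      embed b w 0 ord_max = (-1) ^+ b * (1 - sqn w) / (1 + sqn w)].
Proof. by split; rewrite mxE. Qed.

Lemma embed_sphere (R : realType) (b : bool) (w : 'rV[R]_2) : sphere R (embed b w).
Proof.
have h := sqn1_neq0 w; have [e0 e1 e2] := embedE b w.
rewrite /sphere /= 3!big_ord_recl big_ord0.
rewrite (_ : lift ord0 ord0 = 1); last exact/val_inj.
rewrite (_ : lift ord0 (lift ord0 ord0) = ord_max); last exact/val_inj.
rewrite e0 e1 e2 /sqn in h *; by case: b {e0 e1 e2} => /=; rewrite ?expr1 ?expr0; field.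
Qed.

Lemma embed_surj (R : realType) (b : bool) (p : 'rV[R]_3) :
  sphere R p -> p 0 ord_max != - (-1) ^+ b -> exists w, embed b w = p.
Proof.
rewrite /sphere /= 3!big_ord_recl big_ord0 addr0.
rewrite (_ : lift ord0 ord0 = 1); last exact/val_inj.
rewrite (_ : lift ord0 (lift ord0 ord0) = ord_max); last exact/val_inj.
set x := p 0 _; set y := p 0 1; set z := p 0 ord_max => hp hz.
pose u : R := 1 + (-1) ^+ b * z.
have hu : u != 0.
  rewrite /u; apply: contraNneq hz; case: (b) => /= h;
    rewrite ?expr1 ?expr0 in h *; apply/eqP; lra.
exists (\row_(i < 2) tnth [tuple x / u; - (-1) ^+ b * y / u] i).
set w := \row_(_ < _) _.
have w0 : w 0 0 = x / u by rewrite mxE.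
have w1 : w 0 1 = - (-1) ^+ b * y / u by rewrite mxE.
have hx : x ^+ 2 + y ^+ 2 = u * (2 - u).
  by rewrite /u; case: (b); rewrite /= ?expr1 ?expr0; lra.
have bb : ((-1) ^+ b : R) ^+ 2 = 1 by rewrite sqrr_sign.
have hs : sqn w = (2 - u) / u.
  rewrite /sqn w0 w1 !expr_div_n exprMn sqrrN bb mul1r -mulrDl hx.
  by field.
have h1 : 1 + sqn w = 2 / u by rewrite hs; field.
have [e0 e1 e2] := embedE b w.
apply/rowP => i; case: i => [[|[|[|//]]] hi].
- rewrite (_ : Ordinal hi = 0); last exact/val_inj.
  by rewrite e0 h1 w0 -/x; field.
- rewrite (_ : Ordinal hi = 1); last exact/val_inj.
  rewrite e1 h1 w1 -/y.
  by case: (b); rewrite /= ?expr1 ?expr0; field.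
- rewrite (_ : Ordinal hi = ord_max); last exact/val_inj.
  rewrite e2 h1 hs -/z [z](_ : _ = (-1) ^+ b * (u - 1)); last first.
    by rewrite /u; case: (b); rewrite /= ?expr1 ?expr0; ring.
  by case: (b); rewrite /= ?expr1 ?expr0; field.
Qed.

Lemma embed_transition (R : realType) (b : bool) (w : 'rV[R]_2) :
  w != 0 -> embed (~~ b) (transition w) = embed b w.
Proof.
rewrite -sqn_eq0 => h; have h1 := sqn1_neq0 w.
have t0 : transition w 0 0 = w 0 0 / sqn w by rewrite mxE expr0 mul1r.
have t1 : transition w 0 1 = - w 0 1 / sqn w by rewrite mxE expr1 mulN1r.
have hs : sqn (transition w) = (sqn w)^-1.
  rewrite {1}/sqn t0 t1 !expr_div_n sqrrN -mulrDl -/(sqn w).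
  by field.
have [e0 e1 e2] := embedE b w.
have [f0 f1 f2] := embedE (~~ b) (transition w).
have h2 : sqn w + 1 != 0 by rewrite addrC.
apply/rowP => i; case: i => [[|[|[|//]]] hi].
- rewrite (_ : Ordinal hi = 0); last exact/val_inj.
  by rewrite e0 f0 hs t0; field; rewrite ?h ?h1 ?h2.
- rewrite (_ : Ordinal hi = 1); last exact/val_inj.
  rewrite e1 f1 hs t1.
  by case: (b); rewrite /= ?expr1 ?expr0; field; rewrite ?h ?h1 ?h2.
- rewrite (_ : Ordinal hi = ord_max); last exact/val_inj.
  rewrite e2 f2 hs.
  by case: (b); rewrite /= ?expr1 ?expr0; field; rewrite ?h ?h1 ?h2.
Qed.

Lemma area_pi_sphere (R : realType) (b : bool) (w : 'rV[R]_2) :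
  area R b w 0 1 * pi_sphere R b w [:: 0; 1] = 1.
Proof.
have h := sqn1_neq0 w.
rewrite /area /pi_sphere (_ : eps R [:: 0; 1] = 1) /eps ?subr0//.
by rewrite !mulr1; field.
Qed.

Lemma is_derive_coord (R : realType) (i l : 'I_2) (w : 'rV[R]_2) :
  is_derive w (delta_mx 0 l : 'rV[R]_2) (fun v : 'rV[R]_2 => v 0 i) (i == l)%:R.
Proof.
have d : differentiable (fun v : 'rV[R]_2 => v 0 i) w by exact: differentiable_coord.
apply: DeriveDef; first exact: diff_derivable.
have := @derive_mx R _ 1 2 id w (delta_mx 0 l) (@derivable_id _ _ _ _).
rewrite derive_id => /rowP /(_ i); rewrite !mxE eqxx /= => ->.
by [].
Qed.

Lemma pd_quot (R : realType) (a : R) (u : 'rV[R]_2 -> R) (du : R) (l : 'I_2)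
    (w : 'rV[R]_2) :
  is_derive w (delta_mx 0 l : 'rV[R]_2) u du ->
  is_derive w (delta_mx 0 l : 'rV[R]_2) (fun v => a * u v / (1 + sqn v))
    (a * (du / (1 + sqn w) - u w * (2 * w 0 l) / (1 + sqn w) ^+ 2)).
Proof.
move=> hu; have h := sqn1_neq0 w.
have hx i := @is_derive_coord R i l w.
have hq : is_derive w (delta_mx 0 l : 'rV[R]_2) (fun v : 'rV[R]_2 => 1 + sqn v)
    (2 * w 0 l).
  rewrite (_ : (fun v => 1 + sqn v) = cst 1 +
     ((fun v : 'rV[R]_2 => v 0 0) ^+ 2 + (fun v : 'rV[R]_2 => v 0 1) ^+ 2)); last first.
    by apply/funext => v; rewrite /sqn !fctE.
  have H := is_deriveD (is_derive_cst (1 : R) w (delta_mx 0 l : 'rV[R]_2)) (is_deriveD (is_deriveX 2 (hx 0)) (is_deriveX 2 (hx 1))).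
  have [D0 E0] := H; apply: DeriveDef; [exact: D0|rewrite E0].
  rewrite add0r !expr1 /GRing.scale /=.
  have [->|->] : l = 0 \/ l = 1.
    by case: l {hu hx H D0 E0} => [[|[|//]] hl]; [left|right]; exact/val_inj.
  - by rewrite (_ : (0 == 0 :> 'I_2) = true) // (_ : (1 == 0 :> 'I_2) = false) // mulr1 mulr0 addr0.
  - by rewrite (_ : (0 == 1 :> 'I_2) = false) // (_ : (1 == 1 :> 'I_2) = true) // mulr1 mulr0 add0r.
have [dq eq] := hq; have [d e] := hu.
have hi : is_derive w (delta_mx 0 l : 'rV[R]_2) (fun v : 'rV[R]_2 => (1 + sqn v)^-1)
    (- (2 * w 0 l) / (1 + sqn w) ^+ 2).
  have D2 := @derivableV _ _ (fun v : 'rV[R]_2 => 1 + sqn v) w _ h dq.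
  have E2 := @deriveV _ _ (fun v : 'rV[R]_2 => 1 + sqn v) w _ h dq.
  apply: DeriveDef; first exact: D2.
  by rewrite E2 eq /GRing.scale /=; field.
have H := is_deriveM (is_deriveZ a hu) hi.
have [D1 E1] := H.
rewrite (_ : (fun v => a * u v / _) = (a \*: u) * (fun v : 'rV[R]_2 => (1 + sqn v)^-1)); last first.
  by apply/funext.
apply: DeriveDef; first exact: D1.
rewrite E1 (_ : (a \*: u) w = a * u w) // /GRing.scale /=; field.
by rewrite h.
Qed.

Lemma sum_pi_sphere (R : realType) (b : bool) (w : 'rV[R]_2) (p q : 'I_2 -> R) :
  \sum_i \sum_j pi_sphere R b w [:: i; j] * p i * q j =
  (1 + sqn w) ^+ 2 / 4 * (p 0 * q 1 - p 1 * q 0).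
Proof.
have S2 (F : 'I_2 -> R) : \sum_i F i = F 0 + F 1.
  by rewrite big_ord_recl big_ord_recl big_ord0 addr0;
    congr (F _ + F _); exact/val_inj.
transitivity (\sum_i (pi_sphere R b w [:: i; 0] * p i * q 0 +
                      pi_sphere R b w [:: i; 1] * p i * q 1)).
  by apply: eq_bigr => i _; exact: S2.
apply: etrans (S2 _) _; rewrite /pi_sphere /eps /=.
move: (sqn w) (p 0) (p 1) (q 0) (q 1) => n p0 p1 q0 q1.
ring.
Qed.

(** [- pi_sphere] is the restriction to the sphere of the bivector field
    [x1 d2 /\ d3 + x2 d3 /\ d1 + x3 d1 /\ d2]. *)
Lemma pi_sphere_embed (R : realType) (b : bool) (w : 'rV[R]_2) :
  let br k l := \sum_i \sum_j pi_sphere R b w [:: i; j]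
    * pd i (fun v => embed b v 0 k) w * pd j (fun v => embed b v 0 l) w in
  [/\ br 1 ord_max = - embed b w 0 0,
      br ord_max 0 = - embed b w 0 1 & br 0 1 = - embed b w 0 ord_max].
Proof.
have h := sqn1_neq0 w.
have e0 l : pd l (fun v => embed b v 0 0) w =
    2 * ((0 == l)%:R / (1 + sqn w) - w 0 0 * (2 * w 0 l) / (1 + sqn w) ^+ 2).
  have [_ E] := pd_quot 2 (is_derive_coord 0 l w).
  rewrite /pd (_ : (fun v => embed b v 0 0) = (fun v => 2 * v 0 0 / (1 + sqn v))) ?E //.
  by apply/funext => v; have [-> _ _] := embedE b v.
have e1 l : pd l (fun v => embed b v 0 1) w = (- (-1) ^+ b * 2) *
    ((1 == l)%:R / (1 + sqn w) - w 0 1 * (2 * w 0 l) / (1 + sqn w) ^+ 2).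
  have [_ E] := pd_quot (- (-1) ^+ b * 2) (is_derive_coord 1 l w).
  rewrite /pd (_ : (fun v => embed b v 0 1) =
    (fun v => - (-1) ^+ b * 2 * v 0 1 / (1 + sqn v))) ?E //.
  by apply/funext => v; have [_ -> _] := embedE b v; rewrite !mulrA.
have e2 l : pd l (fun v => embed b v 0 ord_max) w =
    - (-1) ^+ b * 2 * (2 * w 0 l) / (1 + sqn w) ^+ 2.
  have := pd_quot ((-1) ^+ b * 2) (is_derive_cst (1 : R) w (delta_mx 0 l : 'rV[R]_2)).
  rewrite mul0r sub0r mul1r => E.
  have [_ E1] := is_deriveD (is_derive_cst (- (-1) ^+ b : R) w (delta_mx 0 l : 'rV[R]_2)) E.
  rewrite add0r mulrN mulrA -!mulNr in E1; 
  rewrite /pd (_ : (fun v => embed b v 0 ord_max) = cst (- (-1) ^+ b) +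
    (fun v => (-1) ^+ b * 2 * cst 1 v / (1 + sqn v))) ?E1 //.
  apply/funext => v; have [_ _ ->] := embedE b v; rewrite fctE /=.
  by have := sqn1_neq0 v => hv; field.
move=> br; rewrite /br !sum_pi_sphere !e0 !e1 !e2.
have [-> -> ->] := embedE b w.
rewrite (_ : (0 == 0 :> 'I_2) = true) // (_ : (1 == 0 :> 'I_2) = false) //.
rewrite (_ : (0 == 1 :> 'I_2) = false) // (_ : (1 == 1 :> 'I_2) = true) //.
move: h; rewrite /sqn; move: (w 0 0) (w 0 1) => x y h.
have hs : ((-1) ^+ b : R) = 1 \/ ((-1) ^+ b : R) = -1.
  by case: (b); [right; rewrite expr1|left; rewrite expr0].
rewrite (_ : true%:R = 1 :> R) // (_ : false%:R = 0 :> R) //.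
by case: hs => ->; split; field.
Qed.

Lemma permute1 (x : 'I_2) (g : 'S_1) : permute [:: x] g = [:: x].
Proof.
rewrite /permute enum_ordSl /= (_ : enum 'I_0 = [::]) /=.
  by rewrite (_ : g ord0 = ord0) ?ord1.
by apply: size0nil; rewrite size_enum_ord.
Qed.

Lemma sum_perm1 (R : realType) (x : 'I_2) (F : 'S_1 -> R) : \sum_g F g = F 1%g.
Proof.
rewrite (bigD1 1%g) //= big1 ?addr0 // => g /negP[]; apply/eqP.
by apply/permP => i; rewrite !ord1.
Qed.

Lemma d_poisson0 (R : realType) (P f : mvfield R) (b : bool) (w : 'rV[R]_2)
    (j : 'I_2) :
  is_mvf 0 f ->
  d_poisson P 0 f b w [:: j] =
  \sum_l P b w [:: l; j] * pd l (fun v => f b v [::]) w.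
Proof.
move=> /mvf_degree hf; rewrite /d_poisson /schouten /circ /=.
rewrite !(@sum_perm1 _ j) permute1 odd_perm1 /= expr0 !mul1r.
rewrite [X in _ - _ * (_ * X)]big1 ?mulr0 ?subr0; last by move=> l _; rewrite hf ?mul0r.
by rewrite fact0 muln1 invr1 mul1r.
Qed.

Lemma schouten_vector_fields (R : realType) (X Y : tensor R) (w : 'rV[R]_2)
    (j : 'I_2) :
  schouten 1 1 X Y w [:: j] =
  \sum_l X w [:: l] * pd l (fun v => Y v [:: j]) w
  - \sum_l Y w [:: l] * pd l (fun v => X v [:: j]) w.
Proof.
rewrite /schouten /circ /= !(@sum_perm1 _ j) permute1 odd_perm1 /= expr0 !mul1r.
rewrite (_ : (-1) ^+ (2 * 2) = 1 :> R); last by rewrite -signr_odd.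
by rewrite !mul1r fact0 muln1 invr1 !mul1r.
Qed.

(* Main.v *)
Require Import Defs.
From HB Require Import structures.
From mathcomp Require Import all_boot all_order all_algebra all_fingroup.
From mathcomp Require Import ring lra.
From mathcomp Require Import all_classical all_reals all_analysis.

(** Write [h = c - x_3]. The coboundary of a vector field [X] is, up to the factor [-pi],
    [X(h) - h div X], and that of a function [f] is, up to sign, [h] times its Hamiltonian
    field for [pi].
    A function on the sphere is, up to its average over the rotations about the [x_3]-axis,
    the angular derivative of an explicit smooth function, so that every class can be reduced
    to a rotation invariant one. For invariant fields the equations are ordinary differential
    equations in [x_3]: the condition that the radial component vanishes at both poles gives
    the independence of the classes, and they are solved by dividing by [h] the invariant
    functions that vanish on the circle (Hadamard's lemma) and by integrating along the
    meridians; the primitives obtained in the two charts differ by a constant, which is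
    compensated by the classes that survive. *)

(** The obstacle is the poles: polar coordinates are singular there, and a field on the sphere has
    to be smooth in both stereographic charts. The divergence is therefore multiplied by |w|^2 and
    written with the Euler derivative [euler] and the angular derivative [dtheta], which are smooth
    at the origin and change sign under w -> 1/w. Identities between continuous functions are proved
    off a circle or off the origin and extended by density, which also allows [h] to be cancelled.
    The constant by which the primitives of the two charts differ is harmless in degree 1, where it
    is subtracted from the Hamiltonian function in one chart. In degree 2 it is twice the mean over
    the sphere of a function that should be a divergence, and it fixes the coefficient of [pi],
    whereas the coefficient of [pi_c] is the value of a rotation invariant function on the circle.
    In degree 1 the coefficient of the modular field is likewise an angular velocity on the circle,
    where Hamiltonian fields vanish. *)

Set Implicit Arguments.
Unset Strict Implicit.
Unset Printing Implicit Defensive.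
Import Order.TTheory GRing.Theory Num.Theory.
Import numFieldNormedType.Exports.
Local Open Scope classical_set_scope.
Local Open Scope ring_scope.

(** * Differential calculus of functions on the plane *)

Section plane_calculus.
Context {R : realType}.
Implicit Types (f g : 'rV[R]_2 -> R) (w v : 'rV[R]_2) (U : set 'rV[R]_2).

Definition pt (x y : R) : 'rV[R]_2 := x *: delta_mx 0 0 + y *: delta_mx 0 1.

Lemma pt0 x y : pt x y 0 0 = x.
Proof. by rewrite !mxE /= mulr1 mulr0 addr0. Qed.

Lemma pt1 x y : pt x y 0 1 = y.
Proof. by rewrite !mxE /= mulr0 mulr1 add0r. Qed.

Lemma ord2P (P : 'I_2 -> Prop) : P 0 -> P 1 -> forall i, P i.
Proof.
move=> P0 P1 [[|[|//]] hi]; first by rewrite (_ : Ordinal hi = 0)//; exact/val_inj.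
by rewrite (_ : Ordinal hi = 1)//; exact/val_inj.
Qed.

Lemma sum2E (V : nmodType) (F : 'I_2 -> V) : \sum_i F i = F 0 + F 1.
Proof.
by rewrite !big_ord_recl big_ord0 addr0; congr (F _ + F _); exact/val_inj.
Qed.

Lemma row2E w : w = pt (w 0 0) (w 0 1).
Proof. by apply/rowP; apply: ord2P; rewrite ?pt0 ?pt1. Qed.

Lemma sqn_pt x y : sqn (pt x y) = x ^+ 2 + y ^+ 2.
Proof. by rewrite /sqn pt0 pt1. Qed.

Lemma diff_pd f w v : differentiable f w ->
  'd f w v = v 0 0 * pd 0 f w + v 0 1 * pd 1 f w.
Proof.
by move=> df; rewrite {1}[v]row2E /pt linearD !linearZ /pd !deriveE.
Qed.

Lemma is_diff_pt (V : normedModType R) (p q : V -> R) (x : V) f :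
  differentiable p x -> differentiable q x -> differentiable f (pt (p x) (q x)) ->
  is_diff x (fun u => f (pt (p u) (q u)))
    (fun u => 'd p x u * pd 0 f (pt (p x) (q x)) + 'd q x u * pd 1 f (pt (p x) (q x))).
Proof.
move=> dp dq df.
have dh : is_diff x (fun u => pt (p u) (q u)) (fun u => pt ('d p x u) ('d q x u)).
  have h1 : is_diff x (fun u => p u *: (delta_mx 0 0 : 'rV[R]_2))
      (fun u => 'd p x u *: (delta_mx 0 0 : 'rV[R]_2)).
    by apply: DiffDef; [exact: differentiableZl|exact: diffZl].
  have h2 : is_diff x (fun u => q u *: (delta_mx 0 1 : 'rV[R]_2))
      (fun u => 'd q x u *: (delta_mx 0 1 : 'rV[R]_2)).
    by apply: DiffDef; [exact: differentiableZl|exact: diffZl].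
  exact: is_diffD.
have d1 : is_diff (pt (p x) (q x)) f ('d f (pt (p x) (q x))).
  by apply: DiffDef.
have := @is_diff_comp _ _ _ _ _ _ _ _ _ dh d1.
rewrite [X in is_diff _ _ X](_ : _ = (fun u => 'd p x u * pd 0 f (pt (p x) (q x)) + 'd q x u * pd 1 f (pt (p x) (q x))))//.
by apply/funext => u; rewrite /comp diff_pd// pt0 pt1.
Qed.

Lemma is_derive_pt (p q : R -> R) (t dp dq : R) f :
  is_derive t 1 p dp -> is_derive t 1 q dq -> differentiable f (pt (p t) (q t)) ->
  is_derive t 1 (fun u => f (pt (p u) (q u)))
    (dp * pd 0 f (pt (p t) (q t)) + dq * pd 1 f (pt (p t) (q t))).
Proof.
move=> [p1 <-] [q1 <-] df.
have p2 : differentiable p t by exact/derivable1_diffP.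
have q2 : differentiable q t by exact/derivable1_diffP.
have [d e] := is_diff_pt p2 q2 df.
apply: DeriveDef; first exact: diff_derivable.
by rewrite deriveE// e !deriveE.
Qed.

Lemma pd_pt (p q : 'rV[R]_2 -> R) l w f :
  differentiable p w -> differentiable q w -> differentiable f (pt (p w) (q w)) ->
  pd l (fun u => f (pt (p u) (q u))) w =
  pd l p w * pd 0 f (pt (p w) (q w)) + pd l q w * pd 1 f (pt (p w) (q w)).
Proof.
move=> dp dq df; have [d e] := is_diff_pt dp dq df.
by rewrite /pd deriveE// e -!deriveE.
Qed.

Lemma pdD l f g w : differentiable f w -> differentiable g w ->
  pd l (fun u => f u + g u) w = pd l f w + pd l g w.
Proof. by move=> df dg; rewrite /pd deriveD//; exact: diff_derivable. Qed.

Lemma pdB l f g w : differentiable f w -> differentiable g w ->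
  pd l (fun u => f u - g u) w = pd l f w - pd l g w.
Proof. by move=> df dg; rewrite /pd deriveB//; exact: diff_derivable. Qed.

Lemma pdN l f w : differentiable f w -> pd l (fun u => - f u) w = - pd l f w.
Proof. by move=> df; rewrite /pd deriveN//; exact: diff_derivable. Qed.

Lemma pdM l f g w : differentiable f w -> differentiable g w ->
  pd l (fun u => f u * g u) w = f w * pd l g w + g w * pd l f w.
Proof. by move=> df dg; rewrite /pd deriveM//; exact: diff_derivable. Qed.

Lemma pdZ l f (a : R) w : differentiable f w ->
  pd l (fun u => a * f u) w = a * pd l f w.
Proof. by move=> df; rewrite /pd [LHS]deriveZ//; exact: diff_derivable. Qed.

Lemma pd_cst l (a : R) w : pd l (fun=> a) w = 0.
Proof. exact: derive_cst. Qed.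

Lemma pdV l f w : differentiable f w -> f w != 0 ->
  pd l (fun u => (f u)^-1) w = - (f w) ^- 2 * pd l f w.
Proof. by move=> df f0; rewrite /pd [LHS]deriveV//; exact: diff_derivable. Qed.

Lemma pd_coord l (i : 'I_2) w : pd l (fun u => u 0 i) w = (i == l)%:R.
Proof. by have [_ E] := is_derive_coord i l w. Qed.

Lemma pd_near l f g w : {near w, f =1 g} -> pd l f w = pd l g w.
Proof. by move=> fg; rewrite /pd; apply: near_eq_derive. Qed.


(** A criterion with the candidate partial derivatives given in advance. It serves to replace a
    function by one that agrees with it near [w], and to differentiate under the integral sign. *)
Lemma differentiableP_eps f w (a b : R) :
  (forall e : R, 0 < e -> \forall h \near (0 : 'rV[R]_2),
     `|f (h + w) - f w - (h 0 0 * a + h 0 1 * b)| <= e * `|h|) ->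
  [/\ differentiable f w, pd 0 f w = a & pd 1 f w = b].
Proof.
move=> H; pose L (h : 'rV[R]_2) := h 0 0 * a + h 0 1 * b.
have Llin : linear L by move=> k u v; rewrite /L !mxE /GRing.scale /=; ring.
pose L1 := GRing.isLinear.Build _ _ _ _ L Llin.
pose LL : {linear 'rV[R]_2 -> R} := HB.pack L L1.
have Lc : continuous LL.
  have Lc i k : continuous (fun h : 'rV[R]_2 => h 0 i * k : R).
    move=> u; have c1 : {for u, continuous (fun h : 'rV[R]_2 => h 0 i : R)}.
      by apply: differentiable_continuous; exact: differentiable_coord.
    exact: cvgM c1 (cvg_cst k).
  by move=> u; exact: cvgD (Lc 0 a u) (Lc 1 b u).
have E : f \o shift w = cst (f w) + LL +o_ (0 : 'rV[R]_2) id.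
  apply/eqaddoP => e e0; near=> h.
  rewrite [X in `|X|](_ : _ = f (h + w) - f w - (h 0 0 * a + h 0 1 * b)).
    by near: h; exact: H.
  by rewrite -addrA -opprD.
have D := diff_unique Lc E.
have df : differentiable f w by apply/diff_locallyP; rewrite D.
by split=> //; rewrite /pd deriveE// D /= /L !mxE /=; ring.
Unshelve. all: by end_near. Qed.

Lemma differentiable_epsP f w : differentiable f w ->
  forall e : R, 0 < e -> \forall h \near (0 : 'rV[R]_2),
     `|f (h + w) - f w - (h 0 0 * pd 0 f w + h 0 1 * pd 1 f w)| <= e * `|h|.
Proof.
move=> df e e0; have /eqaddoP/(_ _ e0) H := diff_locally df.
near=> h; rewrite -diff_pd// -addrA -opprD.
by near: h; exact: H.
Unshelve. all: by end_near. Qed.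

Lemma differentiable_near f g w : {near w, f =1 g} ->
  differentiable f w -> differentiable g w.
Proof.
move=> fg df; have gw := nbhs_singleton fg.
have := @differentiableP_eps g w (pd 0 f w) (pd 1 f w).
case=> // e e0; near=> h.
rewrite -gw -(_ : f (h + w) = g (h + w)); last first.
  rewrite [h + w]addrC; near: h.
  exact: (proj1 (nbhs0P (fun x => f x = g x) w) fg).
by near: h; exact: differentiable_epsP.
Unshelve. all: by end_near. Qed.

(** The quotient in Hadamard's lemma is smooth for different reasons on two open sets, hence a local
    notion. It still speaks of functions on the whole plane; for open [U] only the values on [U]
    matter, by [CkOn_eq]. *)
Fixpoint CkOn U (k : nat) f : Prop :=
  if k is k'.+1
  then (forall w, U w -> differentiable f w) /\ (forall l, CkOn U k' (pd l f))
  else forall w, U w -> {for w, continuous f}.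

Lemma CkOn_setT k f : CkOn setT k f <-> Ck k f.
Proof.
elim: k f => [|k IH] f /=; first by split=> [h w|h w _]; apply: h.
by split=> -[h1 h2]; split=> [w|l]; (try by move=> *; apply: h1); apply/IH.
Qed.

Lemma CkOn_sub U V k f : U `<=` V -> CkOn V k f -> CkOn U k f.
Proof.
move=> UV; elim: k f => [|k IH] f /=; first by move=> h w /UV; exact: h.
by move=> [h1 h2]; split=> [w /UV|l]; [exact: h1|exact: IH].
Qed.

Lemma CkOn_setU U V k f : CkOn U k f -> CkOn V k f -> CkOn (U `|` V) k f.
Proof.
elim: k f => [|k IH] f /=; first by move=> h1 h2 w [/h1|/h2].
by move=> [h1 h2] [h3 h4]; split=> [w [/h1|/h3]|l] //; exact: IH.
Qed.

Lemma CkOn_le U k f : CkOn U k.+1 f -> CkOn U k f.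
Proof.
elim: k f => [|k IH] f; last by move=> [h1 h2]; split=> // l; exact: IH.
by move=> [h1 _] w /h1; exact: differentiable_continuous.
Qed.

Lemma CkOn_eq U k f g : open U -> (forall w, U w -> f w = g w) ->
  CkOn U k f -> CkOn U k g.
Proof.
move=> oU; have near_U f' g' w : (forall w, U w -> f' w = g' w) -> U w -> {near w, f' =1 g'}.
  by move=> fg Uw; apply: filterS (open_nbhs_nbhs (conj oU Uw)) => u; exact: fg.
elim: k f g => [|k IH] f g fg /=.
  move=> h w Uw; have fc : f @ w --> g w by rewrite -fg//; exact: h.
  apply: (@cvg_trans _ (f @ w)); last exact: fc.
  by apply: (@near_eq_cvg _ _ (nbhs w)); exact: near_U.
move=> [h1 h2]; split=> [w Uw|l].
  exact: differentiable_near (near_U _ _ _ fg Uw) (h1 w Uw).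
by apply: IH (h2 l) => w Uw; exact: pd_near (near_U _ _ _ fg Uw).
Qed.

Lemma CkOn_cst U k (a : R) : CkOn U k (fun=> a).
Proof.
elim: k a => [|k IH] a /=; first by move=> w _; exact: cst_continuous.
split=> [w _|l]; first exact: differentiable_cst.
by rewrite (_ : pd l _ = fun=> 0)//; apply/funext => w; rewrite pd_cst.
Qed.

Lemma CkOn_coord U k (i : 'I_2) : CkOn U k (fun w => w 0 i).
Proof.
have dc w : differentiable (fun w : 'rV[R]_2 => w 0 i : R) w.
  exact: differentiable_coord.
case: k => [|k] /=; first by move=> w _; exact: differentiable_continuous.
split=> // l; rewrite (_ : pd l _ = fun=> (i == l)%:R); first exact: CkOn_cst.
by apply/funext => w; rewrite pd_coord.
Qed.

Lemma CkOnD U k f g : open U -> CkOn U k f -> CkOn U k g ->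
  CkOn U k (fun w => f w + g w).
Proof.
move=> oU; elim: k f g => [|k IH] f g /=.
  by move=> h1 h2 w Uw; exact: cvgD (h1 w Uw) (h2 w Uw).
move=> [h1 h2] [h3 h4]; split=> [w Uw|l]; first exact: differentiableD (h1 w Uw) (h3 w Uw).
apply: CkOn_eq (IH _ _ (h2 l) (h4 l)) => // w Uw.
by rewrite pdD//; [exact: h1|exact: h3].
Qed.

Lemma CkOnM U k f g : open U -> CkOn U k f -> CkOn U k g ->
  CkOn U k (fun w => f w * g w).
Proof.
move=> oU; elim: k f g => [|k IH] f g.
  by move=> h1 h2 w Uw; exact: cvgM (h1 w Uw) (h2 w Uw).
move=> hf hg; have [h1 h2] := hf; have [h3 h4] := hg.
split=> [w Uw|l]; first exact: differentiableM (h1 w Uw) (h3 w Uw).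
apply: CkOn_eq (CkOnD oU (IH _ _ (CkOn_le hf) (h4 l)) (IH _ _ (CkOn_le hg) (h2 l))) => // w Uw.
by rewrite pdM//; [exact: h1|exact: h3].
Qed.

Lemma CkOnN U k f : open U -> CkOn U k f -> CkOn U k (fun w => - f w).
Proof.
move=> oU hf; apply: CkOn_eq (CkOnM oU (CkOn_cst U k (-1)) hf) => // w _.
by rewrite mulN1r.
Qed.

Lemma CkOnB U k f g : open U -> CkOn U k f -> CkOn U k g ->
  CkOn U k (fun w => f w - g w).
Proof. by move=> oU hf hg; exact: CkOnD oU hf (CkOnN oU hg). Qed.

Lemma CkOnX U k f n : open U -> CkOn U k f -> CkOn U k (fun w => f w ^+ n).
Proof.
move=> oU hf; elim: n => [|n IH]; first exact: CkOn_cst.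
by apply: CkOn_eq (CkOnM oU hf IH) => // w _; rewrite exprS.
Qed.

Lemma CkOnV U k f : open U -> (forall w, U w -> f w != 0) -> CkOn U k f ->
  CkOn U k (fun w => (f w)^-1).
Proof.
move=> oU f0; elim: k => [|k IH].
  by move=> h w Uw; exact: cvgV (f0 w Uw) (h w Uw).
move=> hf; have [h1 h2] := hf; split=> [w Uw|l].
  exact: differentiableV (h1 w Uw) (f0 w Uw).
have hi := IH (CkOn_le hf).
apply: CkOn_eq (CkOnM oU (CkOnN oU (CkOnX 2 oU hi)) (h2 l)) => // w Uw.
by rewrite pdV ?exprVn//; [exact: h1|exact: f0].
Qed.

Lemma CkOn_pt U V k (p q : 'rV[R]_2 -> R) f : open U ->
  (forall w, U w -> V (pt (p w) (q w))) ->
  CkOn U k p -> CkOn U k q -> CkOn V k f -> CkOn U k (fun w => f (pt (p w) (q w))).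
Proof.
move=> oU UV; elim: k f => [|k IH] f.
  move=> hp hq hf w Uw.
  have cpt : {for w, continuous (fun w => pt (p w) (q w))}.
    exact: cvgD (cvgZr_tmp (hp w Uw)) (cvgZr_tmp (hq w Uw)).
  exact: (@continuous_comp _ _ _ (fun w => pt (p w) (q w)) f w cpt (hf _ (UV _ Uw))).
move=> hp hq hf; have [h1 h2] := hf; have [p1 p2] := hp; have [q1 q2] := hq.
split=> [w Uw|l].
  by have [] := is_diff_pt (p1 w Uw) (q1 w Uw) (h1 _ (UV _ Uw)).
have hc l' := IH _ (CkOn_le hp) (CkOn_le hq) (h2 l').
apply: CkOn_eq (CkOnD oU (CkOnM oU (p2 l) (hc 0)) (CkOnM oU (q2 l) (hc 1))) => // w Uw.
by rewrite (pd_pt _ (p1 w Uw) (q1 w Uw) (h1 _ (UV _ Uw))).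
Qed.

(** The derivative [f' / (2 sqrt f)] involves only [f'] and [sqrt f] itself, so each order of
    smoothness gives the next one. *)
Lemma CkOn_sqrt U k f : open U -> (forall w, U w -> 0 < f w) -> CkOn U k f ->
  CkOn U k (fun w => Num.sqrt (f w)).
Proof.
move=> oU f0; elim: k => [|k IH].
  move=> h w Uw; apply: (@continuous_comp _ _ _ f Num.sqrt); first exact: h.
  exact: sqrt_continuous.
move=> hf; have [h1 h2] := hf.
have ds w : U w -> is_diff w (fun w => Num.sqrt (f w)) (fun u => 'd f w u * (2 * Num.sqrt (f w))^-1).
  move=> Uw; have [d1 e1] := is_derive1_sqrt (f0 w Uw).
  have d2 : differentiable (@Num.sqrt R) (f w) by apply/derivable1_diffP.
  have d3 : is_diff w f ('d f w) by apply: DiffDef => //; exact: h1.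
  have d4 : is_diff (f w) (@Num.sqrt R) ('d Num.sqrt (f w)) by apply: DiffDef.
  have := @is_diff_comp _ _ _ _ _ _ _ _ _ d3 d4.
  rewrite (_ : 'd Num.sqrt (f w) \o 'd f w = (fun u => 'd f w u * (2 * Num.sqrt (f w))^-1))//.
  apply/funext => u; rewrite /comp -[X in 'd Num.sqrt _ X]mulr1 [LHS]linearZ /=.
  by move: e1; rewrite deriveE// => ->.
split=> [w /ds[]//|l].
have hi := IH (CkOn_le hf).
have s0 w : U w -> 2 * Num.sqrt (f w) != 0.
  by move=> Uw; rewrite mulf_neq0// gt_eqF// sqrtr_gt0 f0.
apply: CkOn_eq (CkOnM oU (h2 l) (CkOnV oU s0 (CkOnM oU (CkOn_cst U k 2) hi))) => // w Uw.
by have [d e] := ds w Uw; rewrite [RHS]/pd deriveE// e -deriveE//; exact: h1.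
Qed.

Definition smoothOn U f := forall k, CkOn U k f.

Lemma smoothE f : smooth f <-> smoothOn setT f.
Proof. by split=> h k; apply/CkOn_setT. Qed.

Lemma smooth_pd l f : smooth f -> smooth (pd l f).
Proof. by move=> h k; have [_ h'] := h k.+1; exact: h'. Qed.

Lemma smooth_diff f w : smooth f -> differentiable f w.
Proof. by move=> h; have [h' _] := h 1; exact: h'. Qed.

Lemma smooth_continuous f : smooth f -> continuous f.
Proof. by move=> /(_ 0). Qed.

End plane_calculus.

Local Opaque pd.

(** * Integration of continuous functions over the unit interval *)

Section unit_interval_integral.
Context {R : realType}.
Implicit Types g : R -> R.

Lemma is_derive_mulR (f g : R -> R) (t a b : R) : is_derive t 1 f a -> is_derive t 1 g b ->
  is_derive t 1 (fun t => f t * g t) (f t * b + g t * a).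
Proof. exact: is_deriveM. Qed.

Lemma MVT01 (G dG : R -> R) : (forall t : R, is_derive t 1 G (dG t)) ->
  exists2 t, 0 <= t <= 1 & G 1 - G 0 = dG t.
Proof.
move=> GP; have Gc : continuous G.
  move=> t; apply: differentiable_continuous; apply/derivable1_diffP.
  by have [] := GP t.
have [t] := @MVT_segment R G dG 0 1 ler01 (fun t _ => GP t) (continuous_subspaceT Gc).
by rewrite in_itv /= subr0 mulr1 => t01 ->; exists t.
Qed.

Definition int01 g : R := Rintegral (@lebesgue_measure R) `[0, 1] g.

Lemma int01_integrable g : continuous g ->
  (@lebesgue_measure R).-integrable `[0, 1] (EFin \o g).
Proof.
move=> gc; apply: continuous_compact_integrable; first exact: segment_compact.
exact: continuous_subspaceT.
Qed.

Lemma int01_FTC g (G : R -> R) : continuous g ->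
  (forall t : R, is_derive t 1 G (g t)) -> int01 g = G 1 - G 0.
Proof.
move=> gc dG; have Gc : continuous G.
  move=> t; apply: differentiable_continuous; apply/derivable1_diffP.
  by have [] := dG t.
rewrite /int01 /Rintegral (@continuous_FTC2 _ g G 0 1)//.
- exact: continuous_subspaceT.
- split=> [t _||]; first by have [] := dG t.
  + exact: cvg_at_right_filter (Gc _).
  + exact: cvg_at_left_filter (Gc _).
- by move=> t _; rewrite derive1E; have [_ ->] := dG t.
Qed.

Lemma int01_eq g (G : R -> R) (r : R) : continuous g ->
  (forall t : R, is_derive t 1 G (g t)) -> G 1 - G 0 = r -> int01 g = r.
Proof. by move=> gc dG <-; exact: int01_FTC. Qed.

Lemma int01D g1 g2 : continuous g1 -> continuous g2 ->
  int01 (fun t => g1 t + g2 t) = int01 g1 + int01 g2.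
Proof. by move=> c1 c2; rewrite /int01 RintegralD//; exact: int01_integrable. Qed.

Lemma int01B g1 g2 : continuous g1 -> continuous g2 ->
  int01 (fun t => g1 t - g2 t) = int01 g1 - int01 g2.
Proof. by move=> c1 c2; rewrite /int01 RintegralB//; exact: int01_integrable. Qed.

Lemma int01Z (a : R) g : continuous g -> int01 (fun t => a * g t) = a * int01 g.
Proof. by move=> c; rewrite /int01 RintegralZl//; exact: int01_integrable. Qed.

Lemma int01_cst (a : R) : int01 (fun=> a) = a.
Proof.
have -> // : int01 (fun=> a) = a * 1 - a * 0; last by rewrite mulr1 mulr0 subr0.
apply: int01_FTC; first exact: cst_continuous.
move=> t; have := is_deriveZ a (is_derive_id t (1 : R)).
by rewrite (_ : a *: (1 : R) = a)//; exact: mulr1.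
Qed.

Lemma eq_int01 g1 g2 : (forall t, 0 <= t <= 1 -> g1 t = g2 t) -> int01 g1 = int01 g2.
Proof.
by move=> h; apply: eq_Rintegral => t; rewrite inE /= in_itv /=; exact: h.
Qed.

Lemma int01_le g (e : R) : continuous g -> (forall t, 0 <= t <= 1 -> `|g t| <= e) ->
  `|int01 g| <= e.
Proof.
move=> gc ge; apply: le_trans (le_normr_Rintegral _ (int01_integrable gc)) _ => //.
rewrite -[leRHS](int01_cst e); apply: le_Rintegral => //.
- by apply: (@int01_integrable (fun t => `|g t|)) => t; exact: cvg_norm (gc t).
- exact: int01_integrable (@cst_continuous _ _ e).
Qed.

End unit_interval_integral.

(** * Differentiation under the integral sign *)

Section parametric_integral.
Context {R : realType}.
Implicit Types (F : R -> 'rV[R]_2 -> R) (w h : 'rV[R]_2).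

Lemma norm_coord_le h (i : 'I_2) : `|h 0 i| <= `|h|.
Proof.
rewrite [leRHS]/Num.norm /= mx_normrE.
by apply: (@le_bigmax _ _ _ 0 (fun ij : 'I_1 * 'I_2 => `|h ij.1 ij.2|) (0, i)).
Qed.

Lemma norm_lin2_le (h0 h1 n a a' b b' e : R) : `|h0| <= n -> `|h1| <= n ->
  `|a - a'| <= e / 2 -> `|b - b'| <= e / 2 ->
  `|h0 * a + h1 * b - (h0 * a' + h1 * b')| <= e * n.
Proof.
move=> h0n h1n ae be.
rewrite [X in `|X|](_ : _ = h0 * (a - a') + h1 * (b - b')); last by ring.
apply: le_trans (ler_normD _ _) _; rewrite !normrM [e]splitr mulrDl.
by rewrite ![e / 2 * n]mulrC; apply: lerD; apply: ler_pM.
Qed.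

(** The dependence on [t] is only continuous; joint continuity with [w] is demanded at every order,
    since it gives the uniformity in [t] that differentiation under the integral sign needs. *)
Fixpoint parCk k F : Prop :=
  continuous (fun p : R * 'rV[R]_2 => F p.1 p.2) /\
  if k is k'.+1 then (forall t w, differentiable (F t) w) /\
                     (forall l, parCk k' (fun t => pd l (F t)))
  else True.

Lemma parCk_continuous k F : parCk k F -> continuous (fun p : R * 'rV[R]_2 => F p.1 p.2).
Proof. by case: k => [|k] []. Qed.

Lemma parCk_continuous_l k F w : parCk k F -> continuous (F^~ w).
Proof.
move=> /parCk_continuous cF t.
have ct : {for t, continuous (fun t : R => (t, w))}.
  exact: cvg_pair (@cvg_id _ (nbhs t)) (cvg_cst w).
exact: (@continuous_comp _ _ _ (fun t : R => (t, w)) (fun p => F p.1 p.2) t ct (cF _)).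
Qed.

(** Uniformity in [t] comes from the compactness of [[0, 1]]. *)
Lemma parametric_near F w (e : R) : continuous (fun p : R * 'rV[R]_2 => F p.1 p.2) ->
  0 < e -> \forall h \near (0 : 'rV[R]_2), forall t, 0 <= t <= 1 -> `|F t (h + w) - F t w| <= e.
Proof.
move=> cF e0.
have := proj1 (compact_near_coveringP _) (@segment_compact R 0 1).
move=> /(_ _ (nbhs (0 : 'rV[R]_2)) (fun h t => `|F t (h + w) - F t w| <= e)).
move=> /(_ (nbhs_filter _)) H.
have {}H : \forall h \near (0 : 'rV[R]_2), `[0, 1] `<=` (fun t => `|F t (h + w) - F t w| <= e).
  apply: H => t0 _.
  have e2 : 0 < e / 2 by rewrite divr_gt0.
  have /cvgrPdist_lt /(_ _ e2) [[A B] /= [nA nB] AB] := cF (t0, w).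
  exists (A, [set h | B (h + w)]) => /=.
    split=> //; have := (proj1 (nbhs0P B w) nB).
    by apply: filterS => h; rewrite addrC.
  move=> [t h] /= [At Bh].
  have h1 := AB (t, h + w) (conj At Bh).
  have h2 := AB (t, w) (conj At (nbhs_singleton nB)).
  rewrite /= in h1 h2.
  rewrite (_ : _ - _ = (F t0 w - F t w) - (F t0 w - F t (h + w))); last by ring.
  apply: le_trans (ler_normB _ _) _.
  by rewrite [e]splitr; apply: lerD; apply: ltW.
apply: filterS H => h H t ht; apply: H.
by rewrite /= in_itv.
Qed.

Definition int01p F w := int01 (F^~ w).

Lemma int01p_continuous F : parCk 0 F -> continuous (int01p F).
Proof.
move=> pF w; have cF := parCk_continuous pF.
apply/(@cvgrPdist_le _ _ _ (nbhs w)) => e e0.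
apply/(nbhs0P (fun x => `|int01p F w - int01p F x| <= e)).
have := parametric_near w cF e0; apply: filterS => h H.
rewrite /int01p -int01B; [|exact: parCk_continuous_l pF..].
apply: int01_le => [t|t t01]; last by rewrite distrC [w + h]addrC H.
exact: cvgB (@parCk_continuous_l _ _ w pF t) (@parCk_continuous_l _ _ (w + h) pF t).
Qed.

(** The mean value theorem on the segment from [w] to [h + w] turns the increment of [F t] into its
    partial derivatives at an intermediate point, and these are close to their values at [w]
    uniformly in [t]. *)
Lemma int01p_pd F w : parCk 1 F ->
  differentiable (int01p F) w /\
  forall l, pd l (int01p F) w = int01p (fun t => pd l (F t)) w.
Proof.
move=> pF; have [cF [dF pdF]] := pF.
have cpd l t : {for t, continuous (fun t => pd l (F t) w)}.
  exact: (@parCk_continuous_l 0 (fun t => pd l (F t)) w (pdF l) t).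
have [//|df p0 p1] := @differentiableP_eps _ (int01p F) w
    (int01p (fun t => pd 0 (F t)) w) (int01p (fun t => pd 1 (F t)) w).
  move=> e e0; have e2 : 0 < e / 2 by rewrite divr_gt0.
  have /nbhs_ballP[d0 /= d00 H0] := @parametric_near (fun t => pd 0 (F t)) w _ (proj1 (pdF 0)) e2.
  have /nbhs_ballP[d1 /= d10 H1] := @parametric_near (fun t => pd 1 (F t)) w _ (proj1 (pdF 1)) e2.
  apply/nbhs_ballP; exists (Num.min d0 d1); first by rewrite /= lt_min d00.
  move=> h; rewrite -ball_normE /= sub0r normrN lt_min => /andP[hd0 hd1].
  have c0 : continuous (fun t : R => h 0 0 * pd 0 (F t) w).
    by move=> t; exact: cvgM (cvg_cst _) (cpd 0 t).
  have c1 : continuous (fun t : R => h 0 1 * pd 1 (F t) w).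
    by move=> t; exact: cvgM (cvg_cst _) (cpd 1 t).
  have c01 : continuous (fun t : R => h 0 0 * pd 0 (F t) w + h 0 1 * pd 1 (F t) w).
    by move=> t; exact: cvgD (c0 t) (c1 t).
  have cF' v : continuous (F^~ v) by exact: parCk_continuous_l pF.
  have cB : continuous (fun t : R => F t (h + w) - F t w).
    by move=> t; exact: cvgB (cF' (h + w) t) (cF' w t).
  rewrite /int01p -(int01B (cF' (h + w)) (cF' w)).
  rewrite -(int01Z (h 0 0) (cpd 0)) -(int01Z (h 0 1) (cpd 1)).
  rewrite -(int01D c0 c1) -(int01B cB c01).
  apply: int01_le => [t|t t01]; first exact: cvgB (cB t) (c01 t).
  pose dphi (s : R) := h 0 0 * pd 0 (F t) (s *: h + w) + h 0 1 * pd 1 (F t) (s *: h + w).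
  have hE s : pt (s * h 0 0 + w 0 0) (s * h 0 1 + w 0 1) = s *: h + w.
    by apply/rowP; apply: ord2P; rewrite ?pt0 ?pt1 !mxE.
  have dphiP (s : R) : is_derive s 1 (fun s : R => F t (s *: h + w)) (dphi s).
    rewrite (_ : (fun s : R => F t (s *: h + w)) =
       (fun s => F t (pt (s * h 0 0 + w 0 0) (s * h 0 1 + w 0 1)))); last first.
      by apply/funext => u; rewrite hE.
    have dl (a b : R) : is_derive s 1 (fun s : R => s * a + b) a.
      have := is_deriveD (is_deriveM (is_derive_id s (1 : R)) (is_derive_cst a s 1)) (is_derive_cst b s 1).
      rewrite (_ : s *: (0 : R) + a *: 1 + 0 = a)//.
      by rewrite scaler0 add0r addr0; exact: mulr1.
    have := is_derive_pt (dl (h 0 0) (w 0 0)) (dl (h 0 1) (w 0 1)).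
    by move=> /(_ (F t)); rewrite hE; apply; exact: dF.
  have [s /andP[s0 s1]] := MVT01 dphiP.
  rewrite scale1r scale0r add0r => ->.
  have shd : `|s *: h| <= `|h|.
    by rewrite normrZ ger0_norm// ler_piMl.
  have b0 : `|pd 0 (F t) (s *: h + w) - pd 0 (F t) w| <= e / 2.
    by apply: H0 t01; rewrite -ball_normE /= sub0r normrN (le_lt_trans shd).
  have b1 : `|pd 1 (F t) (s *: h + w) - pd 1 (F t) w| <= e / 2.
    by apply: H1 t01; rewrite -ball_normE /= sub0r normrN (le_lt_trans shd).
  exact: norm_lin2_le (norm_coord_le h 0) (norm_coord_le h 1) b0 b1.
split; first exact: df.
by apply: ord2P; [exact: p0|exact: p1].
Qed.

Lemma int01p_Ck k F : parCk k F -> Ck k (int01p F).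
Proof.
elim: k F => [|k IH] F pF; first exact: int01p_continuous.
have pF1 : parCk 1 F.
  case: pF => cF [dF pdF]; split=> //; split=> // l; split=> //.
  exact: parCk_continuous (pdF l).
split=> [w|l]; first by have [] := int01p_pd w pF1.
have [_ [_ pdF]] := pF.
rewrite (_ : pd l _ = int01p (fun t => pd l (F t))); first exact: IH (pdF l).
by apply/funext => w; have [_] := int01p_pd w pF1.
Qed.

End parametric_integral.

(** * Integrals of a function along a family of affine maps *)

Section affine_family.
Context {R : realType}.
Implicit Types (F : R -> 'rV[R]_2 -> R) (w : 'rV[R]_2) (f : 'rV[R]_2 -> R).

Lemma parCkD k F G : parCk k F -> parCk k G -> parCk k (fun t w => F t w + G t w).
Proof.
elim: k F G => [|k IH] F G [cF pF] [cG pG].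
  by split=> // p; exact: cvgD (cF p) (cG p).
split; first by move=> p; exact: cvgD (cF p) (cG p).
split=> [t w|l]; first exact: differentiableD (proj1 pF t w) (proj1 pG t w).
rewrite (_ : (fun t => _) = (fun t w => pd l (F t) w + pd l (G t) w)).
  exact: IH (proj2 pF l) (proj2 pG l).
by apply/funext => t; apply/funext => w; rewrite pdD//; [exact: (proj1 pF)|exact: (proj1 pG)].
Qed.

(** One family covers the homotheties, the horizontal contractions, the rotations and the segments
    of Hadamard's lemma. *)
Definition affine (A : 'I_2 -> 'I_2 -> R -> R) (B : 'I_2 -> R -> R) (t : R) w : 'rV[R]_2 :=
  pt (A 0 0 t * w 0 0 + A 0 1 t * w 0 1 + B 0 t)
     (A 1 0 t * w 0 0 + A 1 1 t * w 0 1 + B 1 t).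

Lemma differentiable_affine_coord (a b c : R) w :
  differentiable (fun w : 'rV[R]_2 => a * w 0 0 + b * w 0 1 + c) w.
Proof.
have dc i (k : R) : differentiable (fun w : 'rV[R]_2 => k * w 0 i : R) w.
  by apply: differentiableM; [exact: differentiable_cst|exact: differentiable_coord].
exact: differentiableD (differentiableD (dc 0 a) (dc 1 b)) (differentiable_cst c w).
Qed.

Lemma pd_affine_coord l (a b c : R) w :
  pd l (fun w : 'rV[R]_2 => a * w 0 0 + b * w 0 1 + c) w =
  a * (0 == l)%:R + b * (1 == l)%:R.
Proof.
have dc i : differentiable (fun w : 'rV[R]_2 => w 0 i : R) w.
  exact: differentiable_coord.
have dz i (k : R) : differentiable (fun w : 'rV[R]_2 => k * w 0 i : R) w.
  exact: differentiableM (differentiable_cst k w) (dc i).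
rewrite (pdD _ (differentiableD (dz 0 a) (dz 1 b)) (differentiable_cst c w)) pd_cst addr0.
by rewrite (pdD _ (dz 0 a) (dz 1 b)) (pdZ _ _ (dc 0)) (pdZ _ _ (dc 1)) !pd_coord.
Qed.

Lemma pd_comp_affine A B f t w l : differentiable f (affine A B t w) ->
  pd l (fun w => f (affine A B t w)) w =
  A 0 l t * pd 0 f (affine A B t w) + A 1 l t * pd 1 f (affine A B t w).
Proof.
move=> df; rewrite /affine pd_pt//; try exact: differentiable_affine_coord.
rewrite !pd_affine_coord; move: l; apply: ord2P => /=; by rewrite !mulr1 !mulr0 ?addr0 ?add0r.
Qed.

Lemma affine_continuous A B : (forall i j, continuous (A i j)) ->
  (forall i, continuous (B i)) ->
  continuous (fun p : R * 'rV[R]_2 => affine A B p.1 p.2).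
Proof.
move=> cA cB p.
have c1 (h : R -> R) : continuous h -> {for p, continuous (fun p : R * 'rV[R]_2 => h p.1)}.
  move=> ch; apply: (@continuous_comp _ _ _ fst h); first exact: cvg_fst.
  exact: ch.
have c2 i : {for p, continuous (fun p : R * 'rV[R]_2 => p.2 0 i : R)}.
  apply: (@continuous_comp _ _ _ snd (fun w : 'rV[R]_2 => w 0 i : R)); first exact: cvg_snd.
  by apply: differentiable_continuous; exact: differentiable_coord.
have cc i : {for p, continuous (fun p : R * 'rV[R]_2 =>
    A i 0 p.1 * p.2 0 0 + A i 1 p.1 * p.2 0 1 + B i p.1)}.
  exact: cvgD (cvgD (cvgM (c1 _ (cA i 0)) (c2 0)) (cvgM (c1 _ (cA i 1)) (c2 1))) (c1 _ (cB i)).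
exact: cvgD (cvgZr_tmp (cc 0)) (cvgZr_tmp (cc 1)).
Qed.

(** The weight [phi] keeps the family closed under differentiation: a partial derivative is a sum of
    integrands of the same form with weights [phi t * A i l t]. *)
Lemma parCk_affine k A B (phi : R -> R) f : (forall i j, continuous (A i j)) ->
  (forall i, continuous (B i)) -> continuous phi -> smooth f ->
  parCk k (fun t w => phi t * f (affine A B t w)).
Proof.
move=> cA cB; elim: k phi f => [|k IH] phi f cphi sf.
  split=> // p; apply: cvgM.
    apply: (@continuous_comp _ _ _ fst phi); first exact: cvg_fst.
    exact: cphi.
  apply: (@continuous_comp _ _ _ (fun p : R * 'rV[R]_2 => affine A B p.1 p.2) f).
    exact: affine_continuous.
  exact: smooth_continuous.
split; first exact: parCk_continuous (IH phi f cphi sf).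
have df t w : differentiable (fun w => f (affine A B t w)) w.
  have [d _] := is_diff_pt (differentiable_affine_coord (A 0 0 t) (A 0 1 t) (B 0 t) w)
     (differentiable_affine_coord (A 1 0 t) (A 1 1 t) (B 1 t) w) (smooth_diff _ sf); exact: d.
split=> [t w|l].
  exact: differentiableM (differentiable_cst (phi t) w) (df t w).
rewrite (_ : (fun t => _) = (fun t w => phi t * A 0 l t * pd 0 f (affine A B t w) +
    phi t * A 1 l t * pd 1 f (affine A B t w))).
  by apply: parCkD; apply: IH; try exact: smooth_pd; move=> t; exact: cvgM (cphi t) (cA _ _ t).
apply/funext => t; apply/funext => w; rewrite (pdZ _ _ (df t w)).
by rewrite (pd_comp_affine _ (smooth_diff _ sf)); ring.
Qed.

Definition int_affine A B phi f w : R := int01 (fun t => phi t * f (affine A B t w)).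

Lemma int_affine_smooth A B (phi : R -> R) f : (forall i j, continuous (A i j)) ->
  (forall i, continuous (B i)) -> continuous phi -> smooth f ->
  smooth (int_affine A B phi f).
Proof. by move=> cA cB cphi sf k; apply: int01p_Ck; exact: parCk_affine. Qed.

Lemma pd_int_affine A B (phi : R -> R) f l w : (forall i j, continuous (A i j)) ->
  (forall i, continuous (B i)) -> continuous phi -> smooth f ->
  pd l (int_affine A B phi f) w =
  int01 (fun t => phi t * (A 0 l t * pd 0 f (affine A B t w) + A 1 l t * pd 1 f (affine A B t w))).
Proof.
move=> cA cB cphi sf.
have [_ ->] := int01p_pd w (parCk_affine 1 cA cB cphi sf).
apply: eq_int01 => t _.
have df : differentiable (fun w => f (affine A B t w)) w.
  have [d _] := is_diff_pt (differentiable_affine_coord (A 0 0 t) (A 0 1 t) (B 0 t) w)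
     (differentiable_affine_coord (A 1 0 t) (A 1 1 t) (B 1 t) w) (smooth_diff _ sf); exact: d.
by rewrite (pdZ _ _ df) (pd_comp_affine _ (smooth_diff _ sf)).
Qed.

Lemma int_affine_integrand_continuous A B (phi : R -> R) f w :
  (forall i j, continuous (A i j)) ->
  (forall i, continuous (B i)) -> continuous phi -> smooth f ->
  continuous (fun t => phi t * f (affine A B t w)).
Proof.
by move=> cA cB cphi sf; exact: (@parCk_continuous_l R 0 (fun t w => phi t * f (affine A B t w)) w (parCk_affine 0 cA cB cphi sf)).
Qed.

End affine_family.

(** * Smooth functions, Euler and angular derivatives, symmetry of second derivatives *)

Section plane_fields.
Context {R : realType}.
Implicit Types (f g u : 'rV[R]_2 -> R) (w v : 'rV[R]_2).

Lemma smooth_eq f g : f =1 g -> smooth f -> smooth g.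
Proof. by move=> /funext ->. Qed.

Lemma smooth_cst (a : R) : smooth (fun=> a : R).
Proof. by apply/smoothE => k; exact: CkOn_cst. Qed.

Lemma smooth_coord (i : 'I_2) : smooth (fun w => w 0 i : R).
Proof. by apply/smoothE => k; exact: CkOn_coord. Qed.

Lemma smoothD f g : smooth f -> smooth g -> smooth (fun w => f w + g w).
Proof.
by move=> /smoothE sf /smoothE sg; apply/smoothE => k; apply: CkOnD => //; exact: openT.
Qed.

Lemma smoothB f g : smooth f -> smooth g -> smooth (fun w => f w - g w).
Proof.
by move=> /smoothE sf /smoothE sg; apply/smoothE => k; apply: CkOnB => //; exact: openT.
Qed.

Lemma smoothM f g : smooth f -> smooth g -> smooth (fun w => f w * g w).
Proof.
by move=> /smoothE sf /smoothE sg; apply/smoothE => k; apply: CkOnM => //; exact: openT.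
Qed.

Lemma smoothN f : smooth f -> smooth (fun w => - f w).
Proof. by move=> /smoothE sf; apply/smoothE => k; apply: CkOnN => //; exact: openT. Qed.

Lemma smoothZ (a : R) f : smooth f -> smooth (fun w => a * f w).
Proof. by move=> sf; apply: smoothM => //; exact: smooth_cst. Qed.

Lemma smoothX n f : smooth f -> smooth (fun w => f w ^+ n).
Proof. by move=> /smoothE sf; apply/smoothE => k; apply: CkOnX => //; exact: openT. Qed.

Lemma smoothV f : (forall w, f w != 0) -> smooth f -> smooth (fun w => (f w)^-1).
Proof.
by move=> f0 /smoothE sf; apply/smoothE => k; apply: CkOnV => //; exact: openT.
Qed.

Lemma smooth_sqn : smooth (@sqn R).
Proof. by apply: smoothD; apply: smoothX; exact: smooth_coord. Qed.

Lemma smooth_1sqn : smooth (fun w => 1 + sqn w : R).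
Proof. by apply: smoothD; [exact: smooth_cst|exact: smooth_sqn]. Qed.

Lemma pd_sqn l w : pd l (@sqn R) w = 2 * w 0 l.
Proof.
have dc i : differentiable (fun w : 'rV[R]_2 => w 0 i : R) w by exact: differentiable_coord.
have dX i : differentiable (fun w : 'rV[R]_2 => w 0 i * w 0 i : R) w.
  exact: differentiableM (dc i) (dc i).
rewrite (_ : @sqn R = (fun w => w 0 0 * w 0 0 + w 0 1 * w 0 1)); last first.
  by apply/funext => v; rewrite /sqn !expr2.
rewrite (pdD _ (dX 0) (dX 1)) (pdM _ (dc 0) (dc 0)) (pdM _ (dc 1) (dc 1)) !pd_coord.
by move: l; apply: ord2P => /=; ring.
Qed.

Definition euler f w : R := w 0 0 * pd 0 f w + w 0 1 * pd 1 f w.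
Definition dtheta f w : R := w 0 0 * pd 1 f w - w 0 1 * pd 0 f w.

Lemma smooth_euler f : smooth f -> smooth (euler f).
Proof.
move=> sf; apply: smoothD; apply: smoothM;
  by [exact: smooth_coord|exact: smooth_pd].
Qed.

Lemma smooth_dtheta f : smooth f -> smooth (dtheta f).
Proof.
move=> sf; apply: smoothB; apply: smoothM;
  by [exact: smooth_coord|exact: smooth_pd].
Qed.

(* [scale2 a b w] with [(a, b)] running over [(t, t)] or [(t, 1)], [0 <= t <= 1]. *)
Definition scale2 (a b : R) w : 'rV[R]_2 := pt (a * w 0 0) (b * w 0 1).

Definition Adiag (a b : R -> R) (i j : 'I_2) (t : R) : R :=
  if i == j then (if i == 0 then a t else b t) else 0.
Definition Bzero (i : 'I_2) (t : R) : R := 0.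

Lemma affine_diag a b t w : affine (Adiag a b) Bzero t w = scale2 (a t) (b t) w.
Proof. by rewrite /affine /scale2 /Adiag /Bzero /= !mul0r !addr0 add0r. Qed.

Lemma Adiag_continuous a b : continuous a -> continuous b ->
  forall i j, continuous (Adiag a b i j).
Proof.
move=> ca cb i j; rewrite /Adiag; case: (i == j); last exact: cst_continuous.
by case: (i == 0).
Qed.

Lemma Bzero_continuous i : continuous (Bzero i).
Proof. exact: cst_continuous. Qed.

Lemma idR_continuous : continuous (fun t : R => t).
Proof. by move=> t; exact: cvg_id. Qed.

Lemma cstR_continuous (a : R) : continuous (fun _ : R => a).
Proof. exact: cst_continuous. Qed.

Lemma is_derive_lin (a b s : R) : is_derive s 1 (fun s : R => s * a + b) a.
Proof.
have := is_deriveD (is_deriveM (is_derive_id s (1 : R)) (is_derive_cst a s 1)) (is_derive_cst b s 1).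
rewrite (_ : s *: (0 : R) + a *: 1 + 0 = a)//.
by rewrite scaler0 add0r addr0; exact: mulr1.
Qed.

(** The integral of [g] over the horizontal segment from [(0, y)] to [(x, y)], rescaled to the unit
    interval. *)
Definition prim0 g w : R := w 0 0 * int_affine (Adiag id (fun=> 1)) Bzero (fun=> 1) g w.

Let ca := Adiag_continuous idR_continuous (@cstR_continuous 1).

Lemma smooth_prim0 g : smooth g -> smooth (prim0 g).
Proof.
move=> sg; apply: smoothM; first exact: smooth_coord.
exact: int_affine_smooth ca Bzero_continuous (@cstR_continuous 1) sg.
Qed.

Lemma prim0_pd0 g w : smooth g -> prim0 (pd 0 g) w = g w - g (pt 0 (w 0 1)).
Proof.
move=> sg; rewrite /prim0 /int_affine.
have cint := @int_affine_integrand_continuous _ _ _ _ _ w ca Bzero_continuous (@cstR_continuous 1)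
  (smooth_pd 0 sg).
rewrite -(int01Z (w 0 0) cint).
apply: (@int01_eq _ _ (fun t => g (pt (t * w 0 0 + 0) (t * 0 + w 0 1)))) => [t|t|].
- exact: cvgM (cvg_cst _) (cint t).
- have := is_derive_pt (is_derive_lin (w 0 0) 0 t) (is_derive_lin 0 (w 0 1) t)
    (smooth_diff _ sg).
  by rewrite mul0r !addr0 mul1r affine_diag /scale2 /= mulr0 add0r mul1r.
- by rewrite !mul1r !mul0r !addr0 !add0r -row2E.
Qed.

Lemma pd0_prim0 g w : smooth g -> pd 0 (prim0 g) w = g w.
Proof.
move=> sg; have dI := smooth_diff w (int_affine_smooth ca Bzero_continuous (@cstR_continuous 1) sg).
rewrite /prim0 (pdM _ (differentiable_coord _ _ _) dI) pd_coord mulr1.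
rewrite (pd_int_affine 0 w ca Bzero_continuous (@cstR_continuous 1) sg) /int_affine.
have c1 := @int_affine_integrand_continuous _ _ _ _ _ w ca Bzero_continuous idR_continuous
  (smooth_pd 0 sg).
have c2 := @int_affine_integrand_continuous _ _ _ _ _ w ca Bzero_continuous (@cstR_continuous 1) sg.
rewrite (@eq_int01 _ _ (fun t => t * pd 0 g (affine (Adiag id (fun=> 1)) Bzero t w))); last first.
  by move=> t _; rewrite mul1r /Adiag /= mul0r addr0.
rewrite -(int01Z (w 0 0) c1) -int01D//; last by move=> t; exact: cvgM (cvg_cst _) (c1 t).
apply: (@int01_eq _ _ (fun t => t * g (pt (t * w 0 0 + 0) (t * 0 + w 0 1)))) => [t|t|].
- exact: cvgD (cvgM (cvg_cst _) (c1 t)) (c2 t).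
- have D := is_derive_pt (is_derive_lin (w 0 0) 0 t) (is_derive_lin 0 (w 0 1) t)
    (smooth_diff _ sg).
  have := is_deriveM (is_derive_id t (1 : R)) D.
  rewrite affine_diag /scale2 /= mulr0 add0r !addr0 !mul1r mul0r addr0 /GRing.scale /= mulr1.
  by rewrite mulrCA.
- by rewrite !mul1r !mul0r !addr0 add0r subr0 -row2E.
Qed.

Lemma pd1_prim0 g w : smooth g -> pd 1 (prim0 g) w = prim0 (pd 1 g) w.
Proof.
move=> sg; have dI := smooth_diff w (int_affine_smooth ca Bzero_continuous (@cstR_continuous 1) sg).
rewrite /prim0 (pdM _ (differentiable_coord _ _ _) dI) pd_coord mulr0 addr0.
rewrite (pd_int_affine 1 w ca Bzero_continuous (@cstR_continuous 1) sg) /int_affine.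
by congr (_ * _); apply: eq_int01 => t _; rewrite /Adiag /= mul0r add0r mul1r.
Qed.

(** Write [f] as the integral of [pd 0 f] plus a function [g] of the second coordinate alone. The
    operator [pd 1] passes under the integral and [pd 0] then undoes the integral, while [pd 1 g]
    does not depend on the first coordinate. *)
Lemma pd_swap f w : smooth f -> pd 0 (pd 1 f) w = pd 1 (pd 0 f) w.
Proof.
move=> sf; pose g w := f (pt 0 (w 0 1)); have s0 := smooth_pd 0 sf.
have fE : f = (fun w => prim0 (pd 0 f) w + g w).
  by apply/funext => v; rewrite prim0_pd0// subrK.
have sg : smooth g.
  apply: smooth_eq (smoothB sf (smooth_prim0 s0)) => v; rewrite prim0_pd0//.
  by rewrite opprB addrC subrK.
have g1 : pd 1 f = (fun w => prim0 (pd 1 (pd 0 f)) w + pd 1 g w).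
  apply/funext => v; rewrite {1}fE.
  rewrite (pdD _ (smooth_diff v (smooth_prim0 s0)) (smooth_diff v sg)).
  by rewrite pd1_prim0.
have s10 := smooth_pd 1 s0.
rewrite g1 (pdD _ (smooth_diff w (smooth_prim0 s10)) (smooth_diff w (smooth_pd 1 sg))).
rewrite pd0_prim0// [X in _ + X](_ : _ = 0) ?addr0//.
have g1E v : pd 1 g v = 0 * v 0 0 + pd 1 f (pt 0 (v 0 1)).
  rewrite /g pd_pt; [|exact: differentiable_cst|exact: differentiable_coord|exact: smooth_diff].
  by rewrite pd_cst pd_coord !mul0r mul1r.
rewrite (_ : pd 1 g = (fun v => pd 1 f (pt 0 (v 0 1)))); last first.
  by apply/funext => v; rewrite g1E mul0r add0r.
rewrite pd_pt; [|exact: differentiable_cst|exact: differentiable_coord|exact: smooth_diff (smooth_pd 1 sf)].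
rewrite pd_cst pd_coord.
move: (pd 0 (pd 1 f) _) (pd 1 (pd 1 f) _) => a b.
by rewrite mul0r (_ : (1 == 0 :> 'I_2) = false)// mul0r addr0.
Qed.

End plane_fields.

(** * Rotations, radial functions and averages over the rotations *)

Section radial_functions.
Context {R : realType}.
Implicit Types (f g u : 'rV[R]_2 -> R) (w v : 'rV[R]_2).

Definition rot (a : R) w : 'rV[R]_2 :=
  pt (cos a * w 0 0 - sin a * w 0 1) (sin a * w 0 0 + cos a * w 0 1).

Lemma rot0 w : rot 0 w = w.
Proof. by rewrite /rot cos0 sin0 !mul1r !mul0r subr0 add0r -row2E. Qed.

Lemma sqn_rot a w : sqn (rot a w) = sqn w.
Proof.
rewrite sqn_pt /sqn; have := cos2Dsin2 a; move: (cos a) (sin a) => x y h.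
transitivity ((x ^+ 2 + y ^+ 2) * (w 0 0 ^+ 2 + w 0 1 ^+ 2)); first by ring.
by rewrite h mul1r.
Qed.

Definition radial f := forall w v, sqn w = sqn v -> f w = f v.

Lemma cos_sin_ex (x y : R) : x ^+ 2 + y ^+ 2 = 1 -> exists a, x = cos a /\ y = sin a.
Proof.
move=> h; have x1 : -1 <= x <= 1.
  have y2 : 0 <= y ^+ 2 by exact: sqr_ge0.
  by apply/andP; split; nra.
have sE := sin_acos x1.
have [y0|y0] := leP 0 y.
  exists (acos x); rewrite acosK// sE; split=> //.
  by rewrite -h addrC addKr sqrtr_sqr ger0_norm.
exists (- acos x); rewrite cosN sinN acosK// sE; split=> //.
by rewrite -h addrC addKr sqrtr_sqr ltr0_norm// opprK.
Qed.

Lemma rot_ex w v : sqn w = sqn v -> exists a, v = rot a w.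
Proof.
have [->|w0] := eqVneq w 0.
  move=> h; exists 0; rewrite rot0; apply/eqP; rewrite -sqn_eq0 -h.
  by rewrite /sqn !mxE expr2 mulr0 addr0.
move=> h; have n0 : sqn w != 0 by rewrite sqn_eq0.
(* The scalar product and the determinant of [w] and [v], divided by their common squared norm. *)
have [|a [ca sa]] := @cos_sin_ex ((w 0 0 * v 0 0 + w 0 1 * v 0 1) / sqn w)
    ((w 0 0 * v 0 1 - w 0 1 * v 0 0) / sqn w).
  rewrite !expr_div_n -mulrDl.
  rewrite [X in X / _](_ : _ = sqn w * sqn v); last by rewrite /sqn; ring.
  by rewrite -h -expr2 divff// expf_neq0.
exists a; rewrite /rot -ca -sa [LHS]row2E; congr pt; move: n0; rewrite /sqn => n0; by field.
Qed.

Lemma is_derive_rot f w (tau t : R) : smooth f ->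
  is_derive t 1 (fun t => f (rot (tau * t) w)) (tau * dtheta f (rot (tau * t) w)).
Proof.
move=> sf; set p := rot (tau * t) w.
have dl : is_derive t 1 (fun t => tau * t) tau.
  rewrite (_ : (fun t : R => _) = (fun t : R => t * tau + 0)); first exact: is_derive_lin.
  by apply/funext => u; rewrite addr0 mulrC.
have dc := is_derive1_comp (is_derive_cos (tau * t)) dl.
have ds := is_derive1_comp (is_derive_sin (tau * t)) dl.
have dM (h : R -> R) (d k : R) : is_derive t 1 h d -> is_derive t 1 (fun t => h t * k) (d * k).
  move=> [h1 h2]; have [h3 h4] := is_deriveM (DeriveDef h1 h2) (is_derive_cst k t 1).
  apply: DeriveDef; first exact: h3.
  by rewrite h4 scaler0 add0r /GRing.scale /= mulrC.
have dx := is_deriveB (dM _ _ (w 0 0) dc) (dM _ _ (w 0 1) ds).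
have dy := is_deriveD (dM _ _ (w 0 0) ds) (dM _ _ (w 0 1) dc).
have := is_derive_pt dx dy (smooth_diff _ sf).
rewrite -[pt _ _]/p => D; apply: is_derive_eq D _.
rewrite /dtheta /p pt0 pt1.
move: (pd 0 f _) (pd 1 f _) => a b; ring.
Qed.

Lemma dtheta0_radial f : smooth f -> (forall w, dtheta f w = 0) -> radial f.
Proof.
move=> sf f0 w v /rot_ex[a ->].
have := @is_derive_0_is_cst R (fun t => f (rot (1 * t) w)) 0 a.
rewrite !mul1r rot0; apply=> t.
by have := is_derive_rot w 1 t sf; rewrite f0 mulr0.
Qed.

Lemma radial_dtheta f w : smooth f -> radial f -> dtheta f w = 0.
Proof.
move=> sf rf; have [_] := is_derive_rot w 1 0 sf.
rewrite (_ : (fun t => _) = cst (f w)); last first.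
  by apply/funext => t; apply: rf; rewrite sqn_rot.
by rewrite derive_cst mulr0 rot0 mul1r.
Qed.

Definition Arot (tau : R) (i j : 'I_2) (t : R) : R :=
  if i == j then cos (tau * t) else if i == 0 then - sin (tau * t) else sin (tau * t).

Lemma affine_rot tau t w : affine (Arot tau) Bzero t w = rot (tau * t) w.
Proof. by rewrite /affine /rot /Arot /Bzero /= !addr0 mulNr. Qed.

Lemma Arot_continuous tau i j : continuous (Arot tau i j).
Proof.
have cl : continuous (fun t : R => tau * t).
  by move=> t; exact: cvgM (cvg_cst tau) (@cvg_id _ (nbhs t)).
have cc : continuous (fun t : R => cos (tau * t)).
  by move=> t; exact: (@continuous_comp _ _ _ (fun t => tau * t) cos t (cl t) (@continuous_cos R _)).
have cs : continuous (fun t : R => sin (tau * t)).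
  by move=> t; exact: (@continuous_comp _ _ _ (fun t => tau * t) sin t (cl t) (@continuous_sin R _)).
rewrite /Arot; case: (i == j) => //; case: (i == 0) => //.
by move=> t; exact: cvgN (cs t).
Qed.

Definition avg tau f w : R := int_affine (Arot tau) Bzero (fun=> 1) f w.
(* For [tau] a full turn, [avg_prim f] is a primitive of [f - avg f] along the rotations, by
   integration by parts. *)
Definition avg_prim tau f w : R := int_affine (Arot tau) Bzero (fun t => tau * t) f w.

Lemma linR_continuous (tau : R) : continuous (fun t : R => tau * t).
Proof. by move=> t; exact: cvgM (cvg_cst tau) (@cvg_id _ (nbhs t)). Qed.

Lemma avgE tau f w : avg tau f w = int01 (fun t => f (rot (tau * t) w)).
Proof. by apply: eq_int01 => t _; rewrite mul1r affine_rot. Qed.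

Lemma avg_primE tau f w : avg_prim tau f w = int01 (fun t => tau * t * f (rot (tau * t) w)).
Proof. by apply: eq_int01 => t _; rewrite affine_rot. Qed.

Lemma smooth_avg tau f : smooth f -> smooth (avg tau f).
Proof.
exact: int_affine_smooth (@Arot_continuous tau) Bzero_continuous (@cstR_continuous R 1).
Qed.

Lemma smooth_avg_prim tau f : smooth f -> smooth (avg_prim tau f).
Proof.
exact: int_affine_smooth (@Arot_continuous tau) Bzero_continuous (@linR_continuous tau).
Qed.

Lemma rot_continuous tau f w : smooth f -> continuous (fun t : R => f (rot (tau * t) w)).
Proof.
move=> sf; rewrite (_ : (fun t : R => _) = (fun t : R => 1 * f (affine (Arot tau) Bzero t w))).
  exact: (@int_affine_integrand_continuous _ _ _ _ _ w (@Arot_continuous tau)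
    Bzero_continuous (@cstR_continuous R 1) sf).
by apply/funext => t; rewrite mul1r affine_rot.
Qed.

(** This is the commutation of [dtheta] with the rotations, in the shape that the chain rule
    produces. *)
Lemma dtheta_rot f tau t w :
  w 0 0 * (Arot tau 0 1 t * pd 0 f (rot (tau * t) w) + Arot tau 1 1 t * pd 1 f (rot (tau * t) w))
  - w 0 1 * (Arot tau 0 0 t * pd 0 f (rot (tau * t) w) + Arot tau 1 0 t * pd 1 f (rot (tau * t) w))
  = dtheta f (rot (tau * t) w).
Proof.
rewrite /dtheta /Arot /= [in RHS]/rot pt0 pt1.
move: (pd 0 f _) (pd 1 f _) => a b; ring.
Qed.

Lemma dtheta_int_rot tau phi f w : continuous phi -> smooth f ->
  dtheta (int_affine (Arot tau) Bzero phi f) w =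
  int01 (fun t => phi t * dtheta f (rot (tau * t) w)).
Proof.
move=> cphi sf; rewrite {1}/dtheta.
rewrite !(pd_int_affine _ w (@Arot_continuous tau) Bzero_continuous cphi sf).
have cA i j t : {for t, continuous (Arot tau i j)} by exact: Arot_continuous.
have c l : continuous (fun t : R => phi t * (Arot tau 0 l t * pd 0 f (affine (Arot tau) Bzero t w) +
    Arot tau 1 l t * pd 1 f (affine (Arot tau) Bzero t w))).
  move=> t; apply: cvgM; first exact: cphi.
  have c0 k : {for t, continuous (fun t : R => pd k f (affine (Arot tau) Bzero t w))}.
    rewrite (_ : (fun t : R => _) = (fun t : R => pd k f (rot (tau * t) w))).
      exact: rot_continuous (smooth_pd k sf) t.
    by apply/funext => u; rewrite affine_rot.
  exact: cvgD (cvgM (cA 0 l t) (c0 0)) (cvgM (cA 1 l t) (c0 1)).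
have c' l (k : R) : continuous (fun t : R => k * (phi t * (Arot tau 0 l t * pd 0 f (affine (Arot tau) Bzero t w) +
    Arot tau 1 l t * pd 1 f (affine (Arot tau) Bzero t w)))).
  by move=> t; exact: cvgM (cvg_cst k) (c l t).
rewrite -(int01Z _ (c 0)) -(int01Z _ (c 1)) -(int01B (c' 1 _) (c' 0 _)).
apply: eq_int01 => t _; rewrite affine_rot -dtheta_rot.
move: (pd 0 f _) (pd 1 f _) => a b; ring.
Qed.

(** Up to the factor [tau], the angular derivative of the average is the integral of the derivative
    of [f] along the orbit, which closes up after a full turn. *)
Lemma avg_radial tau f : tau != 0 -> cos tau = 1 -> sin tau = 0 -> smooth f ->
  radial (avg tau f).
Proof.
move=> tau0 ct st sf; apply: dtheta0_radial; first exact: smooth_avg.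
move=> w; rewrite /avg (dtheta_int_rot _ _ (@cstR_continuous R 1) sf).
apply: (mulfI tau0); rewrite mulr0.
have c := @rot_continuous tau _ w (smooth_dtheta sf).
have c1 : continuous (fun t : R => 1 * dtheta f (rot (tau * t) w)).
  by move=> t; exact: cvgM (cvg_cst _) (c t).
rewrite -(int01Z _ c1); apply: (@int01_eq _ _ (fun t => f (rot (tau * t) w))).
- by move=> t; exact: cvgM (cvg_cst _) (c1 t).
- by move=> t; rewrite mul1r; exact: is_derive_rot.
- rewrite mulr1 mulr0 rot0 /rot ct st !mul1r !mul0r subr0 add0r -row2E; exact: subrr.
Qed.

Lemma dtheta_avg_prim tau f w : cos tau = 1 -> sin tau = 0 -> smooth f ->
  dtheta (avg_prim tau f) w = f w - avg tau f w.
Proof.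
move=> ct st sf; rewrite /avg_prim (dtheta_int_rot _ _ (@linR_continuous tau) sf) avgE.
have c := @rot_continuous tau _ w (smooth_dtheta sf).
have c0 := @rot_continuous tau _ w sf.
have c1 : continuous (fun t : R => tau * t * dtheta f (rot (tau * t) w)).
  by move=> t; exact: cvgM (@linR_continuous tau t) (c t).
apply/eqP; rewrite eq_sym subr_eq eq_sym -(int01D c1 c0); apply/eqP.
apply: (@int01_eq _ _ (fun t => t * f (rot (tau * t) w))).
- by move=> t; exact: cvgD (c1 t) (c0 t).
- move=> t; have := is_deriveM (is_derive_id t (1 : R)) (is_derive_rot w tau t sf).
  by rewrite /GRing.scale /= mulr1 mulrA [t * tau]mulrC.
- by rewrite mul1r mul0r subr0 mulr1 /rot ct st !mul1r !mul0r subr0 add0r -row2E.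
Qed.

End radial_functions.

(** * Density arguments, radial primitives and Hadamard's lemma *)

Section radial_integration.
Context {R : realType}.
Implicit Types (f g m p : 'rV[R]_2 -> R) (w v : 'rV[R]_2).

Lemma sqn0 : sqn (0 : 'rV[R]_2) = 0.
Proof. by apply/eqP; rewrite sqn_eq0. Qed.

Lemma ray_limit0 p w v : {for w, continuous p} ->
  (forall t : R, 0 < t -> p (t *: v + w) = 0) -> p w = 0.
Proof.
move=> cp p0; pose q (t : R) := p (t *: v + w).
have cq : {for 0, continuous q}.
  have c1 : {for 0, continuous (fun t : R => t *: v + w)}.
    exact: cvgD (cvgZr_tmp (@idR_continuous R 0)) (cvg_cst w).
  have cp' : {for 0 *: v + w, continuous p} by rewrite scale0r add0r.
  exact: (@continuous_comp _ _ _ (fun t : R => t *: v + w) p 0 c1 cp').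
have l1 : q t @[t --> 0^'+] --> q 0 by exact: cvg_at_right_filter cq.
have l2 : q t @[t --> 0^'+] --> (0 : R).
  apply: (@cvg_trans _ (cst 0 @ (0 : R)^'+)); last exact: cvg_cst.
  apply: near_eq_cvg; near=> t; rewrite /cst /q p0//; near: t; exact: nbhs_right_gt.
have q00 : q 0 = 0 by apply: cvg_unique l1 l2; exact: norm_hausdorff.
by rewrite -q00 /q scale0r add0r.
Unshelve. all: by end_near. Qed.

(** Only the outside of the circle through [w] is involved, so that the same argument applies at the
    origin and on any circle. *)
Lemma off_circle_limit0 p w : {for w, continuous p} ->
  (forall v, sqn w < sqn v -> p v = 0) -> p w = 0.
Proof.
(* The sign of the horizontal direction in which [sqn] increases from [w] on. *)
move=> cp p0; pose s : R := if 0 <= w 0 0 then 1 else -1.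
have s0 : 0 <= s * w 0 0.
  by rewrite /s; case: (leP 0 (w 0 0)) => h; lra.
have ss : s ^+ 2 = 1 by rewrite /s; case: ifP => _; ring.
apply: (@ray_limit0 _ _ (pt s 0)) => // t t0; apply: p0.
rewrite (_ : t *: pt s 0 + w = pt (t * s + w 0 0) (w 0 1)); last first.
  by rewrite [LHS]row2E; congr pt; rewrite mxE [X in X + _]mxE ?pt0 ?pt1 ?mulr0 ?add0r.
rewrite sqn_pt /sqn [ltRHS](_ : _ = w 0 0 ^+ 2 + w 0 1 ^+ 2 +
  (s ^+ 2 * t ^+ 2 + 2 * t * (s * w 0 0))); last by ring.
rewrite ltrDl ss mul1r ltr_pwDl// ?exprn_gt0//.
by apply: mulr_ge0 => //; rewrite mulr_ge0// ltW.
Qed.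

Lemma off_circle_dense p (rho : R) : continuous p ->
  (forall w, sqn w != rho -> p w = 0) -> forall w, p w = 0.
Proof.
move=> cp p0 w; case: (eqVneq (sqn w) rho) => [wr|]; last exact: p0.
apply: off_circle_limit0 => [|v wv]; first exact: cp.
by apply: p0; rewrite gt_eqF// -wr.
Qed.

Lemma eq_off_circle f g (rho : R) : continuous f -> continuous g ->
  (forall w, sqn w != rho -> f w = g w) -> forall w, f w = g w.
Proof.
move=> cf cg fg w; apply/eqP; rewrite -subr_eq0; apply/eqP.
apply: (@off_circle_dense (fun w => f w - g w) rho) => [v|v /fg ->].
  exact: cvgB (cf v) (cg v).
by rewrite subrr.
Qed.

(** For radial [g], [sqn w * rad_prim g w] is the integral of [r g(r)] from [0] to [|w|]. The factor
    [sqn w] is kept apart because [rad_prim] alone occurs in the coefficient of an Euler field in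
    degree 2. *)
Definition rad_prim g w : R := int_affine (Adiag id id) Bzero id g w.

Let ca := Adiag_continuous (@idR_continuous R) (@idR_continuous R).

Lemma rad_primE g w : rad_prim g w = int01 (fun t => t * g (t *: w)).
Proof.
apply: eq_int01 => t _; rewrite affine_diag /scale2 (_ : pt _ _ = t *: w)//.
by rewrite [RHS]row2E !mxE.
Qed.

Lemma smooth_rad_prim g : smooth g -> smooth (rad_prim g).
Proof. exact: int_affine_smooth ca Bzero_continuous (@idR_continuous R). Qed.

Lemma sqnZ (t : R) w : sqn (t *: w) = t ^+ 2 * sqn w.
Proof. by rewrite /sqn !mxE; ring. Qed.

Lemma radial_rad_prim g : radial g -> radial (rad_prim g).
Proof.
move=> rg w v wv; rewrite !rad_primE; apply: eq_int01 => t _.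
by congr (_ * _); apply: rg; rewrite !sqnZ wv.
Qed.

Lemma is_derive_ray f w (t : R) : smooth f ->
  is_derive t 1 (fun t => f (t *: w))
    (w 0 0 * pd 0 f (t *: w) + w 0 1 * pd 1 f (t *: w)).
Proof.
move=> sf; have E u : t *: w = t *: w -> pt (u * w 0 0 + 0) (u * w 0 1 + 0) = u *: w.
  by move=> _; rewrite [RHS]row2E !mxE !addr0.
have := is_derive_pt (is_derive_lin (w 0 0) 0 t) (is_derive_lin (w 0 1) 0 t) (smooth_diff _ sf).
rewrite E// (_ : (fun u => f (pt _ _)) = (fun u => f (u *: w)))//.
by apply/funext => u; rewrite E.
Qed.

Lemma euler_rad_prim g w : smooth g -> 2 * rad_prim g w + euler (rad_prim g) w = g w.
Proof.
move=> sg; rewrite /euler /rad_prim.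
rewrite !(pd_int_affine _ w ca Bzero_continuous (@idR_continuous R) sg) /int_affine.
have cg l : continuous (fun t : R => t * pd l g (affine (Adiag id id) Bzero t w)).
  exact: (@int_affine_integrand_continuous _ _ _ _ _ w ca Bzero_continuous
    (@idR_continuous R) (smooth_pd l sg)).
have cg2 l : continuous (fun t : R => t * (t * pd l g (affine (Adiag id id) Bzero t w))).
  by move=> t; exact: cvgM (@idR_continuous R t) (cg l t).
have c0 : continuous (fun t : R => t * g (affine (Adiag id id) Bzero t w)).
  exact: (@int_affine_integrand_continuous _ _ _ _ _ w ca Bzero_continuous
    (@idR_continuous R) sg).
have E l : int01 (fun t => id t * (Adiag id id 0 l t * pd 0 g (affine (Adiag id id) Bzero t w) +
    Adiag id id 1 l t * pd 1 g (affine (Adiag id id) Bzero t w))) =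
    int01 (fun t => t * (t * pd l g (affine (Adiag id id) Bzero t w))).
  apply: eq_int01 => t _; move: l; apply: ord2P; rewrite /Adiag /= mul0r ?addr0 ?add0r//.
rewrite !E -(int01Z _ c0) -(int01Z _ (cg2 0)) -(int01Z _ (cg2 1)).
have cZ (k : R) (h : R -> R) : continuous h -> continuous (fun t : R => k * h t).
  by move=> ch t; exact: cvgM (cvg_cst k) (ch t).
have cs : continuous (fun t : R => w 0 0 * (t * (t * pd 0 g (affine (Adiag id id) Bzero t w))) +
    w 0 1 * (t * (t * pd 1 g (affine (Adiag id id) Bzero t w)))).
  by move=> t; exact: cvgD (cZ _ _ (cg2 0) t) (cZ _ _ (cg2 1) t).
rewrite -(int01D (cZ _ _ (cg2 0)) (cZ _ _ (cg2 1))) -(int01D (cZ _ _ c0) cs).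
apply: (@int01_eq _ _ (fun t => t * (t * g (t *: w)))).
- by move=> t; exact: cvgD (cZ _ _ c0 t) (cs t).
- move=> t; have := is_derive_mulR (is_derive_id t (1 : R))
    (is_derive_mulR (is_derive_id t (1 : R)) (is_derive_ray w t sg)).
  rewrite affine_diag /scale2 /= (_ : pt _ _ = t *: w); last by rewrite [RHS]row2E !mxE.
  move=> D; apply: is_derive_eq D _.
  move: (pd 0 g _) (pd 1 g _) (g _) => a b d; ring.
- by rewrite !mul1r mul0r subr0 scale1r.
Qed.

Lemma sqn_pd_radial f w l : smooth f -> radial f -> sqn w * pd l f w = w 0 l * euler f w.
Proof.
move=> sf rf; have := radial_dtheta w sf rf; rewrite /dtheta /euler /sqn => /eqP.
rewrite subr_eq0; move: l; apply: ord2P; move: (pd 0 f w) (pd 1 f w) => a b /eqP ab.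
  by rewrite mulrDl mulrDr !expr2 -!mulrA -ab; ring.
by rewrite mulrDl mulrDr !expr2 -!mulrA ab; ring.
Qed.

Definition rad_pot g w : R := sqn w * rad_prim g w.

Lemma smooth_rad_pot g : smooth g -> smooth (rad_pot g).
Proof. by move=> sg; apply: smoothM; [exact: smooth_sqn|exact: smooth_rad_prim]. Qed.

Lemma radial_rad_pot g : radial g -> radial (rad_pot g).
Proof. by move=> rg w v wv; rewrite /rad_pot wv (radial_rad_prim rg wv). Qed.

Lemma pd_rad_pot g l w : smooth g -> radial g -> pd l (rad_pot g) w = w 0 l * g w.
Proof.
move=> sg rg; have sF := smooth_rad_prim sg.
rewrite /rad_pot (pdM _ (smooth_diff w smooth_sqn) (smooth_diff w sF)) pd_sqn.
rewrite (sqn_pd_radial _ _ sF (radial_rad_prim rg)) -(euler_rad_prim w sg).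
by move: (rad_prim g w) (euler _ w) => a b; ring.
Qed.

Lemma euler0_cst f w : smooth f -> (forall v, euler f v = 0) -> f w = f 0.
Proof.
move=> sf f0; pose df (t : R) := w 0 0 * pd 0 f (t *: w) + w 0 1 * pd 1 f (t *: w).
have cf : continuous (fun t : R => f (t *: w)).
  move=> t; apply: differentiable_continuous; apply/derivable1_diffP.
  by have [] := is_derive_ray w t sf.
(* The intermediate point lies in the open interval: [t * df t] is [euler f (t *: w)], and [t] can
   be cancelled. *)
have [t] := @MVT R (fun t => f (t *: w)) df 0 1 ltr01 (fun t _ => is_derive_ray w t sf)
  (continuous_subspaceT cf).
rewrite in_itv /= scale1r scale0r subr0 mulr1 => /andP[t0 _] E.
apply/eqP; rewrite -subr_eq0 E; apply/eqP.
apply: (mulfI (lt0r_neq0 t0)); rewrite mulr0 -[RHS](f0 (t *: w)) /df /euler !mxE.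
by move: (pd 0 f _) (pd 1 f _) => a b; ring.
Qed.

Lemma pd0_cst f w : smooth f -> (forall l v, pd l f v = 0) -> f w = f 0.
Proof. by move=> sf f0; apply: euler0_cst => // v; rewrite /euler !f0 !mulr0 addr0. Qed.

(* Hadamard's lemma on the ray through [e_0]; off the circle [k] is the quotient and off the
   origin it is smooth because [|w|] is. *)
Lemma radial_division m (r : R) : 0 < r -> smooth m -> radial m -> m (pt r 0) = 0 ->
  exists k, [/\ smooth k, radial k & forall w, m w = (sqn w - r ^+ 2) * k w].
Proof.
move=> r0 sm rm m0.
(* At [w = (x, 0)] the point [affine A B t w] is [(t x + (1 - t) r, 0)], which runs from the zero of
   [m] to [w]. *)
pose A (i j : 'I_2) (t : R) : R := if (i == 0) && (j == 0) then t else 0.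
pose B (i : 'I_2) (t : R) : R := if i == 0 then r + (- r) * t else 0.
pose Q := int_affine A B (fun=> 1) (pd 0 m).
have cA i j : continuous (A i j).
  rewrite /A; case: andP => _; [exact: idR_continuous|exact: cstR_continuous].
have cB i : continuous (B i).
  rewrite /B; case: eqP => _; last exact: cstR_continuous.
  by move=> t; exact: cvgD (cvg_cst r) (@linR_continuous _ (- r) t).
have sQ : smooth Q := int_affine_smooth cA cB (@cstR_continuous R 1) (smooth_pd 0 sm).
have QE x : (x - r) * Q (pt x 0) = m (pt x 0).
  rewrite /Q /int_affine.
  have c1 := @int_affine_integrand_continuous _ _ _ _ _ (pt x 0) cA cB (@cstR_continuous R 1)
    (smooth_pd 0 sm).
  rewrite -(int01Z _ c1).
  apply: (@int01_eq _ _ (fun t => m (pt (t * (x - r) + r) (t * 0 + 0)))) => [t|t|].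
  - exact: cvgM (cvg_cst _) (c1 t).
  - have := is_derive_pt (is_derive_lin (x - r) r t) (is_derive_lin 0 0 t) (smooth_diff _ sm).
    rewrite mul0r addr0 mul1r /affine /A /B /= pt0 pt1.
    rewrite !mul0r !addr0 (_ : t * x + (r + - r * t) = t * (x - r) + r)//; last by ring.
    by rewrite mulr0.
  - by rewrite mul1r !mul0r !add0r mulr0 addr0 m0 subr0 subrK.
pose n w := Num.sqrt (sqn w).
pose k w := Q (pt (n w) 0) * (n w + r)^-1.
have n0 w : 0 <= n w by exact: sqrtr_ge0.
have nr w : n w + r != 0 by rewrite gt_eqF// ltr_wpDl.
have nn w : n w ^+ 2 = sqn w by rewrite sqr_sqrtr// sqn_ge0.
have kE w : m w = (sqn w - r ^+ 2) * k w.
  transitivity (m (pt (n w) 0)); first by apply: rm; rewrite sqn_pt nn expr2 mulr0 addr0.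
  rewrite -QE /k -nn; move: (Q (pt (n w) 0)) (n w) (nr w) => a b br; by field.
exists k; split => // [|w v wv]; last by rewrite /k /n wv.
pose U := [set w : 'rV[R]_2 | 0 < sqn w].
pose V := [set w : 'rV[R]_2 | sqn w - r ^+ 2 != 0].
have csqn : continuous (@sqn R) := smooth_continuous smooth_sqn.
have oU : open U.
  have := @open_comp _ _ (@sqn R) [set x | 0 < x]; apply; last exact: open_gt.
  by move=> w _; exact: csqn.
have oV : open V.
  have := @open_comp _ _ (fun w : 'rV[R]_2 => sqn w - r ^+ 2) [set x | x != 0].
  apply; last exact: open_neq.
  by move=> w _; exact: cvgB (csqn w) (cvg_cst _).
have UV : U `|` V = setT.
  apply/seteqP; split=> // w _; have := sqn_ge0 w; rewrite le_eqVlt => /orP[/eqP w0|]; last by left.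
  by right; rewrite /V /= -w0 sub0r oppr_eq0 expf_neq0// gt_eqF.
apply/smoothE => i; rewrite -UV; apply: CkOn_setU.
  have Sn : CkOn U i n.
    apply: CkOn_sqrt => //; exact: CkOn_sub (@subsetT _ U) (proj1 (smoothE _) smooth_sqn i).
  have Sd := CkOnV oU (fun w _ => nr w) (CkOnD oU Sn (CkOn_cst U i r)).
  have SQ := proj1 (smoothE _) sQ i.
  exact: CkOnM oU (CkOn_pt oU (fun w _ => I) Sn (CkOn_cst U i 0) SQ) Sd.
have St f : smooth f -> CkOn V i f.
  by move=> /smoothE sf; exact: CkOn_sub (@subsetT _ V) (sf i).
have Sd := St _ (smoothB smooth_sqn (smooth_cst (r ^+ 2))).
apply: CkOn_eq (CkOnM oV (St _ sm) (CkOnV oV (fun w Vw => Vw) Sd)) => // w Vw.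
by rewrite kE mulrAC divff// mul1r.
Qed.

End radial_integration.

(** * The stereographic charts, the function c - x_3 and its zero circle *)

Section charts.
Context {R : realType}.
Implicit Types (f g m p : 'rV[R]_2 -> R) (w v : 'rV[R]_2) (c s : R).

(** [zeta] is [x_3] in the first chart and [- x_3] in the second; [sig] is the density of the area
    form in both. *)
Definition zeta w : R := (1 - sqn w) / (1 + sqn w).
Definition sig w : R := 4 / (1 + sqn w) ^+ 2.
(* [c - x_3] in the chart of index [b], for [s = (-1) ^+ b]. *)
Definition hh c s w : R := c - s * zeta w.

Lemma smooth_zeta : smooth zeta.
Proof.
apply: smoothM; first exact: smoothB (smooth_cst 1) smooth_sqn.
by apply: smoothV; [exact: sqn1_neq0|exact: smooth_1sqn].
Qed.

Lemma smooth_sig : smooth sig.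
Proof.
apply: smoothM; first exact: smooth_cst.
by apply: smoothV; [move=> w; rewrite expf_neq0// sqn1_neq0|exact: smoothX smooth_1sqn].
Qed.

Lemma smooth_hh c s : smooth (hh c s).
Proof. exact: smoothB (smooth_cst c) (smoothZ s smooth_zeta). Qed.

Lemma sig_neq0 w : sig w != 0.
Proof. by rewrite /sig mulf_neq0// ?invr_neq0// ?expf_neq0 ?sqn1_neq0// pnatr_eq0. Qed.

Lemma pd_1sqn l w : pd l (fun w => 1 + sqn w) w = 2 * w 0 l.
Proof.
rewrite (pdD _ (differentiable_cst _ _) (smooth_diff w smooth_sqn)) pd_cst add0r.
exact: pd_sqn.
Qed.

Lemma pd_inv1sqn l w : pd l (fun w => (1 + sqn w)^-1) w = - (1 + sqn w) ^- 2 * (2 * w 0 l).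
Proof.
by rewrite (pdV _ (smooth_diff w smooth_1sqn) (sqn1_neq0 w)) pd_1sqn.
Qed.

Lemma smooth_inv1sqn : smooth (fun w : 'rV[R]_2 => (1 + sqn w)^-1).
Proof. by apply: smoothV; [exact: sqn1_neq0|exact: smooth_1sqn]. Qed.

Lemma zetaE w : zeta w = 2 * (1 + sqn w)^-1 - 1.
Proof. by rewrite /zeta; have := sqn1_neq0 w; move: (sqn w) => q q0; field. Qed.

Lemma pd_zeta l w : pd l zeta w = - sig w * w 0 l.
Proof.
rewrite (_ : zeta = (fun w => 2 * (1 + sqn w)^-1 - 1)); last exact/funext/zetaE.
have dI := smooth_diff w smooth_inv1sqn.
rewrite (pdB _ (smooth_diff w (smoothZ 2 smooth_inv1sqn)) (differentiable_cst _ _)) pd_cst subr0.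
rewrite (pdZ _ _ dI) pd_inv1sqn /sig.
by have := sqn1_neq0 w; move: (sqn w) => q q0; field.
Qed.

Lemma pd_sig l w : pd l sig w = - (4 / (1 + sqn w)) * sig w * w 0 l.
Proof.
rewrite (_ : sig = (fun w => 4 * ((1 + sqn w)^-1 * (1 + sqn w)^-1))); last first.
  by apply/funext => v; rewrite /sig -expr2 exprVn.
have dI := smooth_diff w smooth_inv1sqn.
rewrite (pdZ _ _ (smooth_diff w (smoothM smooth_inv1sqn smooth_inv1sqn))).
rewrite (pdM _ dI dI) pd_inv1sqn.
by have := sqn1_neq0 w; move: (sqn w) => q q0; field.
Qed.

Lemma pd_hh c s l w : pd l (hh c s) w = s * sig w * w 0 l.
Proof.
rewrite /hh (pdB _ (differentiable_cst _ _) (smooth_diff w (smoothZ s smooth_zeta))) pd_cst.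
by rewrite (pdZ _ _ (smooth_diff w smooth_zeta)) pd_zeta sub0r mulNr mulrN opprK mulrA.
Qed.

Lemma sqr_zeta w : 1 - zeta w ^+ 2 = sqn w * sig w.
Proof. by rewrite /zeta /sig; have := sqn1_neq0 w; move: (sqn w) => q q0; field. Qed.

Lemma radial_zeta : radial zeta.
Proof. by move=> w v wv; rewrite /zeta wv. Qed.

Lemma radial_sig : radial sig.
Proof. by move=> w v wv; rewrite /sig wv. Qed.

Lemma radial_hh c s : radial (hh c s).
Proof. by move=> w v wv; rewrite /hh (radial_zeta wv). Qed.

(* The zero circle of [hh c s] is [sqn w = rho c s]. *)
Definition rho c s : R := (s - c) / (s + c).

Lemma pm1_bounds c s : `|c| < 1 -> s = 1 \/ s = -1 -> 0 < (s - c) / (s + c) /\ s + c != 0.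
Proof.
rewrite ltr_norml => /andP[c1 c2] [->|->].
  have h : 0 < 1 + c by lra.
  by split; [apply: divr_gt0 => //; lra|exact: lt0r_neq0].
have h : 0 < 1 - c by lra.
have h' : -1 + c < 0 by lra.
split; last by rewrite lt_eqF.
by rewrite -mulrNN -invrN; apply: divr_gt0; lra.
Qed.

Lemma hhE c s w : s + c != 0 -> hh c s w = (s + c) * (sqn w - rho c s) / (1 + sqn w).
Proof.
move=> sc; rewrite /hh /zeta /rho.
by have := sqn1_neq0 w; move: (sqn w) => q q0; field; rewrite q0 sc.
Qed.

Lemma hh_eq0 c s w : `|c| < 1 -> s = 1 \/ s = -1 ->
  (hh c s w == 0) = (sqn w == rho c s).
Proof.
move=> hc hs; have [_ sc] := pm1_bounds hc hs.
rewrite (hhE _ sc) !mulf_eq0 (negPf sc) invr_eq0 (negPf (sqn1_neq0 w)) orbF /=.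
by rewrite subr_eq0.
Qed.

Lemma hh_zero_ex c s : `|c| < 1 -> s = 1 \/ s = -1 ->
  exists2 r, 0 < r & hh c s (pt r 0) = 0.
Proof.
move=> hc hs; have [r0 _] := pm1_bounds hc hs.
exists (Num.sqrt (rho c s)); first by rewrite sqrtr_gt0.
apply/eqP; rewrite hh_eq0// sqn_pt sqr_sqrtr; last exact: ltW.
by rewrite expr2 mulr0 addr0.
Qed.

Lemma hh_dense c s f g : `|c| < 1 -> s = 1 \/ s = -1 -> continuous f -> continuous g ->
  (forall w, hh c s w * f w = hh c s w * g w) -> forall w, f w = g w.
Proof.
move=> hc hs cf cg fg; apply: (@eq_off_circle _ f g (rho c s)) => // w wr.
by apply: (@mulfI _ (hh c s w)); [rewrite hh_eq0|exact: fg].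
Qed.

(** [hh c s] is a nowhere zero smooth multiple of [sqn w - rho c s], so that division by the latter
    suffices. *)
Lemma hh_division c s m : `|c| < 1 -> s = 1 \/ s = -1 -> smooth m -> radial m ->
  (forall w, hh c s w = 0 -> m w = 0) ->
  exists k, [/\ smooth k, radial k & forall w, m w = hh c s w * k w].
Proof.
move=> hc hs sm rm m0; have [_ sc] := pm1_bounds hc hs.
have [r r0 hr] := hh_zero_ex hc hs.
have r2 : r ^+ 2 = rho c s.
  by move/eqP: hr; rewrite hh_eq0// sqn_pt [0 ^+ 2]expr2 mulr0 addr0 => /eqP.
have [k [sk rk kE]] := radial_division r0 sm rm (m0 _ hr).
exists (fun w => (s + c)^-1 * ((1 + sqn w) * k w)); split.
- exact: smoothZ (smoothM smooth_1sqn sk).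
- by move=> w v wv; rewrite wv (rk _ _ wv).
- move=> w; rewrite kE (hhE _ sc) r2; have := sqn1_neq0 w.
  by move: (k w) (sqn w) => a q q0; field; rewrite q0 sc.
Qed.

(** The exponential parameter makes [euler] the derivative in [t] and the transition the reversal of
    [t]. *)
Definition eray (t : R) : 'rV[R]_2 := pt (expR t) 0.

Lemma sqn_eray t : sqn (eray t) = expR t ^+ 2.
Proof. by rewrite sqn_pt [0 ^+ 2]expr2 mulr0 addr0. Qed.

Lemma eray_ex w : w != 0 -> exists t, sqn w = sqn (eray t).
Proof.
move=> w0; have q0 : 0 < sqn w by rewrite lt_def sqn_eq0 w0 sqn_ge0.
by exists (ln (sqn w) / 2); rewrite sqn_eray expr2 -expRD -splitr lnK.
Qed.

Lemma eray_neq0 t : eray t != 0.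
Proof. by rewrite -sqn_eq0 sqn_eray expf_neq0// gt_eqF// expR_gt0. Qed.

Lemma is_derive_eray f (t : R) : smooth f ->
  is_derive t 1 (fun t => f (eray t)) (euler f (eray t)).
Proof.
move=> sf; have := is_derive_pt (is_derive_expR t) (is_derive_cst 0 t 1) (smooth_diff _ sf).
move=> D; apply: is_derive_eq D _; rewrite /euler /eray pt0 pt1.
by move: (pd 0 f _) (pd 1 f _) => a b; rewrite !mul0r.
Qed.

Lemma transition0 w : transition w 0 0 = w 0 0 / sqn w.
Proof. by rewrite mxE expr0 mul1r. Qed.

Lemma transition1 w : transition w 0 1 = - w 0 1 / sqn w.
Proof. by rewrite mxE expr1 mulN1r. Qed.

Lemma transition_pt w : transition w = pt (w 0 0 / sqn w) (- w 0 1 / sqn w).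
Proof. by rewrite [LHS]row2E transition0 transition1. Qed.

Lemma sqn_transition w : sqn (transition w) = (sqn w)^-1.
Proof.
(* At the origin both sides are zero by the convention for [0^-1]. *)
have [->|w0] := eqVneq w 0.
  by rewrite transition_pt sqn_pt !mxE sqn0 invr0 !mulr0 expr2 mulr0 addr0.
rewrite -sqn_eq0 in w0; rewrite transition_pt sqn_pt !expr_div_n sqrrN -mulrDl.
by rewrite -/(sqn w) expr2 invfM mulrA divff// mul1r.
Qed.

Lemma transition_neq0 w : w != 0 -> transition w != 0.
Proof. by move=> w0; rewrite -sqn_eq0 sqn_transition invr_eq0 sqn_eq0. Qed.

Lemma transitionK w : w != 0 -> transition (transition w) = w.
Proof.
move=> w0; rewrite -sqn_eq0 in w0.
rewrite [LHS]transition_pt transition0 transition1 sqn_transition [RHS]row2E.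
by congr pt; field.
Qed.

Lemma transition_rot a w : transition (rot a w) = rot (- a) (transition w).
Proof.
rewrite transition_pt sqn_rot /rot pt0 pt1 transition0 transition1 cosN sinN.
by congr pt; ring.
Qed.

Lemma transition_eray t : transition (eray t) = eray (- t).
Proof.
rewrite transition_pt sqn_eray pt0 pt1 oppr0 mul0r /eray; congr pt.
by rewrite expRN; have := expR_gt0 t => /lt0r_neq0 h; field.
Qed.

Lemma zeta_transition w : w != 0 -> zeta (transition w) = - zeta w.
Proof.
rewrite -sqn_eq0 /zeta sqn_transition => w0; have := sqn1_neq0 w.
move: (sqn w) w0 => q q0 q1; by field; rewrite q0 q1.
Qed.

Lemma sig_transition w : w != 0 -> sig (transition w) = sqn w ^+ 2 * sig w.
Proof.
rewrite -sqn_eq0 /sig sqn_transition => w0; have := sqn1_neq0 w.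
move: (sqn w) w0 => q q0 q1; by field; rewrite q0 q1.
Qed.

Lemma hh_transition c s w : w != 0 -> hh c (- s) (transition w) = hh c s w.
Proof. by move=> w0; rewrite /hh zeta_transition// mulrNN. Qed.

Lemma dense_neq0 f g : continuous f -> continuous g ->
  (forall w, w != 0 -> f w = g w) -> forall w, f w = g w.
Proof.
by move=> cf cg fg; apply: (@eq_off_circle _ f g 0) => // w; rewrite sqn_eq0; exact: fg.
Qed.

(** The Euler derivative of [rad_pot g] is [sqn w * g w] and the transition reverses the Euler
    field, so the relation between [g0] and [g1] makes the derivatives of the two terms cancel along
    [eray]. Radiality carries the constant to the other points. *)
Lemma rad_pot_transition (e : R) g0 g1 : smooth g0 -> smooth g1 -> radial g0 -> radial g1 ->
  (forall w, w != 0 -> g1 (transition w) = e * sqn w ^+ 2 * g0 w) ->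
  exists C, forall w, w != 0 -> rad_pot g1 (transition w) + e * rad_pot g0 w = C.
Proof.
move=> s0 s1 r0 r1 g10.
pose q t := rad_pot g1 (eray (- t)) + e * rad_pot g0 (eray t).
have qcst t : q t = q 0.
  apply: is_derive_0_is_cst => x.
  have p0 := smooth_rad_pot s0; have p1 := smooth_rad_pot s1.
  have dN : is_derive x 1 (fun t : R => - t) (-1) by exact: is_deriveNid.
  have D1 := is_derive1_comp (is_derive_eray (- x) p1) dN.
  have D0 := is_deriveZ e (is_derive_eray x p0).
  have D := is_deriveD D1 D0; apply: is_derive_eq D _.
  have eE g y : smooth g -> radial g -> euler (rad_pot g) (eray y) = sqn (eray y) * g (eray y).
    move=> sg rg; rewrite /euler !pd_rad_pot// /sqn; move: (g _) => a; ring.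
  rewrite !eE// -transition_eray g10 ?eray_neq0// sqn_transition.
  have := eray_neq0 x; rewrite -sqn_eq0; move: (sqn _) (g0 _) => a b a0.
  by rewrite /GRing.scale /=; field.
exists (q 0) => w /eray_ex[t wt].
rewrite (radial_rad_pot r0 wt) (radial_rad_pot (v := eray (- t)) r1); first exact: qcst.
by rewrite -transition_eray !sqn_transition wt.
Qed.

End charts.

(** * Averages over full turns and derivatives across the two charts *)

Section averages.
Context {R : realType}.
Implicit Types (f g k : 'rV[R]_2 -> R) (w v : 'rV[R]_2) (c s : R).

(** The sign is the orientation of the angle in the chart: for both [b], [turn (sgn b)] describes
    the same motion of the sphere, as [avg_transition] requires. *)
Definition turn s : R := s * (2 * pi).

Lemma cos_turn s : s = 1 \/ s = -1 -> cos (turn s) = 1.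
Proof.
have c2 : cos (2 * pi) = 1 :> R by rewrite mulr_natl cos2pi.
by rewrite /turn => -[->|->]; rewrite ?mul1r ?mulN1r ?cosN c2.
Qed.

Lemma sin_turn s : s = 1 \/ s = -1 -> sin (turn s) = 0.
Proof.
have c2 : sin (2 * pi) = 0 :> R by rewrite mulr_natl sin2pi.
by rewrite /turn => -[->|->]; rewrite ?mul1r ?mulN1r ?sinN c2 ?oppr0.
Qed.

Lemma turn_neq0 s : s = 1 \/ s = -1 -> turn s != 0.
Proof.
have p0 : (2 * pi : R) != 0 by rewrite mulf_neq0// gt_eqF// pi_gt0.
by rewrite /turn => -[->|->]; rewrite ?mul1r// mulN1r oppr_eq0.
Qed.

Lemma avgD tau f g w : smooth f -> smooth g ->
  avg tau (fun w => f w + g w) w = avg tau f w + avg tau g w.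
Proof. by move=> sf sg; rewrite !avgE int01D//; exact: rot_continuous. Qed.

Lemma avgB tau f g w : smooth f -> smooth g ->
  avg tau (fun w => f w - g w) w = avg tau f w - avg tau g w.
Proof. by move=> sf sg; rewrite !avgE int01B//; exact: rot_continuous. Qed.

Lemma avg_radialM tau k f w : radial k -> smooth f ->
  avg tau (fun w => k w * f w) w = k w * avg tau f w.
Proof.
move=> rk sf; rewrite !avgE -int01Z; last exact: rot_continuous.
by apply: eq_int01 => t _; rewrite (rk _ w)// sqn_rot.
Qed.

Lemma avg_of_radial tau k w : radial k -> avg tau k w = k w.
Proof.
move=> rk; rewrite avgE -[RHS]int01_cst; apply: eq_int01 => t _.
by apply: rk; rewrite sqn_rot.
Qed.

(** Averaging commutes with [dtheta], and an average is radial. *)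
Lemma avg_dtheta s f w : s = 1 \/ s = -1 -> smooth f -> avg (turn s) (dtheta f) w = 0.
Proof.
move=> hs sf; have <- : dtheta (avg (turn s) f) w = avg (turn s) (dtheta f) w.
  rewrite {1}/avg (dtheta_int_rot _ w (@cstR_continuous R 1) sf) avgE.
  by apply: eq_int01 => t _; exact: mul1r.
apply: radial_dtheta; first exact: smooth_avg.
by apply: avg_radial => //; [exact: turn_neq0|exact: cos_turn|exact: sin_turn].
Qed.

Lemma euler_rot f tau t w :
  w 0 0 * (Arot tau 0 0 t * pd 0 f (rot (tau * t) w) + Arot tau 1 0 t * pd 1 f (rot (tau * t) w))
  + w 0 1 * (Arot tau 0 1 t * pd 0 f (rot (tau * t) w) + Arot tau 1 1 t * pd 1 f (rot (tau * t) w))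
  = euler f (rot (tau * t) w).
Proof.
rewrite /euler /Arot /= [in RHS]/rot pt0 pt1.
move: (pd 0 f _) (pd 1 f _) => a b; ring.
Qed.

Lemma euler_avg tau f w : smooth f -> euler (avg tau f) w = avg tau (euler f) w.
Proof.
move=> sf; rewrite [RHS]avgE {1}/euler {1 2}/avg.
rewrite !(pd_int_affine _ w (@Arot_continuous R tau) Bzero_continuous (@cstR_continuous R 1) sf).
have c l : continuous (fun t : R => 1 * (Arot tau 0 l t * pd 0 f (affine (Arot tau) Bzero t w) +
    Arot tau 1 l t * pd 1 f (affine (Arot tau) Bzero t w))).
  move=> t.
  have c0 i : {for t, continuous (fun t : R => pd i f (affine (Arot tau) Bzero t w))}.
    rewrite (_ : (fun t : R => _) = (fun t : R => pd i f (rot (tau * t) w))).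
      exact: rot_continuous (smooth_pd i sf) t.
    by apply/funext => u; rewrite affine_rot.
  have cA i j : {for t, continuous (Arot tau i j)} by exact: Arot_continuous.
  have c1 : {for t, continuous (fun _ : R => 1 : R)} by exact: cstR_continuous.
  exact: cvgM c1 (cvgD (cvgM (cA 0 l) (c0 0)) (cvgM (cA 1 l) (c0 1))).
rewrite -(int01Z _ (c 0)) -(int01Z _ (c 1)) -int01D;
  [|by move=> t; exact: cvgM (cvg_cst _) (c _ t)..].
apply: eq_int01 => t _; rewrite affine_rot -euler_rot.
move: (pd 0 f _) (pd 1 f _) => a b; ring.
Qed.

Lemma avg_transition s f0 f1 w : w != 0 -> (forall v, v != 0 -> f1 (transition v) = f0 v) ->
  avg (turn (- s)) f1 (transition w) = avg (turn s) f0 w.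
Proof.
move=> w0 f10; rewrite !avgE; apply: eq_int01 => t _.
rewrite /turn !mulNr -transition_rot f10// -sqn_eq0 sqn_rot sqn_eq0//.
Qed.

(** The sign comes from the weight [tau * t], which changes with the orientation of the angle. *)
Lemma avg_prim_transition s f0 f1 w : w != 0 -> smooth f0 ->
  (forall v, v != 0 -> f1 (transition v) = f0 v) ->
  avg_prim (turn (- s)) f1 (transition w) = - avg_prim (turn s) f0 w.
Proof.
move=> w0 sf f10; rewrite !avg_primE -[RHS]mulN1r -int01Z; last first.
  by move=> t; exact: cvgM (@linR_continuous R (turn s) t) (@rot_continuous R (turn s) f0 w sf t).
apply: eq_int01 => t _.
rewrite /turn !mulNr -transition_rot f10 ?mul1r ?mulNr// -sqn_eq0 sqn_rot sqn_eq0//.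
Qed.

Lemma eulerD f g w : smooth f -> smooth g ->
  euler (fun w => f w + g w) w = euler f w + euler g w.
Proof.
move=> sf sg; rewrite /euler !(pdD _ (smooth_diff w sf) (smooth_diff w sg)).
by move: (pd 0 f w) (pd 1 f w) (pd 0 g w) (pd 1 g w) => *; ring.
Qed.

Lemma eulerM f g w : smooth f -> smooth g ->
  euler (fun w => f w * g w) w = f w * euler g w + g w * euler f w.
Proof.
move=> sf sg; rewrite /euler !(pdM _ (smooth_diff w sf) (smooth_diff w sg)).
by move: (pd 0 f w) (pd 1 f w) (pd 0 g w) (pd 1 g w) => *; ring.
Qed.

Lemma eulerZ a f w : smooth f -> euler (fun w => a * f w) w = a * euler f w.
Proof.
move=> sf; rewrite /euler !(pdZ _ _ (smooth_diff w sf)).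
by move: (pd 0 f w) (pd 1 f w) => *; ring.
Qed.

Lemma euler_cst (a : R) w : euler (fun=> a) w = 0.
Proof. by rewrite /euler !pd_cst !mulr0 addr0. Qed.

Lemma dthetaM_radial k f w : smooth k -> radial k -> smooth f ->
  dtheta (fun w => k w * f w) w = k w * dtheta f w.
Proof.
move=> sk rk sf; have := radial_dtheta w sk rk; rewrite /dtheta.
rewrite !(pdM _ (smooth_diff w sk) (smooth_diff w sf)).
move: (pd 0 f w) (pd 1 f w) (pd 0 k w) (pd 1 k w) => a b x y.
move=> h; apply/eqP; rewrite -subr_eq0; apply/eqP.
by transitivity (f w * (w 0 0 * y - w 0 1 * x)); [ring|rewrite h mulr0].
Qed.

Lemma euler_sqn w : euler (@sqn R) w = 2 * sqn w.
Proof. by rewrite /euler !pd_sqn /sqn; ring. Qed.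

Lemma euler_zeta w : euler zeta w = - (sqn w * sig w).
Proof. by rewrite /euler !pd_zeta [in RHS]/sqn; ring. Qed.

Lemma euler_hh c s w : euler (hh c s) w = s * (sqn w * sig w).
Proof. by rewrite /euler !pd_hh [in RHS]/sqn; ring. Qed.

Lemma euler_sig w : euler sig w = - (4 * sqn w / (1 + sqn w)) * sig w.
Proof.
rewrite /euler !pd_sig.
transitivity (- (4 / (1 + sqn w)) * sig w * (w 0 0 ^+ 2 + w 0 1 ^+ 2)); first by ring.
by rewrite -/(sqn w); ring.
Qed.

(** The transition conjugates the homothety by [e^t] to the one by [e^-t]; the identity is the
    derivative of this relation at [t = 0]. *)
Lemma euler_transition f0 f1 w : smooth f0 -> smooth f1 ->
  (forall v, v != 0 -> f1 (transition v) = f0 v) -> w != 0 ->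
  euler f1 (transition w) = - euler f0 w.
Proof.
move=> s0 s1 f10 w0.
have dexp (f : 'rV[R]_2 -> R) v (t : R) : smooth f ->
    is_derive t 1 (fun t : R => f (expR t *: v)) (euler f (expR t *: v)).
  move=> sf; have E u : pt (u * v 0 0) (u * v 0 1) = u *: v.
    by rewrite [RHS]row2E !mxE.
  have dl (a : R) : is_derive t 1 (fun t => expR t * a) (expR t * a).
    have := is_derive_mulR (is_derive_expR t) (is_derive_cst a t 1).
    by rewrite mulr0 add0r mulrC.
  have := is_derive_pt (dl (v 0 0)) (dl (v 0 1)) (smooth_diff _ sf).
  rewrite E (_ : (fun u => f (pt _ _)) = (fun u => f (expR u *: v))); last first.
    by apply/funext => u; rewrite E.
  by move=> D; apply: is_derive_eq D _; rewrite /euler !mxE.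
have D1 := is_derive1_comp (dexp f1 (transition w) (- 0) s1) (is_deriveNid (0 : R) (1 : R)).
have D0 := dexp f0 w 0 s0.
have [_ E1] := D1; have [_ E0] := D0.
have FE : (fun t : R => f1 (expR t *: transition w)) \o -%R = (fun t : R => f0 (expR t *: w)).
  apply/funext => t /=; have e0 : expR t != 0 by rewrite gt_eqF// expR_gt0.
  rewrite -f10; last by rewrite scaler_eq0 negb_or e0.
  congr f1; rewrite expRN [LHS]row2E [RHS]row2E !mxE sqnZ !expr0 !expr1.
  by move: w0; rewrite -sqn_eq0 => w0; congr pt; field; rewrite e0 w0.
move: E1; rewrite FE E0 oppr0 expR0 !scale1r mulrN1 => ->.
by rewrite opprK.
Qed.

End averages.

(** * Divergence of a vector field and the radial differential equation *)

Section vector_fields.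
Context {R : realType}.
Implicit Types (f g k X Y : 'rV[R]_2 -> R) (w v : 'rV[R]_2) (c s : R).

Lemma transition_continuous w : w != 0 -> {for w, continuous (@transition R)}.
Proof.
rewrite -sqn_eq0 => w0.
rewrite (_ : @transition R = (fun w => pt (w 0 0 / sqn w) (- w 0 1 / sqn w))); last first.
  by apply/funext => v; exact: transition_pt.
have ci : {for w, continuous (fun w : 'rV[R]_2 => (sqn w)^-1)}.
  have cs : {for w, continuous (@sqn R)} by move: (w); exact: (smooth_continuous smooth_sqn).
  exact: cvgV w0 cs.
have cc (i : 'I_2) : {for w, continuous (fun w : 'rV[R]_2 => w 0 i : R)}.
  by move: (w); exact: (smooth_continuous (@smooth_coord R i)).
exact: cvgD (cvgZr_tmp (cvgM (cc 0) ci)) (cvgZr_tmp (cvgM (cvgN (cc 1)) ci)).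
Qed.

(** Off the circle [hh c s] cancels. A point of the circle is a limit of points outside it, and the
    transition is continuous there because the point is not the origin. *)
Lemma hh_dense_transition c s f0 f1 (e : R) : `|c| < 1 -> s = 1 \/ s = -1 ->
  continuous f0 -> continuous f1 ->
  (forall w, w != 0 -> hh c s w * f1 (transition w) = hh c s w * (e * f0 w)) ->
  forall w, w != 0 -> f1 (transition w) = e * f0 w.
Proof.
move=> hc hs c0 c1 f10 w w0.
have [hw|hw] := eqVneq (hh c s w) 0; last exact: (mulfI hw) (f10 w w0).
apply/eqP; rewrite -subr_eq0; apply/eqP.
apply: (@off_circle_limit0 _ (fun w => f1 (transition w) - e * f0 w)) => [|v wv].
  have cT : {for w, continuous (fun w => f1 (transition w))}.
    exact: (@continuous_comp _ _ _ (@transition R) f1 w (transition_continuous w0) (c1 _)).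
  exact: cvgB cT (cvgM (cvg_cst e) (c0 w)).
have v0 : v != 0 by rewrite -sqn_eq0 gt_eqF// (le_lt_trans (sqn_ge0 w)).
have hv : hh c s v != 0.
  rewrite hh_eq0// gt_eqF//; move/eqP: hw; rewrite hh_eq0// => /eqP <-.
  exact: wv.
by rewrite ((mulfI hv) _ _ (f10 v v0)) subrr.
Qed.

(** [xi] is half the derivative of [sqn] along the field, [tau] is [sqn] times its angular velocity,
    and the last term of [divw] is the logarithmic derivative of [sig] along it. *)
Definition xi X Y w : R := w 0 0 * X w + w 0 1 * Y w.
Definition tau X Y w : R := w 0 0 * Y w - w 0 1 * X w.
Definition divw X Y w : R := pd 0 X w + pd 1 Y w - 4 / (1 + sqn w) * xi X Y w.

(* [X(h) - h div X], [div] being the divergence for the area form. *)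
Definition Lop c s X Y w : R := s * sig w * xi X Y w - hh c s w * divw X Y w.

Lemma smooth_xi X Y : smooth X -> smooth Y -> smooth (xi X Y).
Proof.
by move=> sX sY; apply: smoothD; apply: smoothM => //; exact: smooth_coord.
Qed.

Lemma smooth_tau X Y : smooth X -> smooth Y -> smooth (tau X Y).
Proof.
by move=> sX sY; apply: smoothB; apply: smoothM => //; exact: smooth_coord.
Qed.

Lemma smooth_divw X Y : smooth X -> smooth Y -> smooth (divw X Y).
Proof.
move=> sX sY; apply: smoothB; first exact: smoothD (smooth_pd 0 sX) (smooth_pd 1 sY).
by apply: smoothM; [exact: smoothZ smooth_inv1sqn|exact: smooth_xi].
Qed.

(** The divergence in polar coordinates, multiplied by [sqn w] so as to make sense at the origin. *)
Lemma sqn_divw X Y w : smooth X -> smooth Y ->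
  sqn w * divw X Y w = euler (xi X Y) w + dtheta (tau X Y) w
     - 4 * sqn w / (1 + sqn w) * xi X Y w.
Proof.
move=> sX sY; have dX := smooth_diff w sX; have dY := smooth_diff w sY.
have dc (i : 'I_2) := smooth_diff w (@smooth_coord R i).
have dM (i : 'I_2) Z : smooth Z -> differentiable (fun w => w 0 i * Z w) w.
  by move=> sZ; exact: smooth_diff w (smoothM (smooth_coord i) sZ).
have pM l (i : 'I_2) Z : smooth Z ->
    pd l (fun w => w 0 i * Z w) w = w 0 i * pd l Z w + Z w * (i == l)%:R.
  by move=> sZ; rewrite (pdM _ (dc i) (smooth_diff w sZ)) pd_coord.
rewrite /euler /dtheta /xi /tau.
rewrite !(pdD _ (dM 0 X sX) (dM 1 Y sY)) !(pdB _ (dM 0 Y sY) (dM 1 X sX)) !pM//.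
rewrite /divw /xi.
rewrite (_ : (0 == 0 :> 'I_2) = true)// (_ : (1 == 1 :> 'I_2) = true)//.
rewrite (_ : (1 == 0 :> 'I_2) = false)// (_ : (0 == 1 :> 'I_2) = false)//.
move: (pd 0 X w) (pd 1 X w) (pd 0 Y w) (pd 1 Y w) (X w) (Y w) => a b a' b' x y.
rewrite [in X in X * (_ - _)]/sqn mulrBr.
have -> : w 0 0 ^+ 2 + w 0 1 ^+ 2 = sqn w by [].
transitivity ((w 0 0 ^+ 2 + w 0 1 ^+ 2) * (a + b') -
  4 * sqn w / (1 + sqn w) * (w 0 0 * x + w 0 1 * y)); last by rewrite /=; ring.
by rewrite -/(sqn w); ring.
Qed.

Lemma divwB X Y X' Y' w : smooth X -> smooth Y -> smooth X' -> smooth Y' ->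
  divw (fun w => X w - X' w) (fun w => Y w - Y' w) w = divw X Y w - divw X' Y' w.
Proof.
move=> sX sY sX' sY'; rewrite /divw /xi.
rewrite (pdB _ (smooth_diff w sX) (smooth_diff w sX')).
rewrite (pdB _ (smooth_diff w sY) (smooth_diff w sY')).
by move: (pd 0 X w) (pd 1 Y w) (pd 0 X' w) (pd 1 Y' w) => *; ring.
Qed.

Lemma LopB c s X Y X' Y' w : smooth X -> smooth Y -> smooth X' -> smooth Y' ->
  Lop c s (fun w => X w - X' w) (fun w => Y w - Y' w) w = Lop c s X Y w - Lop c s X' Y' w.
Proof.
move=> sX sY sX' sY'; rewrite /Lop divwB// /xi.
by move: (divw X Y w) (divw X' Y' w) => *; ring.
Qed.

(* The [x_3]-component of the field, averaged over the rotations, satisfies an ordinary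
   differential equation in [z = x_3]; in these terms it reads
   [t1 (c - z) + t2 = - al - (c - z) al'], so that [t1 = (c - z) al''] after differentiation. *)
Lemma radial_ode c (t1 t2 : R) al al1 : `|c| < 1 -> smooth al -> radial al -> continuous al1 ->
  (forall w, w != 0 -> al1 (transition w) = al w) -> al 0 = 0 -> al1 0 = 0 ->
  (forall w, sqn w * sig w * (t1 * hh c 1 w + t2) =
     - (sqn w * sig w * al w) + hh c 1 w * euler al w) ->
  [/\ t1 = 0, t2 = 0 & forall w, al w = 0].
Proof.
move=> hc sal ral cal1 al10 al00 al100 eq0.
have h1 : (1 : R) = 1 \/ (1 : R) = -1 by left.
have seal := smooth_euler sal.
pose isig w : R := 4^-1 * (1 + sqn w) ^+ 2.
have sis : smooth isig by apply: smoothZ; apply: smoothX; exact: smooth_1sqn.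
have isE w : isig w * sig w = 1.
  by rewrite /isig /sig; have := sqn1_neq0 w; move: (sqn w) => q q0; field.
(* In terms of [z = zeta w], [B] is [sqn w] times [al'(z)], in a form that is visibly smooth at the
   pole. *)
pose B w : R := - (isig w * euler al w).
have sB : smooth B by apply: smoothN; exact: smoothM.
have EalB w : euler al w = - (sig w * B w).
  by rewrite /B mulrN opprK mulrA [sig w * _]mulrC isE mul1r.
have eq1 w : sqn w * (t1 * hh c 1 w + t2) = - (sqn w * al w) - hh c 1 w * B w.
  apply: (mulfI (sig_neq0 w)).
  have := eq0 w; rewrite EalB => E.
  transitivity (sqn w * sig w * (t1 * hh c 1 w + t2)); first by ring.
  by rewrite E; ring.
have shh := smooth_hh c 1.
(* The Euler derivative of [eq1]. *)
have eq2 w : 2 * sqn w * (t1 * hh c 1 w + t2) + sqn w * (t1 * (sqn w * sig w)) =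
    - (2 * sqn w * al w + sqn w * euler al w)
    - (hh c 1 w * euler B w + B w * (sqn w * sig w)).
  have : euler (fun w => sqn w * (t1 * hh c 1 w + t2)) w =
         euler (fun w => (-1) * (sqn w * al w) + (-1) * (hh c 1 w * B w)) w.
    by congr (euler _ w); apply/funext => v; rewrite eq1; ring.
  have sl : smooth (fun w => t1 * hh c 1 w + t2) by exact: smoothD (smoothZ _ shh) (smooth_cst _).
  rewrite eulerM//; last exact: smooth_sqn.
  rewrite eulerD; [|exact: smoothZ|exact: smooth_cst].
  rewrite euler_cst eulerZ// euler_hh euler_sqn eulerD; first last.
  - by apply: smoothZ; exact: smoothM.
  - by apply: smoothZ; apply: smoothM => //; exact: smooth_sqn.
  rewrite !eulerZ; first last.
  - by apply: smoothM => //; exact: smooth_sqn.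
  - exact: smoothM.
  rewrite !eulerM//; last exact: smooth_sqn.
  rewrite euler_sqn euler_hh.
  move: (euler al w) (euler B w) (hh c 1 w) (B w) (al w) (sig w) (sqn w) => a b h B' al' sg q E.
  apply/eqP; rewrite -subr_eq0; move/eqP: E; rewrite -subr_eq0 => /eqP E.
  by apply/eqP; rewrite -[RHS]E; ring.
(* Subtracting twice [eq1] from [eq2] eliminates [al]. Since [euler B - 2 * B] is
   [- sqn w ^+ 2 * sig w] times [al''(z)], the result is [t1 = h al'']. *)
have eq3 w : t1 * (sqn w ^+ 2 * sig w) = - (hh c 1 w * (euler B w - 2 * B w)).
  have E1 := eq1 w; have E2 := eq2 w; rewrite EalB in E2.
  move: (euler B w) (hh c 1 w) (B w) (al w) (sig w) (sqn w) E1 E2 => b h B' al' sg q E1 E2.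
  apply/eqP; rewrite -subr_eq0; apply/eqP.
  move/eqP: E1; rewrite -subr_eq0 => /eqP E1; move/eqP: E2; rewrite -subr_eq0 => /eqP E2.
  transitivity ((2 * q * (t1 * h + t2) + q * (t1 * (q * sg)) -
      (- (2 * q * al' + q * - (sg * B')) - (h * b + B' * (q * sg)))) -
    2 * (q * (t1 * h + t2) - (- (q * al') - h * B'))); first by ring.
  by rewrite E1 E2 mulr0 subrr.
have t10 : t1 = 0.
  have [r r0 hr] := hh_zero_ex hc h1.
  have /eqP := eq3 (pt r 0); rewrite hr mul0r oppr0 mulf_eq0 => /orP[/eqP//|].
  rewrite mulf_eq0 (negPf (sig_neq0 _)) orbF expf_eq0 /= sqn_pt [0 ^+ 2]expr2 mulr0 addr0.
  by rewrite expf_eq0 /= gt_eqF.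
have C0 w : euler B w - 2 * B w = 0.
  apply: (@hh_dense _ c 1 (fun w => euler B w - 2 * B w) (fun=> 0)) => // [||v].
  - by apply: smooth_continuous; exact: smoothB (smooth_euler sB) (smoothZ 2 sB).
  - exact: cst_continuous.
  - by rewrite mulr0; have := eq3 v; rewrite t10 mul0r => /eqP; rewrite eq_sym oppr_eq0 => /eqP.
(* This is [B / sqn] along the ray; its constancy makes [al] an affine function of [z]. *)
pose b (t : R) := expR (-2 * t) * B (eray t).
have bcst t : b t = b 0.
  apply: is_derive_0_is_cst => x.
  have dl : is_derive x 1 (fun t : R => -2 * t) (-2).
    have := is_derive_lin (-2) 0 x.
    rewrite (_ : (fun t => t * -2 + 0) = (fun t => -2 * t))//.
    by apply/funext => u; rewrite addr0 mulrC.
  have D := is_derive_mulR (is_derive1_comp (is_derive_expR (-2 * x)) dl) (is_derive_eray x sB).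
  apply: is_derive_eq D _.
  have := C0 (eray x); move/eqP; rewrite subr_eq0 => /eqP ->.
  by rewrite /=; move: (B _) (expR _) => p q; ring.
pose kap := b 0.
have BE t : B (eray t) = kap * sqn (eray t).
  rewrite /kap -(bcst t) /b sqn_eray mulrAC -[LHS]mul1r; congr (_ * _).
  by rewrite expr2 -!expRD (_ : -2 * t + (t + t) = 0) ?expR0//; ring.
pose a (t : R) := al (eray t) + (- kap) * zeta (eray t).
have acst t : a t = a 0.
  apply: is_derive_0_is_cst => x.
  have D := is_deriveD (is_derive_eray x sal) (is_deriveZ (- kap) (is_derive_eray x smooth_zeta)).
  apply: is_derive_eq D _.
  by rewrite EalB BE euler_zeta /GRing.scale /=; move: (sig _) (sqn _) => p q; ring.
pose k2 := a 0.
have alE : forall w, al w = kap * zeta w + k2.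
  apply: dense_neq0.
  - exact: smooth_continuous.
  - by apply: smooth_continuous; exact: smoothD (smoothZ _ smooth_zeta) (smooth_cst _).
  - move=> w /eray_ex[t wt]; rewrite (ral _ _ wt) (radial_zeta wt) /k2 -(acst t) /a.
    by move: (al _) (zeta _) => p q; ring.
have al1E : forall w, al1 w = - kap * zeta w + k2.
  apply: dense_neq0 => // [|w w0].
    by apply: smooth_continuous; exact: smoothD (smoothZ _ smooth_zeta) (smooth_cst _).
  have T0 := transition_neq0 w0.
  by rewrite -{1}(transitionK w0) al10// alE zeta_transition//; ring.
have z0 : zeta (0 : 'rV[R]_2) = 1 by rewrite /zeta sqn0 subr0 addr0 divr1.
(* The two poles give [kap + k2 = 0] and [- kap + k2 = 0]. *)
have e0 := alE 0; have e1 := al1E 0; rewrite z0 al00 in e0; rewrite z0 al100 in e1.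
have k0 : kap = 0 by lra.
have k20 : k2 = 0 by lra.
have al0 w : al w = 0 by rewrite alE k0 k20 mul0r addr0.
split=> //; have := eq1 (pt 1 0); rewrite t10 al0.
have -> : B (pt 1 0) = 0.
  by rewrite /B (_ : al = fun=> 0) ?euler_cst ?mulr0 ?oppr0//; exact/funext.
rewrite sqn_pt expr1n [0 ^+ 2]expr2 mulr0 addr0 !mul1r mul0r add0r => ->.
by rewrite mulr0 subr0 oppr0.
Qed.

End vector_fields.

(** * Functions and fields in the two charts, and the averaged coboundary equation *)

Section chart_pairs.
Context {R : realType}.
Implicit Types (X Y f : bool -> 'rV[R]_2 -> R) (w v : 'rV[R]_2) (c s : R).

Definition sgn (b : bool) : R := (-1) ^+ b.

Lemma sgnP b : sgn b = 1 \/ sgn b = -1.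
Proof. by case: b; [right|left]; rewrite /sgn ?expr1 ?expr0. Qed.

Lemma sgnN b : sgn (~~ b) = - sgn b.
Proof. by case: b; rewrite /sgn ?expr1 ?expr0 ?opprK. Qed.

Lemma sgn2 b : sgn b * sgn b = 1.
Proof. by case: b; rewrite /sgn ?expr1 ?expr0; ring. Qed.

(* For [e = 1], a smooth function on the sphere. *)
Definition funpair (e : R) f := (forall b, smooth (f b)) /\
  forall b w, w != 0 -> f (~~ b) (transition w) = e * f b w.

(* [X d_x + Y d_y] in the two charts; the transition [w |-> 1 / w] reverses the radial and the
   angular components of a field. *)
Definition vecpair X Y := [/\ forall b, smooth (X b), forall b, smooth (Y b) &
  forall b w, w != 0 ->
    sqn w ^+ 2 * xi (X (~~ b)) (Y (~~ b)) (transition w) = - xi (X b) (Y b) w /\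
    sqn w ^+ 2 * tau (X (~~ b)) (Y (~~ b)) (transition w) = - tau (X b) (Y b) w].

Lemma funpair_half (e : R) f : e * e = 1 -> (forall b, smooth (f b)) ->
  (forall w, w != 0 -> f true (transition w) = e * f false w) -> funpair e f.
Proof.
move=> ee sf h; split=> // -[] w w0 /=; last exact: h.
by rewrite -{2}(transitionK w0) h ?transition_neq0// mulrA ee mul1r.
Qed.

Definition isig w : R := (1 + sqn w) ^+ 2 / 4.

Lemma smooth_isig : smooth isig.
Proof. by apply: smoothM; [exact: smoothX smooth_1sqn|exact: smooth_cst]. Qed.

Lemma isig_sig w : isig w * sig w = 1.
Proof. by rewrite /isig /sig; have := sqn1_neq0 w; move: (sqn w) => q q0; field. Qed.

Lemma pd_isig l w : pd l isig w = (1 + sqn w) * w 0 l.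
Proof.
rewrite (_ : isig = (fun w => 4^-1 * ((1 + sqn w) * (1 + sqn w)))); last first.
  by apply/funext => v; rewrite /isig expr2 mulrC.
have d := smooth_diff w (@smooth_1sqn R).
rewrite (pdZ _ _ (smooth_diff w (smoothM smooth_1sqn smooth_1sqn))) (pdM _ d d) pd_1sqn.
by move: (sqn w) => q; field.
Qed.

Lemma isig_transition w : w != 0 -> sqn w ^+ 2 * isig (transition w) = isig w.
Proof.
rewrite -sqn_eq0 /isig sqn_transition; move: (sqn w) => q q0; by field.
Qed.

(* The Hamiltonian vector field of any function is a cocycle: [h div] of it is [X_f(h)]. *)
Lemma Lop_hamiltonian c s (f : 'rV[R]_2 -> R) w : smooth f ->
  Lop c s (fun w => - (hh c s w * isig w * pd 1 f w))
          (fun w => hh c s w * isig w * pd 0 f w) w = 0.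
Proof.
move=> sf; have sr := smoothM (smooth_hh c s) smooth_isig.
have s1 := smooth_pd 1 sf; have s0 := smooth_pd 0 sf.
have pr l : pd l (fun w => hh c s w * isig w) w = w 0 l * (s + hh c s w * (1 + sqn w)).
  rewrite (pdM _ (smooth_diff w (smooth_hh c s)) (smooth_diff w smooth_isig)).
  rewrite pd_hh pd_isig.
  transitivity (w 0 l * (s * (isig w * sig w) + hh c s w * (1 + sqn w))); first by ring.
  by rewrite isig_sig mulr1.
rewrite /Lop /divw (pdN _ (smooth_diff w (smoothM sr s1))).
rewrite (pdM _ (smooth_diff w sr) (smooth_diff w s1)) (pdM _ (smooth_diff w sr) (smooth_diff w s0)).
rewrite !pr (pd_swap w sf) /xi.
move: (pd 0 f w) (pd 1 f w) (pd 1 (pd 0 f) w) => a b d.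
have := sqn1_neq0 w; rewrite /sig /isig; move: (hh c s w) (sqn w) => h q q0.
by field.
Qed.

Lemma xi0 (X Y : 'rV[R]_2 -> R) : xi X Y 0 = 0.
Proof. by rewrite /xi !mxE !mul0r addr0. Qed.

Lemma rot_0 (a : R) : rot a (0 : 'rV[R]_2) = 0.
Proof. by apply/eqP; rewrite -sqn_eq0 sqn_rot sqn0. Qed.

(** For [t1 = t2 = 0] this bounds the radial component of a cocycle of degree 1: its average
    vanishes, so it can be integrated along the rotations. In general it is the independence of the
    classes of [pi_c] and [pi]. *)
Lemma Lop_avg c t1 t2 X Y : `|c| < 1 -> vecpair X Y ->
  (forall b w, Lop c (sgn b) (X b) (Y b) w = t1 * hh c (sgn b) w + t2) ->
  [/\ t1 = 0, t2 = 0 & forall b w, avg (turn (sgn b)) (xi (X b) (Y b)) w = 0].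
Proof.
move=> hc [sX sY XY] L.
have sxi b := smooth_xi (sX b) (sY b).
(* The derivative of [x_3] along the field, which unlike [xi] is a function on the sphere; it
   vanishes at the poles. *)
pose be b w : R := - sgn b * (sig w * xi (X b) (Y b) w).
have sbe b : smooth (be b) by apply: smoothZ; apply: smoothM => //; exact: smooth_sig.
pose al b := avg (turn (sgn b)) (be b).
have alE b w : al b w = - sgn b * (sig w * avg (turn (sgn b)) (xi (X b) (Y b)) w).
  rewrite /al /be avg_radialM; [|by []|exact: smoothM smooth_sig (sxi b)].
  by rewrite avg_radialM//; exact: radial_sig.
have cbe v : v != 0 -> be true (transition v) = be false v.
  move=> v0; have [E _] := XY false v v0; rewrite /= in E.
  rewrite /be sig_transition// (sgnN false) opprK.
  transitivity (sgn false * (sig v * (sqn v ^+ 2 * xi (X true) (Y true) (transition v)))).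
    by ring.
  by rewrite E; ring.
have alT w : w != 0 -> al true (transition w) = al false w.
  by move=> w0; rewrite /al (sgnN false); exact: avg_transition w0 cbe.
have al0 b : al b 0 = 0.
  rewrite /al avgE (_ : (fun t => _) = (fun=> 0)) ?int01_cst//.
  by apply/funext => t; rewrite rot_0 /be xi0 !mulr0.
have s0 : sgn false = 1 by [].
have sal b : smooth (al b) by exact: smooth_avg.
have ral : radial (al false).
  by apply: avg_radial => //;
    [exact: turn_neq0 (sgnP _)|exact: cos_turn (sgnP _)|exact: sin_turn (sgnP _)].
have ode : forall w, sqn w * sig w * (t1 * hh c 1 w + t2) =
     - (sqn w * sig w * al false w) + hh c 1 w * euler (al false) w.
  (* [G] collects the radial terms, and [H] is a radial function times an angular derivative, so
     that its average vanishes. *)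
  move=> w; pose G v := (- (sqn v * sig v)) * be false v + hh c 1 v * euler (be false) v.
  pose H v := (hh c 1 v * sig v) * dtheta (tau (X false) (Y false)) v.
  have eqp v : sqn v * sig v * (t1 * hh c 1 v + t2) = G v - H v.
    have := L false v; rewrite s0 => <-.
    have E := sqn_divw v (sX false) (sY false).
    transitivity (sig v * (sqn v * (sig v * xi (X false) (Y false) v)) -
      sig v * hh c 1 v * (sqn v * divw (X false) (Y false) v)).
      by rewrite /Lop; move: (divw _ _ v) (xi _ _ v) => x y; ring.
    rewrite E /G /H /be s0.
    rewrite (@eulerZ _ (-1) (fun w => sig w * xi (X false) (Y false) w)); last exact: smoothM smooth_sig (sxi _).
    rewrite eulerM; [|exact: smooth_sig|exact: sxi]; rewrite euler_sig.
    by move: (xi _ _ v) (euler _ v) (dtheta _ v) => x y z; ring.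
  have sbe0 := sbe false; have ste := smooth_dtheta (smooth_tau (sX false) (sY false)).
  have rq : radial (fun v => - (sqn v * sig v)) by move=> v v' vv; rewrite vv (radial_sig vv).
  have rh : radial (fun v => hh c 1 v * sig v).
    by move=> v v' vv; rewrite (radial_sig vv) (radial_hh c 1 vv).
  have sG1 : smooth (fun v => - (sqn v * sig v) * be false v).
    by apply: smoothM => //; apply: smoothN; exact: smoothM smooth_sqn smooth_sig.
  have sG2 : smooth (fun v => hh c 1 v * euler (be false) v).
    by apply: smoothM; [exact: smooth_hh|exact: smooth_euler].
  have sH : smooth H.
    by apply: smoothM => //; exact: smoothM (smooth_hh c 1) smooth_sig.
  transitivity (avg (turn 1) (fun v => sqn v * sig v * (t1 * hh c 1 v + t2)) w).
    rewrite avg_of_radial// => v v' vv.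
    by rewrite vv (radial_sig vv) (radial_hh c 1 vv).
  rewrite (_ : (fun v => _) = (fun v => G v - H v)); last exact/funext.
  rewrite avgB//; last exact: smoothD sG1 sG2.
  have e1 : avg (turn 1) (fun v => - (sqn v * sig v) * be false v) w =
      - (sqn w * sig w) * avg (turn 1) (be false) w := avg_radialM _ _ rq sbe0.
  have e2 : avg (turn 1) (fun v => hh c 1 v * euler (be false) v) w =
      hh c 1 w * avg (turn 1) (euler (be false)) w.
    exact: avg_radialM (radial_hh c 1) (smooth_euler sbe0).
  have e3 : avg (turn 1) H w =
      hh c 1 w * sig w * avg (turn 1) (dtheta (tau (X false) (Y false))) w.
    exact: avg_radialM _ _ rh ste.
  rewrite /G (avgD _ _ sG1 sG2) e1 e2 e3 avg_dtheta; [|by left|exact: smooth_tau].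
  by rewrite mulr0 subr0 -euler_avg// mulNr.
have [t10 t20 al00] := radial_ode hc (sal false) ral (smooth_continuous (sal true)) alT
  (al0 false) (al0 true) ode.
split=> // b w.
have alb v : al b v = 0.
  case: b; last exact: al00.
  apply: (@dense_neq0 _ (al true) (fun=> 0)) => [||u u0].
  - by apply: smooth_continuous; exact: smooth_avg.
  - exact: cst_continuous.
  - by rewrite -(transitionK u0) alT ?al00// transition_neq0.
have E := alb w; rewrite alE in E; apply: (mulfI (sig_neq0 w)).
by rewrite -[LHS]mul1r -(sgn2 b) -[sgn b * sgn b]mulrNN -mulrA E !mulr0.
Qed.

End chart_pairs.

(** * Cocycles of degree 1 up to Hamiltonian fields *)

Section first_cohomology.
Context {R : realType}.
Implicit Types (X Y f : bool -> 'rV[R]_2 -> R) (w v : 'rV[R]_2) (c s : R).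

(** [Y] vanishes on the axis [w 0 0 = 0], so its quotient by the first coordinate is smooth, as in
    Hadamard's lemma. The formula for [X] follows by cancelling the first coordinate off the axis
    and passing to the limit. *)
Lemma tangential_field (X Y : 'rV[R]_2 -> R) : smooth X -> smooth Y ->
  (forall w, xi X Y w = 0) ->
  exists psi, [/\ smooth psi, forall w, X w = - (w 0 1 * psi w) &
    forall w, Y w = w 0 0 * psi w].
Proof.
move=> sX sY XY.
pose psi := int_affine (Adiag id (fun=> 1)) (Bzero (R := R)) (fun=> 1) (pd 0 Y).
have spsi : smooth psi.
  exact: int_affine_smooth (Adiag_continuous (@idR_continuous R) (@cstR_continuous R 1))
    Bzero_continuous (@cstR_continuous R 1) (smooth_pd 0 sY).
have Y00 y : y != 0 -> Y (pt 0 y) = 0.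
  move=> y0; apply: (mulfI y0); rewrite mulr0.
  by have := XY (pt 0 y); rewrite /xi pt0 pt1 mul0r add0r.
(* The origin is reached by continuity along the half axis parametrized by [sqn w], a form to which
   [dense_neq0] applies. *)
have cq : continuous (fun w : 'rV[R]_2 => Y (pt 0 (sqn w))).
  apply: smooth_continuous; apply/smoothE => k.
  apply: (@CkOn_pt _ setT setT k (fun=> 0) (@sqn R) Y) => //; first exact: openT.
  - exact: CkOn_cst.
  - exact: (proj1 (smoothE _) (@smooth_sqn R)).
  - exact: (proj1 (smoothE _) sY).
have Y000 : Y (pt 0 0) = 0.
  have E : forall w, Y (pt 0 (sqn w)) = 0.
    apply: (@dense_neq0 _ (fun w => Y (pt 0 (sqn w))) (fun=> 0)) => // [|w w0].
      exact: cst_continuous.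
    by rewrite Y00// sqn_eq0.
  by have := E 0; rewrite sqn0.
have YE w : Y w = w 0 0 * psi w.
  have := prim0_pd0 w sY; rewrite /prim0 -/psi => ->.
  have [->|/Y00 ->] := eqVneq (w 0 1) 0; last by rewrite subr0.
  by rewrite Y000 subr0.
exists psi; split=> // w; apply/eqP; rewrite -addr_eq0; apply/eqP.
have E v : v 0 0 != 0 -> X v + v 0 1 * psi v = 0.
  move=> v0; apply: (mulfI v0); rewrite mulr0 -[RHS](XY v) /xi YE.
  by move: (psi v) (X v) => a b; ring.
have [w0|w0] := eqVneq (w 0 0) 0; last exact: E.
apply: (@ray_limit0 _ (fun v => X v + v 0 1 * psi v) w (pt 1 0)).
  by move: w {w0}; apply: smooth_continuous; apply: smoothD => //; apply: smoothM => //;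
    exact: smooth_coord.
by move=> t t0; apply: E; rewrite mxE [X in X + _]mxE pt0 mulr1 w0 addr0 gt_eqF.
Qed.

(* Subtracting the Hamiltonian field of [f], [d f / d theta = - s div X], leaves a field tangent
   to the circles [x_3 = const]. *)
Lemma cocycle1_decomposition c X Y : `|c| < 1 -> vecpair X Y ->
  (forall b w, Lop c (sgn b) (X b) (Y b) w = 0) ->
  exists f t, funpair 1 f /\ forall b w,
    X b w = - (hh c (sgn b) w * isig w * pd 1 (f b) w) - t * (sgn b * w 0 1) /\
    Y b w = hh c (sgn b) w * isig w * pd 0 (f b) w + t * (sgn b * w 0 0).
Proof.
move=> hc vXY L0; have [sX sY XY] := vXY.
have sxi b := smooth_xi (sX b) (sY b).
have [|_ _ avgxi] := @Lop_avg R c 0 0 X Y hc vXY.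
  by move=> b w; rewrite L0 mul0r addr0.
pose u b := divw (X b) (Y b).
have su b : smooth (u b) := smooth_divw (sX b) (sY b).
have hu b w : hh c (sgn b) w * u b w = sgn b * sig w * xi (X b) (Y b) w.
  by have /eqP := L0 b w; rewrite /Lop subr_eq0 => /eqP ->.
(* Average [hu], whose right-hand side has average zero, and cancel the radial factor [h]. *)
have avgu b w : avg (turn (sgn b)) (u b) w = 0.
  apply: (@hh_dense _ c (sgn b) (avg (turn (sgn b)) (u b)) (fun=> 0)) => //.
  - exact: sgnP.
  - by apply: smooth_continuous; exact: smooth_avg.
  - exact: cst_continuous.
  - move=> v; rewrite mulr0 -(avg_radialM _ _ (radial_hh c (sgn b)) (su b)).
    rewrite (_ : (fun w => _) = (fun w => (sgn b * sig w) * xi (X b) (Y b) w)); last exact/funext.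
    rewrite avg_radialM//; last by move=> v1 v2 vv; rewrite (radial_sig vv).
    by rewrite avgxi mulr0.
have hT b w : w != 0 -> hh c (sgn (~~ b)) (transition w) = hh c (sgn b) w.
  by move=> w0; rewrite sgnN hh_transition.
have uT b w : w != 0 -> u (~~ b) (transition w) = u b w.
  move=> w0; rewrite -[RHS]mul1r.
  apply: (@hh_dense_transition _ c (sgn b) (u b) (u (~~ b)) 1 hc (sgnP b)) => //.
  - exact: smooth_continuous.
  - exact: smooth_continuous.
  move=> v v0; rewrite mul1r hu -(hT b v v0) hu sig_transition// sgnN.
  have [E _] := XY b v v0.
  transitivity (- sgn b * (sig v * (sqn v ^+ 2 * xi (X (~~ b)) (Y (~~ b)) (transition v)))).
    by ring.
  by rewrite E; ring.
pose f b w := - sgn b * avg_prim (turn (sgn b)) (u b) w.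
have sf b : smooth (f b) by apply: smoothZ; exact: smooth_avg_prim.
have fT b w : w != 0 -> f (~~ b) (transition w) = f b w.
  move=> w0; rewrite /f sgnN (avg_prim_transition _ w0 (su b)); last exact: uT.
  by ring.
have thf b w : dtheta (f b) w = - sgn b * u b w.
  have sc : smooth (fun _ : 'rV[R]_2 => - sgn b) by exact: smooth_cst.
  rewrite /f (dthetaM_radial w sc _ (smooth_avg_prim _ (su b)))//.
  by rewrite dtheta_avg_prim ?avgu ?subr0//; [exact: cos_turn (sgnP b)|exact: sin_turn (sgnP b)].
clearbody f.
pose rho b w := hh c (sgn b) w * isig w.
have sr b : smooth (rho b) := smoothM (smooth_hh c (sgn b)) smooth_isig.
pose fX b w := - (rho b w * pd 1 (f b) w); pose fY b w := rho b w * pd 0 (f b) w.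
have sfX b : smooth (fX b) by apply: smoothN; exact: smoothM (sr b) (smooth_pd 1 (sf b)).
have sfY b : smooth (fY b) by exact: smoothM (sr b) (smooth_pd 0 (sf b)).
pose X' b w := X b w - fX b w; pose Y' b w := Y b w - fY b w.
have sX' b : smooth (X' b) := smoothB (sX b) (sfX b).
have sY' b : smooth (Y' b) := smoothB (sY b) (sfY b).
have xi' b w : xi (X' b) (Y' b) w = 0.
  transitivity (xi (X b) (Y b) w - rho b w * - dtheta (f b) w).
    rewrite /xi /X' /Y' /fX /fY /dtheta.
    by move: (pd 0 (f b) w) (pd 1 (f b) w) => p q; ring.
  rewrite thf /rho; apply/eqP; rewrite subr_eq0; apply/eqP.
  transitivity (isig w * sgn b * (hh c (sgn b) w * u b w)); last by ring.
  rewrite hu; transitivity ((sgn b * sgn b) * (isig w * sig w) * xi (X b) (Y b) w).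
    by rewrite sgn2 isig_sig !mul1r.
  by ring.
have L' b w : Lop c (sgn b) (X' b) (Y' b) w = 0.
  by rewrite LopB// L0 sub0r /fX /fY Lop_hamiltonian ?oppr0.
(* For a field with no radial component the cocycle equation reduces to [h div = 0]; zero divergence
   then makes the angular velocity [psi] radial. *)
have div' b w : divw (X' b) (Y' b) w = 0.
  apply: (@hh_dense _ c (sgn b) (divw (X' b) (Y' b)) (fun=> 0)) => //.
  - exact: sgnP.
  - by apply: smooth_continuous; exact: smooth_divw.
  - exact: cst_continuous.
  - by move=> v; rewrite mulr0; have := L' b v; rewrite /Lop xi' mulr0 sub0r => /eqP;
      rewrite oppr_eq0 => /eqP.
have thtau b w : dtheta (tau (X' b) (Y' b)) w = 0.
  have := sqn_divw w (sX' b) (sY' b); rewrite div' mulr0 xi' mulr0 subr0.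
  rewrite (_ : xi (X' b) (Y' b) = fun=> 0) ?euler_cst ?add0r//; exact/funext.
have /choice[psi psiP] : forall b, exists psi, [/\ smooth psi,
    forall w, X' b w = - (w 0 1 * psi w) & forall w, Y' b w = w 0 0 * psi w].
  by move=> b; exact: tangential_field (sX' b) (sY' b) (xi' b).
have spsi b : smooth (psi b) by have [] := psiP b.
have XE b w : X' b w = - (w 0 1 * psi b w) by have [_ ->] := psiP b.
have YE b w : Y' b w = w 0 0 * psi b w by have [_ _ ->] := psiP b.
have tauE b w : tau (X' b) (Y' b) w = sqn w * psi b w.
  by rewrite /tau XE YE /sqn; ring.
have rpsi b : radial (psi b).
  apply: dtheta0_radial => // w; have [->|w0] := eqVneq w 0.
    by rewrite /dtheta !mxE !mul0r subrr.
  rewrite -sqn_eq0 in w0; apply: (mulfI w0); rewrite mulr0 -[RHS](thtau b w).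
  rewrite (_ : tau (X' b) (Y' b) = (fun w => sqn w * psi b w)); last exact/funext.
  by rewrite (dthetaM_radial w (@smooth_sqn R))// => v1 v2.
have tauT b w : w != 0 -> sqn w ^+ 2 * tau (X' (~~ b)) (Y' (~~ b)) (transition w) =
    - tau (X' b) (Y' b) w.
  move=> w0; have [_ E] := XY b w w0.
  have tE d v : tau (X' d) (Y' d) v = tau (X d) (Y d) v - rho d v * euler (f d) v.
    rewrite /tau /X' /Y' /fX /fY /euler.
    by move: (pd 0 (f d) v) (pd 1 (f d) v) => p q; ring.
  rewrite !tE mulrBr E (euler_transition (sf b) (sf (~~ b)) (fT b) w0) /rho (hT b w w0).
  rewrite -(isig_transition w0).
  by move: (euler (f b) w) (tau (X b) (Y b) w) (hh c (sgn b) w) (isig _) => e1 e2 e3 e4; ring.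
have psiT b w : w != 0 -> psi (~~ b) (transition w) = -1 * psi b w.
  move=> w0; have := tauT b w w0; rewrite !tauE sqn_transition.
  have q0 : sqn w != 0 by rewrite sqn_eq0.
  move=> E; apply: (mulfI q0).
  transitivity (sqn w ^+ 2 * ((sqn w)^-1 * psi (~~ b) (transition w))).
    by move: (sqn w) q0 (psi _ _) => q q0 a; field.
  by rewrite E; ring.
have [r r0 hr] := hh_zero_ex hc (sgnP false).
(* Hamiltonian fields vanish on the circle, so the coefficient of the modular field has to be the
   angular velocity there. *)
pose t := psi false (pt r 0).
have psi0 b w : hh c (sgn b) w = 0 -> psi b w = t * sgn b.
  have F v : hh c (sgn false) v = 0 -> psi false v = t.
    move=> /eqP; rewrite hh_eq0//; last exact: sgnP.
    move=> /eqP hv; apply: rpsi; rewrite hv; apply/eqP; rewrite eq_sym -hh_eq0//; last exact: sgnP.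
    by rewrite hr.
  case: b => [hw|/F ->]; last by rewrite mulr1.
  (* The circle does not pass through the pole, because [rho] is positive. *)
  have w0 : w != 0.
    apply/eqP => w0; have [rh _] := pm1_bounds hc (sgnP true).
    move/eqP: hw; rewrite hh_eq0//; last exact: sgnP.
    by rewrite w0 sqn0 => /eqP E; rewrite -[X in _ < X]E ltxx in rh.
  have T0 := transition_neq0 w0.
  rewrite -(transitionK w0) (psiT false)// F.
    by rewrite /sgn expr1; ring.
  by rewrite -(hT false)// transitionK.
have /choice[k kP] : forall b, exists k, [/\ smooth k, radial k &
    forall w, psi b w - t * sgn b = hh c (sgn b) w * k w].
  move=> b; apply: (hh_division hc (sgnP b)).
  - exact: smoothB (spsi b) (smooth_cst _).
  - by move=> v1 v2 vv; rewrite (rpsi b v1 v2 vv).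
  - by move=> w hw; rewrite psi0// subrr.
have sk b : smooth (k b) by have [] := kP b.
have rk b : radial (k b) by have [] := kP b.
have kE b w : psi b w - t * sgn b = hh c (sgn b) w * k b w by have [] := kP b.
have kT w : w != 0 -> k true (transition w) = -1 * k false w.
  apply: (@hh_dense_transition _ c (sgn false)) => //.
  - exact: sgnP.
  - exact: smooth_continuous.
  - exact: smooth_continuous.
  - move=> v v0; rewrite -{1}(hT false)// -kE (psiT false)// sgnN.
    by rewrite mulrCA -kE; ring.
(* The Hamiltonian field of a function with gradient [g w] rotates with angular velocity
   [h isig g = h k], the part of [psi] that is left. *)
pose g b w := sig w * k b w.
have sg b : smooth (g b) := smoothM smooth_sig (sk b).
have rg b : radial (g b) by move=> v1 v2 vv; rewrite /g (radial_sig vv) (rk b _ _ vv).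
have [|C CP] := @rad_pot_transition _ (-1) _ _ (sg false) (sg true) (rg false) (rg true).
  by move=> w w0; rewrite /g sig_transition// kT//; ring.
(* Subtracting [C] in one chart makes the two primitives agree and leaves the field unchanged. *)
pose f2 b w := rad_pot (g b) w - (if b then C else 0).
have sf2 b : smooth (f2 b) := smoothB (smooth_rad_pot (sg b)) (smooth_cst _).
have pf2 l b w : pd l (f2 b) w = w 0 l * g b w.
  rewrite /f2 (pdB _ (smooth_diff w (smooth_rad_pot (sg b))) (differentiable_cst _ _)) pd_cst subr0.
  exact: pd_rad_pot.
have pF : funpair 1 (fun b w => f b w + f2 b w).
  apply: funpair_half => [|b|w w0]; first exact: mulr1.
    exact: smoothD.
  rewrite mul1r (fT false)// /f2; congr (_ + _).
  by rewrite -(CP w w0); ring.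
exists (fun b w => f b w + f2 b w), t; split=> // b w.
rewrite !(pdD _ (smooth_diff w (sf b)) (smooth_diff w (sf2 b))) !pf2.
have pE : psi b w = t * sgn b + hh c (sgn b) w * isig w * g b w.
  rewrite /g; transitivity (t * sgn b + hh c (sgn b) w * k b w * (isig w * sig w)); last by ring.
  by rewrite isig_sig mulr1 -kE; ring.
split.
  have := XE b w; rewrite /X' /fX /rho pE => /eqP; rewrite subr_eq => /eqP ->.
  by move: (pd 1 (f b) w) (g b w) => p q; ring.
have := YE b w; rewrite /Y' /fY /rho pE => /eqP; rewrite subr_eq => /eqP ->.
by move: (pd 0 (f b) w) (g b w) => p q; ring.
Qed.

End first_cohomology.

(** * Bivector fields up to coboundaries *)

Section second_cohomology.
Context {R : realType}.
Implicit Types (u f : bool -> 'rV[R]_2 -> R) (w v : 'rV[R]_2) (c s : R).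

(** The components of [phi] times the Euler field plus [psi] times the rotation field. Both fields
    change sign under the transition, hence the factor [-1] that [phi] and [psi] acquire when this
    is a field on the sphere. *)
Definition polarX (phi psi : 'rV[R]_2 -> R) w : R := phi w * w 0 0 - psi w * w 0 1.
Definition polarY (phi psi : 'rV[R]_2 -> R) w : R := phi w * w 0 1 + psi w * w 0 0.

Lemma smooth_polarX phi psi : smooth phi -> smooth psi -> smooth (polarX phi psi).
Proof.
by move=> s1 s2; apply: smoothB; apply: smoothM => //; exact: smooth_coord.
Qed.

Lemma smooth_polarY phi psi : smooth phi -> smooth psi -> smooth (polarY phi psi).
Proof.
by move=> s1 s2; apply: smoothD; apply: smoothM => //; exact: smooth_coord.
Qed.

(** The term [2 * zeta] is the divergence of the Euler field for the area form. *)
Lemma Lop_polar c s phi psi w : smooth phi -> smooth psi ->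
  Lop c s (polarX phi psi) (polarY phi psi) w =
  s * (sqn w * sig w) * phi w
  - hh c s w * (2 * zeta w * phi w + euler phi w + dtheta psi w).
Proof.
move=> s1 s2; have d1 := smooth_diff w s1; have d2 := smooth_diff w s2.
have dc (i : 'I_2) := smooth_diff w (@smooth_coord R i).
have dM (f : 'rV[R]_2 -> R) (i : 'I_2) : smooth f -> differentiable (fun w => f w * w 0 i) w.
  by move=> sf; exact: smooth_diff w (smoothM sf (smooth_coord i)).
have pM l (f : 'rV[R]_2 -> R) (i : 'I_2) : smooth f ->
    pd l (fun w => f w * w 0 i) w = f w * (i == l)%:R + w 0 i * pd l f w.
  by move=> sf; rewrite (pdM _ (smooth_diff w sf) (dc i)) pd_coord.
rewrite /Lop /divw /polarX /polarY (pdB _ (dM _ 0 s1) (dM _ 1 s2)) (pdD _ (dM _ 1 s1) (dM _ 0 s2)).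
rewrite !pM// (_ : (0 == 0 :> 'I_2) = true)// (_ : (1 == 1 :> 'I_2) = true)//.
rewrite (_ : (1 == 0 :> 'I_2) = false)// (_ : (0 == 1 :> 'I_2) = false)//.
rewrite /euler /dtheta /xi zetaE.
have qE : w 0 0 ^+ 2 + w 0 1 ^+ 2 = sqn w by [].
have := sqn1_neq0 w.
move: (pd 0 phi w) (pd 1 phi w) (pd 0 psi w) (pd 1 psi w) (phi w) (psi w) => a b a' b' x y q0.
have E : 4 / (1 + sqn w) * sqn w = 4 - 4 / (1 + sqn w).
  by move: (sqn w) q0 => q q0; field.
have E1 : w 0 0 * (x * w 0 0 - y * w 0 1) + w 0 1 * (x * w 0 1 + y * w 0 0) = x * sqn w.
  by rewrite -qE; ring.
rewrite E1 [4 / _ * (x * _)]mulrCA E /=.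
by move: (sig w) (sqn w) q0 => p q q0; field.
Qed.

(* The last step of [cocycle2_decomposition], for [x], [z] and [y] the values of [u], [zeta]
   and [phi2] and [e1], [e2] those of [euler u] and [euler phi2]. *)
Lemma second_cohomology_identity c s (z x y e1 e2 t1 t2 : R) :
  1 - c ^+ 2 != 0 -> s = 1 \/ s = -1 ->
  x = s * (1 - z ^+ 2) * (s / (1 - c ^+ 2) * (x - t2) + (c - s * z) * y) -
    (c - s * z) * (2 * z * (s / (1 - c ^+ 2) * (x - t2) + (c - s * z) * y) +
      (s / (1 - c ^+ 2) * e1 + ((c - s * z) * e2 + y * (s * (1 - z ^+ 2)))) +
      ((c - s * z) * (- ((1 - c ^+ 2)^-1 * t2) - (2 * z * y + e2)) + t1 -
       (1 - c ^+ 2)^-1 * (s * e1 - (c - s * z) * x))) +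
    t1 * (c - s * z) + t2.
Proof. by move=> c0 [->|->]; field. Qed.

(* On the circle [X(h) = u - t2] for [X = s (u - t2) / (1 - c^2)] times the Euler field, so [h]
   divides [u - t2 - Lop X]; the quotient is [u1 + t2 h / (1 - c^2)].  The angular component
   [psi] integrates [avg u1 - u1] along the rotations, and [phi2] absorbs the radial function
   [avg u1 - t1], which is divisible by [h] for [t1] the value of [avg u1] on the circle. *)
Lemma cocycle2_decomposition c u : `|c| < 1 -> funpair 1 u ->
  exists t1 t2 phi psi, [/\ funpair (-1) phi, funpair (-1) psi &
    forall b w, u b w = Lop c (sgn b) (polarX (phi b) (psi b)) (polarY (phi b) (psi b)) w
      + t1 * hh c (sgn b) w + t2].
Proof.
move=> hc [su uT].
have c0 : 1 - c ^+ 2 != 0.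
  by move: hc; rewrite ltr_norml => /andP[c1 c2]; apply: lt0r_neq0; nra.
pose K := (1 - c ^+ 2)^-1.
have hT b w : w != 0 -> hh c (sgn (~~ b)) (transition w) = hh c (sgn b) w.
  by move=> w0; rewrite sgnN hh_transition.
have uT1 b w : w != 0 -> u (~~ b) (transition w) = u b w by move=> w0; rewrite uT// mul1r.
pose u1 b w := K * (sgn b * euler (u b) w - hh c (sgn b) w * u b w).
have su1 b : smooth (u1 b).
  apply: smoothZ; apply: smoothB; first exact: smoothZ _ (smooth_euler (su b)).
  exact: smoothM (smooth_hh c (sgn b)) (su b).
have u1T b w : w != 0 -> u1 (~~ b) (transition w) = u1 b w.
  move=> w0; rewrite /u1 (euler_transition (su b) (su (~~ b)) (uT1 b) w0) (hT b w w0).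
  by rewrite (uT1 b w w0) sgnN mulrNN.
pose m b := avg (turn (sgn b)) (u1 b).
have sm b : smooth (m b) := smooth_avg _ (su1 b).
have rm b : radial (m b).
  by apply: avg_radial => //;
    [exact: turn_neq0 (sgnP _)|exact: cos_turn (sgnP _)|exact: sin_turn (sgnP _)].
have mT b w : w != 0 -> m (~~ b) (transition w) = m b w.
  by move=> w0; rewrite /m sgnN; exact: avg_transition w0 (u1T b).
pose psi b w := - avg_prim (turn (sgn b)) (u1 b) w.
have spsi b : smooth (psi b) := smoothN (smooth_avg_prim _ (su1 b)).
have psiT b w : w != 0 -> psi (~~ b) (transition w) = -1 * psi b w.
  by move=> w0; rewrite /psi sgnN (avg_prim_transition _ w0 (su1 b) (u1T b)) mulN1r.
have thpsi b w : dtheta (psi b) w = m b w - u1 b w.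
  have sp := smooth_avg_prim (turn (sgn b)) (su1 b).
  rewrite /dtheta /psi !(pdN _ (smooth_diff w sp)).
  have := dtheta_avg_prim w (cos_turn (sgnP b)) (sin_turn (sgnP b)) (su1 b).
  rewrite /dtheta -/(m b w) => E.
  move: E; move: (pd 1 _ w) (pd 0 _ w) (m b w) (u1 b w) => p q x y E.
  by transitivity (- (w 0 0 * p - w 0 1 * q)); [ring|rewrite E opprB].
clearbody psi m.
have [r r0 hr] := hh_zero_ex hc (sgnP false).
pose t1 := m false (pt r 0).
have m0 b w : hh c (sgn b) w = 0 -> m b w = t1.
  have F v : hh c (sgn false) v = 0 -> m false v = t1.
    move=> /eqP; rewrite hh_eq0//; last exact: sgnP.
    move=> /eqP hv; apply: rm; rewrite hv; apply/eqP; rewrite eq_sym -hh_eq0//; last exact: sgnP.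
    by rewrite hr.
  case: b => [hw|/F ->//].
  have w0 : w != 0.
    apply/eqP => w0; have [rh _] := pm1_bounds hc (sgnP true).
    move/eqP: hw; rewrite hh_eq0//; last exact: sgnP.
    by rewrite w0 sqn0 => /eqP E; rewrite -[X in _ < X]E ltxx in rh.
  have T0 := transition_neq0 w0.
  by rewrite -(transitionK w0) (mT false)// F// -(hT false)// transitionK.
have /choice[k kP] : forall b, exists k, [/\ smooth k, radial k &
    forall w, m b w - t1 = hh c (sgn b) w * k w].
  move=> b; apply: (hh_division hc (sgnP b)).
  - exact: smoothB (sm b) (smooth_cst _).
  - by move=> v1 v2 vv; rewrite (rm b v1 v2 vv).
  - by move=> w hw; rewrite m0// subrr.
have sk b : smooth (k b) by have [] := kP b.
have rk b : radial (k b) by have [] := kP b.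
have kE b w : m b w - t1 = hh c (sgn b) w * k b w by have [] := kP b.
have kT w : w != 0 -> k true (transition w) = 1 * k false w.
  apply: (@hh_dense_transition _ c (sgn false)) => //.
  - exact: sgnP.
  - exact: smooth_continuous.
  - exact: smooth_continuous.
  - by move=> v v0; rewrite -{1}(hT false)// -kE (mT false)// mul1r kE.
pose g b w := sig w * k b w.
have sg b : smooth (g b) := smoothM smooth_sig (sk b).
have rg b : radial (g b) by move=> v1 v2 vv; rewrite /g (radial_sig vv) (rk b _ _ vv).
have [|C CP] := @rad_pot_transition _ 1 _ _ (sg false) (sg true) (rg false) (rg true).
  by move=> w w0; rewrite /g sig_transition// kT//; ring.
(* [phi2] times the Euler field has divergence [C / 2 - k]: the first term gives [- k], and the
   second gives the constant [C / 2], the mean of [k] over the sphere, and makes the two charts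
   match. *)
pose phi2 b w := - (isig w * rad_prim (g b) w) + C / 4 * (1 + sqn w).
have sphi2 b : smooth (phi2 b).
  apply: smoothD; last exact: smoothZ _ smooth_1sqn.
  by apply: smoothN; exact: smoothM smooth_isig (smooth_rad_prim (sg b)).
have phi2T w : w != 0 -> phi2 true (transition w) = -1 * phi2 false w.
  move=> w0; have q0 : sqn w != 0 by rewrite sqn_eq0.
  have := CP w w0; rewrite /phi2 /rad_pot sqn_transition mul1r => E.
  have I := isig_transition w0.
  have {}E : rad_prim (g true) (transition w) = sqn w * (C - sqn w * rad_prim (g false) w).
    rewrite -E; move: (rad_prim (g true) _) (rad_prim (g false) _) (sqn w) q0 => a b q q0.
    by field.
  have {}I : isig (transition w) = isig w / sqn w ^+ 2.
    by rewrite -I; move: (isig (transition w)) (sqn w) q0 => a q q0; field.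
  rewrite E I /isig; move: (rad_prim (g false) _) (sqn w) q0 => a q q0.
  by field.
have phi2E b w : 2 * zeta w * phi2 b w + euler (phi2 b) w = C / 2 - k b w.
  have sF := smooth_rad_prim (sg b).
  have E1 : euler (fun w : 'rV[R]_2 => 1 + sqn w) w = 2 * sqn w.
    rewrite (eulerD _ (smooth_cst 1) (@smooth_sqn R)) euler_cst add0r; exact: euler_sqn.
  have E2 : euler isig w = sqn w * (1 + sqn w).
    by rewrite /euler !pd_isig /sqn; ring.
  have E3 : euler (phi2 b) w = - (isig w * euler (rad_prim (g b)) w
      + rad_prim (g b) w * (sqn w * (1 + sqn w))) + C / 4 * (2 * sqn w).
    rewrite (_ : phi2 b = (fun w => -1 * (isig w * rad_prim (g b) w) + C / 4 * (1 + sqn w))).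
      have P := smoothM smooth_isig sF.
      rewrite (eulerD w (smoothZ (-1) P) (smoothZ (C / 4) (@smooth_1sqn R))).
      rewrite (eulerZ _ w P) (eulerZ _ w (@smooth_1sqn R)) E1.
      by rewrite (eulerM w smooth_isig sF) E2 mulN1r.
    by apply/funext => v; rewrite /phi2 mulN1r.
  have E4 := euler_rad_prim w (sg b).
  have E5 : k b w = isig w * (2 * rad_prim (g b) w + euler (rad_prim (g b)) w).
    by rewrite E4 /g mulrA isig_sig mul1r.
  rewrite E3 E5 /phi2 zetaE /isig.
  have := sqn1_neq0 w.
  by move: (rad_prim (g b) w) (euler _ w) (sqn w) => x e q q0; field.
(* What remains of [u] after the other terms is [h^2 (k + K t2)], and [Lop] of [h phi2] times the
   Euler field is [h^2 (k - C / 2)]; this value of [t2] makes them equal. *)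
pose t2 := - (1 - c ^+ 2) * (C / 2).
pose phi b w := sgn b * K * (u b w - t2) + hh c (sgn b) w * phi2 b w.
have sut b : smooth (fun w => u b w - t2) := smoothB (su b) (smooth_cst t2).
have shp b : smooth (fun w => hh c (sgn b) w * phi2 b w) := smoothM (smooth_hh c (sgn b)) (sphi2 b).
have sphi b : smooth (phi b) by apply: smoothD => //; exact: smoothZ.
exists t1, t2, phi, psi; split.
- apply: funpair_half => //; first by ring.
  move=> w w0; rewrite /phi phi2T// (uT1 false)// (hT false)// (sgnN false).
  by move: (u _ _) (hh _ _ _) (phi2 _ _) => x y z; ring.
- by apply: funpair_half => //; [ring|exact: (psiT false)].
move=> b w; rewrite Lop_polar// thpsi.
have E1 : euler (phi b) w = sgn b * K * euler (u b) w
    + (hh c (sgn b) w * euler (phi2 b) w + phi2 b w * (sgn b * (sqn w * sig w))).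
  rewrite /phi eulerD//; last exact: smoothZ.
  rewrite eulerZ// eulerM//; last exact: smooth_hh.
  rewrite euler_hh; congr (_ * _ + _).
  by rewrite (eulerD w (su b) (smooth_cst (- t2))) euler_cst addr0.
have H3 := phi2E b w; have H4 := kE b w.
have mE : m b w = hh c (sgn b) w * k b w + t1 by rewrite -H4 subrK.
have kE' : k b w = C / 2 - (2 * zeta w * phi2 b w + euler (phi2 b) w).
  by rewrite H3 opprB addrC subrK.
have t2E : C / 2 = - (K * t2) by rewrite /t2 /K; field.
rewrite E1 mE kE' t2E /u1 /phi /K -sqr_zeta /hh.
move: (euler (u b) w) (euler (phi2 b) w) (u b w) (phi2 b w) (zeta w) => e1 e2 x y z.
exact: second_cohomology_identity c0 (sgnP b).
Qed.

End second_cohomology.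

(** * Components of the Schouten bracket *)

Section tensor_components.
Context {R : realType}.
Implicit Types (A B P : tensor R) (w v : 'rV[R]_2) (s : seq 'I_2).

Lemma size_permute (T : Type) (s : seq T) (g : 'S_(size s)) : size (permute s g) = size s.
Proof. by rewrite size_map size_enum_ord. Qed.

Lemma perm2P (g : 'S_2) : g = 1%g \/ g = tperm ord0 ord_max.
Proof.
have [g0|g0] := eqVneq (g ord0) ord0; [left|right]; apply/permP.
  have g1 : g ord_max = ord_max.
    apply: (ord2P (P := fun i => i != ord0 -> i = ord_max)) => //.
      by move=> _; exact/val_inj.
    by rewrite -g0 (inj_eq perm_inj).
  apply: ord2P; rewrite perm1.
    by rewrite (_ : 0 = ord0)//; exact/val_inj.
  by rewrite (_ : 1 = ord_max)//; exact/val_inj.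
have ne i : i != ord0 -> i = ord_max :> 'I_2.
  by move: i; apply: ord2P => // _; exact/val_inj.
have g0' := ne _ g0.
have g1 : g ord_max = ord0.
  have [//|/ne g1] := eqVneq (g ord_max) ord0.
  by have := @perm_inj _ g ord0 ord_max; rewrite g0' g1 => /(_ erefl).
apply: ord2P.
  by rewrite (_ : 0 = ord0) ?tpermL//; exact/val_inj.
by rewrite (_ : 1 = ord_max) ?tpermR//; exact/val_inj.
Qed.

Lemma sum_perm2 (F : 'S_2 -> R) : \sum_g F g = F 1%g + F (tperm ord0 ord_max).
Proof.
rewrite (bigD1 1%g) //= (bigD1 (tperm ord0 ord_max)) /=; last first.
  by apply/eqP => /permP/(_ ord0); rewrite tpermL perm1.
rewrite big1 ?addr0// => g /andP[g1 g2].
by case: (perm2P g) => E; rewrite E eqxx in g1 g2.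
Qed.

Lemma permute2 (i j : 'I_2) (g : 'S_2) :
  permute [:: i; j] g = if g == 1%g then [:: i; j] else [:: j; i].
Proof.
rewrite /permute enum_ordSl /= enum_ordSl /= (_ : enum 'I_0 = [::]); last first.
  by apply: size0nil; rewrite size_enum_ord.
rewrite (_ : lift ord0 ord0 = ord_max); last exact/val_inj.
case: (perm2P g) => ->; first by rewrite eqxx !perm1.
rewrite (_ : _ == _ = false) ?tpermL ?tpermR//.
by apply/eqP => /permP/(_ ord0); rewrite tpermL perm1.
Qed.

Lemma odd_tperm2 : odd_perm (tperm ord0 ord_max : 'S_2) = true.
Proof. by rewrite odd_tperm. Qed.

Definition graded (k : nat) A := forall w s, size s != k -> A w s = 0.

(** If [s] is shorter than [q], then [take] returns fewer than [q] indices and [B] vanishes;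
    otherwise the number of indices left for [A] is wrong. *)
Lemma circ_graded (p q : nat) A B w s : graded p A -> graded q B ->
  (size s).+1 != (p + q)%N -> circ p q A B w s = 0.
Proof.
move=> gA gB ns; rewrite /circ big1 ?mulr0// => g _; rewrite big1 ?mulr0// => l _.
have sz := size_permute g.
have [qs|sq] := leqP q (size s).
  rewrite gA ?mul0r//= size_drop sz; apply: contra ns => /eqP <-.
  by rewrite addSn subnK.
rewrite (_ : (fun v => _) = fun=> 0); first by rewrite pd_cst mulr0.
by apply/funext => v; rewrite gB// size_take sz ltnNge (ltnW sq) /= ltn_eqF.
Qed.

(* Exchanging two equal entries of [s] reverses the sign of the sum over permutations. *)
Lemma circ_repeat (p q : nat) A B w s (a b : 'I_(size s)) : a != b ->
  tnth (in_tuple s) a = tnth (in_tuple s) b -> circ p q A B w s = 0.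
Proof.
move=> ab sab; rewrite /circ; set S := \sum_g _.
suff E : S = - S.
  by move: E; move: S => S E; rewrite (_ : S = 0) ?mulr0//; lra.
rewrite {1}/S (reindex_inj (mulIg (tperm a b))) /= -sumrN; apply: eq_bigr => g _.
rewrite odd_permM odd_tperm ab addbT signrN mulNr; congr (- (_ * _)).
have -> : permute s (g * tperm a b)%g = permute s g.
  apply: eq_map => i; rewrite permM; case: tpermP => [->|->|]//.
by [].
Qed.

Lemma schouten_graded (k : nat) P A w s : graded 2 P -> graded k A ->
  size s != k.+1 -> schouten 2 k P A w s = 0.
Proof.
move=> gP gA ns; rewrite /schouten !circ_graded ?mulr0 ?subrr//.
by rewrite addn2 eqSS.
Qed.

(** Among three indices from ['I_2] two coincide: a surface carries no trivectors. *)
Lemma schouten3 P A w : graded 2 P -> graded 2 A -> schouten 2 2 P A w = fun=> 0.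
Proof.
move=> gP gA; apply/funext => s; have [s3|] := eqVneq (size s) 3; last exact: schouten_graded.
have : ~~ uniq s.
  apply/negP => /card_uniqP; rewrite s3 => c3.
  by have := max_card (mem s); rewrite c3 card_ord.
move=> /(uniqPn (0 : 'I_2))[i [j [ij js sij]]].
have is_ := ltn_trans ij js.
have E : tnth (in_tuple s) (Ordinal is_) = tnth (in_tuple s) (Ordinal js).
  by rewrite !(tnth_nth 0).
have ne : Ordinal is_ != Ordinal js by rewrite -val_eqE /= ltn_eqF.
by rewrite /schouten !(circ_repeat _ _ _ _ _ ne E) mulr0 subr0.
Qed.

Lemma eps_size s : size s != 2 -> eps R s = 0.
Proof.
rewrite /eps; move: s => [|a [|b [|d s]]] //= _.
- by rewrite subr0.
- by rewrite eqseq_cons andbF eqseq_cons andbF subr0.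
- by rewrite !eqseq_cons !andbF subr0.
Qed.

Lemma eps01 : eps R [:: 0; 1] = 1.
Proof. by rewrite /eps /= subr0. Qed.

Lemma eps10 : eps R [:: 1; 0] = -1.
Proof. by rewrite /eps /= sub0r. Qed.

Lemma eps_diag (i : 'I_2) : eps R [:: i; i] = 0.
Proof. by move: i; apply: ord2P; rewrite /eps /= subrr. Qed.

Lemma eps_swap (i j : 'I_2) : eps R [:: j; i] = - eps R [:: i; j].
Proof.
by move: i j; apply: ord2P; apply: ord2P; rewrite ?eps01 ?eps10 ?eps_diag ?opprK ?oppr0.
Qed.

Lemma eps_permute s (g : 'S_(size s)) : eps R (permute s g) = (-1) ^+ g * eps R s.
Proof.
have [s2|ns] := eqVneq (size s) 2; last by rewrite !eps_size ?size_permute// mulr0.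
move: s s2 g => [|i [|j [|]]] //= _ g; rewrite permute2.
case: (perm2P g) => ->; first by rewrite eqxx odd_perm1 expr0 mul1r.
rewrite (_ : _ == _ = false); last by apply/eqP => /permP/(_ ord0); rewrite tpermL perm1.
by rewrite odd_tperm2 expr1 mulN1r eps_swap.
Qed.

(** Up to sign this is the Lie derivative along [A] of the bivector with coefficient [r], namely
    [A(r) - r div A] with the flat divergence. *)
Lemma schouten_bivector_vector (r : 'rV[R]_2 -> R) A w s : smooth r ->
  (forall s, smooth (fun w => A w s)) -> graded 1 A ->
  schouten 2 1 (fun w s => r w * eps R s) A w s =
  (r w * (pd 0 (fun w => A w [:: 0]) w + pd 1 (fun w => A w [:: 1]) w)
    - (A w [:: 0] * pd 0 r w + A w [:: 1] * pd 1 r w)) * eps R s.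
Proof.
move=> sr sA gA.
have gP : graded 2 (fun w s => r w * eps R s) by move=> v t t2; rewrite eps_size ?mulr0.
have [s2|ns] := eqVneq (size s) 2; last by rewrite eps_size// mulr0 schouten_graded.
have pr l (k : R) : pd l (fun v => r v * k) w = k * pd l r w.
  by rewrite (_ : (fun v => _) = (fun v => k * r v)) ?pdZ//;
    [exact: smooth_diff|apply/funext => v; rewrite mulrC].
move: s s2 => [|i [|j [|]]] //= _.
rewrite /schouten /circ /= !sum_perm2 !permute2 eqxx /=.
rewrite (_ : (tperm ord0 ord_max == 1%g :> 'S_2) = false); last first.
  by apply/eqP => /permP/(_ ord0); rewrite tpermL perm1.
rewrite odd_perm1 odd_tperm2 expr0 expr1 !mul1r !mulN1r !sum2E /=.
rewrite !pr [eps R [:: j; i]]eps_swap.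
rewrite (_ : (-1) ^+ 6 = 1 :> R); last by rewrite -signr_odd.
have f1 : ((1`! * 1`!)%N)%:R = 1 :> R by [].
have f2 : ((2`! * 0`!)%N)%:R = 2 :> R by [].
pose D l k := pd l (fun v => A v [:: k]) w.
rewrite f1 f2 invr1 !mul1r -!/(D _ _).
move: (A w [:: 0]) (A w [:: 1]) (pd 0 r w) (pd 1 r w) (r w) (D) => a b x y z d.
by move: i j; apply: ord2P; apply: ord2P; rewrite ?eps01 ?eps10 ?eps_diag; field.
Qed.

End tensor_components.

(** * Multivector fields on the sphere in terms of their chart components *)

Section sphere_fields.
Context {R : realType}.
Implicit Types (X Y f u phi psi : bool -> 'rV[R]_2 -> R) (w v : 'rV[R]_2) (s : seq 'I_2).

Lemma sum_tuple0 (F : 0.-tuple 'I_2 -> R) : \sum_t F t = F [tuple].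
Proof.
by rewrite (bigD1 [tuple]) //= big1 ?addr0 // => t /negP[]; apply/eqP; exact: tuple0.
Qed.

Lemma sum_tupleS n (F : n.+1.-tuple 'I_2 -> R) :
  \sum_t F t = \sum_i \sum_t F (cons_tuple i t).
Proof.
rewrite pair_big /= (reindex (fun p : 'I_2 * n.-tuple 'I_2 => cons_tuple p.1 p.2)) //=.
exists (fun t => (thead t, behead_tuple t)) => [[i t] _|t _] /=.
  by congr (_, _); exact/val_inj.
by rewrite [RHS]tuple_eta; exact/val_inj.
Qed.

Lemma sum_compat1 (D : 'I_2 -> 'I_2 -> R) (G : seq 'I_2 -> R) (i : 'I_2) :
  \sum_(t : (size [:: i]).-tuple 'I_2)
    (\prod_(k < size [:: i]) D (tnth t k) (tnth (in_tuple [:: i]) k)) * G t =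
  D 0 i * G [:: 0] + D 1 i * G [:: 1].
Proof.
transitivity (\sum_a D a i * G [:: a]); last exact: sum2E.
rewrite (sum_tupleS (fun t => _)); apply: eq_bigr => a _.
by rewrite sum_tuple0 big_ord_recl big_ord0 mulr1.
Qed.

Lemma sum_compat2 (D : 'I_2 -> 'I_2 -> R) (G : seq 'I_2 -> R) (i j : 'I_2) :
  \sum_(t : (size [:: i; j]).-tuple 'I_2)
    (\prod_(k < size [:: i; j]) D (tnth t k) (tnth (in_tuple [:: i; j]) k)) * G t =
  \sum_a \sum_b D a i * D b j * G [:: a; b].
Proof.
rewrite (sum_tupleS (fun t => _)); apply: eq_bigr => a _.
rewrite (sum_tupleS (fun t => _)); apply: eq_bigr => b _.
rewrite sum_tuple0 big_ord_recl big_ord_recl big_ord0 mulr1.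
by rewrite !(tnth_nth 0).
Qed.

Lemma pd_transition w : w != 0 ->
  [/\ pd 0 (fun v => transition v 0 0) w = (w 0 1 ^+ 2 - w 0 0 ^+ 2) / sqn w ^+ 2,
      pd 1 (fun v => transition v 0 0) w = - (2 * w 0 0 * w 0 1) / sqn w ^+ 2,
      pd 0 (fun v => transition v 0 1) w = (2 * w 0 0 * w 0 1) / sqn w ^+ 2 &
      pd 1 (fun v => transition v 0 1) w = (w 0 1 ^+ 2 - w 0 0 ^+ 2) / sqn w ^+ 2].
Proof.
rewrite -sqn_eq0 => w0.
have dq := smooth_diff w (@smooth_sqn R).
have di : differentiable (fun v : 'rV[R]_2 => (sqn v)^-1) w := differentiableV dq w0.
have dc (i : 'I_2) := smooth_diff w (@smooth_coord R i).
have p (i l : 'I_2) : pd l (fun v => v 0 i * (sqn v)^-1) w =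
    w 0 i * (- sqn w ^- 2 * (2 * w 0 l)) + (sqn w)^-1 * (i == l)%:R.
  by rewrite (pdM _ (dc i) di) (pdV _ dq w0) pd_sqn pd_coord.
rewrite (_ : (fun v => transition v 0 0) = (fun v => v 0 0 * (sqn v)^-1)); last first.
  by apply/funext => v; rewrite transition0.
rewrite (_ : (fun v => transition v 0 1) = (fun v => - (v 0 1 * (sqn v)^-1))); last first.
  by apply/funext => v; rewrite transition1 mulNr.
have dM : differentiable (fun v : 'rV[R]_2 => v 0 1 * (sqn v)^-1) w := differentiableM (dc 1) di.
rewrite !(pdN _ dM) !p.
rewrite (_ : (0 == 0 :> 'I_2) = true)// (_ : (1 == 1 :> 'I_2) = true)//.
rewrite (_ : (1 == 0 :> 'I_2) = false)// (_ : (0 == 1 :> 'I_2) = false)//.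
move: w0; rewrite /sqn; move: (w 0 0) (w 0 1) => x y q0.
by split; rewrite /=; field.
Qed.

Definition fun_field f : mvfield R := fun b w s => if s is [::] then f b w else 0.

Definition vec_field X Y : mvfield R :=
  fun b w s => if s is [:: i] then if i == 0 then X b w else Y b w else 0.

(** The product of [u] with [pi_sphere]. *)
Definition biv_field u : mvfield R := fun b w s => u b w * isig w * eps R s.

Lemma is_mvf_fun f : funpair 1 f -> is_mvf 0 (fun_field f).
Proof.
move=> [sf fT]; split.
- by move=> b w [].
- move=> b w [|i s] g; last by rewrite /permute enum_ordSl /= mulr0.
  rewrite (_ : permute [::] g = [::]); last by apply: size0nil; rewrite size_permute.
  by rewrite (_ : g = 1%g) ?odd_perm1 ?mul1r//; apply/permP => -[].
- by move=> b [|i s]; [exact: sf|exact: smooth_cst].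
- move=> b w [|i s] w0; last by rewrite big1// => t _; rewrite (tuple_eta t) mulr0.
  by rewrite (sum_tuple0 (fun t => _)) big_ord0 mul1r /= fT// mul1r.
Qed.

Lemma is_mvf_biv u : funpair 1 u -> is_mvf 2 (biv_field u).
Proof.
move=> [su uT]; split.
- by move=> b w s s2; rewrite /biv_field eps_size ?mulr0.
- by move=> b w s g; rewrite /biv_field eps_permute mulrCA.
- move=> b s; apply: smoothM; last exact: smooth_cst.
  exact: smoothM (su b) smooth_isig.
- move=> b w s w0; have [s2|ns] := eqVneq (size s) 2; last first.
    rewrite /biv_field eps_size// mulr0 big1// => t _.
    by rewrite eps_size ?mulr0// size_tuple.
  move: s s2 => [|i [|j [|]]] //= _.
  pose D a k := pd a (fun v => transition v 0 k) w.
  rewrite (sum_compat2 D (biv_field u b w)).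
  have [p00 p10 p01 p11] := pd_transition w0; have I := isig_transition w0.
  (* By the Cauchy-Riemann equations for [1 / w] the Jacobian matrix is given by two numbers [x] and
     [y] and has determinant [x^2 + y^2]. *)
  pose x := (w 0 1 ^+ 2 - w 0 0 ^+ 2) / sqn w ^+ 2; pose y := (2 * w 0 0 * w 0 1) / sqn w ^+ 2.
  have d10 : D 1 0 = - y by rewrite /D p10 mulNr.
  have {p00}d00 : D 0 0 = x := p00.
  have {p01}d01 : D 0 1 = y := p01.
  have {p11}d11 : D 1 1 = x := p11.
  rewrite !sum2E /biv_field !eps_diag eps01 eps10 uT// mul1r.
  have {}I : isig (transition w) = isig w * (x ^+ 2 + y ^+ 2).
    rewrite -{}I /x /y; rewrite -sqn_eq0 in w0; move: w0; rewrite /sqn => w0.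
    by field.
  rewrite {}I; clearbody D x y.
  move: (u b w) (isig w) => p q.
  by move: i j; apply: ord2P; apply: ord2P;
    rewrite ?eps_diag ?eps01 ?eps10 ?d00 ?d10 ?d01 ?d11; ring.
Qed.

Lemma vecpair_mvf (A : mvfield R) : is_mvf 1 A ->
  vecpair (fun b w => A b w [:: 0]) (fun b w => A b w [:: 1]).
Proof.
move=> [gA _ sA cA]; split=> [b|b|b w w0]; [exact: sA|exact: sA|].
pose D a k := pd a (fun v => transition v 0 k) w.
have E (i : 'I_2) : A (~~ b) (transition w) [:: i] = D 0 i * A b w [:: 0] + D 1 i * A b w [:: 1].
  by rewrite cA// (sum_compat1 D (A b w)).
have [p00 p10 p01 p11] := pd_transition w0.
have {p00}d00 : D 0 0 = (w 0 1 ^+ 2 - w 0 0 ^+ 2) / sqn w ^+ 2 := p00.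
have {p01}d01 : D 0 1 = (2 * w 0 0 * w 0 1) / sqn w ^+ 2 := p01.
have {p10}d10 : D 1 0 = - (2 * w 0 0 * w 0 1) / sqn w ^+ 2 := p10.
have {p11}d11 : D 1 1 = (w 0 1 ^+ 2 - w 0 0 ^+ 2) / sqn w ^+ 2 := p11.
rewrite /xi /tau !E d00 d01 d10 d11 transition0 transition1.
rewrite -sqn_eq0 in w0; move: w0; rewrite /sqn => w0.
move: (A b w [:: 0]) (A b w [:: 1]) => x y.
by split; field.
Qed.

Lemma vec_field_size X Y b w s : size s != 1 -> vec_field X Y b w s = 0.
Proof. by case: s => [|i [|]]. Qed.

Lemma is_mvf_polar phi psi : funpair (-1) phi -> funpair (-1) psi ->
  is_mvf 1 (vec_field (fun b => polarX (phi b) (psi b)) (fun b => polarY (phi b) (psi b))).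
Proof.
move=> [sphi phiT] [spsi psiT]; split.
- by move=> b w s; exact: vec_field_size.
- move=> b w s g; have [s1|ns] := eqVneq (size s) 1; last first.
    by rewrite !vec_field_size ?mulr0 ?size_permute.
  move: s s1 g => [|i [|]] //= _ g.
  by rewrite permute1 (_ : g = 1%g) ?odd_perm1 ?mul1r//; apply/permP => k; rewrite !ord1.
- move=> b [|i [|j s]]; [exact: smooth_cst| |exact: smooth_cst].
  rewrite /vec_field; case: (i == 0); [exact: smooth_polarX|exact: smooth_polarY].
- move=> b w s w0; have [s1|ns] := eqVneq (size s) 1; last first.
    rewrite vec_field_size// big1// => t _.
    by rewrite vec_field_size ?mulr0// size_tuple.
  move: s s1 => [|i [|]] //= _.
  pose D a k := pd a (fun v => transition v 0 k) w.
  rewrite (sum_compat1 D (vec_field _ _ b w)) /vec_field.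
  have [p00 p10 p01 p11] := pd_transition w0.
  have {p00}d00 : D 0 0 = (w 0 1 ^+ 2 - w 0 0 ^+ 2) / sqn w ^+ 2 := p00.
  have {p01}d01 : D 0 1 = (2 * w 0 0 * w 0 1) / sqn w ^+ 2 := p01.
  have {p10}d10 : D 1 0 = - (2 * w 0 0 * w 0 1) / sqn w ^+ 2 := p10.
  have {p11}d11 : D 1 1 = (w 0 1 ^+ 2 - w 0 0 ^+ 2) / sqn w ^+ 2 := p11.
  rewrite (_ : (0 == 0 :> 'I_2) = true)// (_ : (1 == 0 :> 'I_2) = false)//.
  rewrite /polarX /polarY phiT// psiT// transition0 transition1.
  rewrite -sqn_eq0 in w0; rewrite /sqn in w0 d00 d01 d10 d11 *.
  move: (phi b w) (psi b w) => x y.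
  by move: i; apply: ord2P; rewrite /= ?d00 ?d01 ?d10 ?d11; clearbody D; field.
Qed.

End sphere_fields.

(** * The Poisson differential of the necklace structure, degree 0 and the modular field *)

Section necklace_cohomology.
Context {R : realType}.
Implicit Types (X Y f u : bool -> 'rV[R]_2 -> R) (w v : 'rV[R]_2) (s : seq 'I_2) (c : R).

Lemma funpair_hh c : funpair 1 (fun b => hh c (sgn b)).
Proof.
by split=> [b|b w w0]; [exact: smooth_hh|rewrite sgnN hh_transition// mul1r].
Qed.

Lemma funpair_cst (a : R) : funpair 1 (fun _ _ => a).
Proof. by split=> [b|b w _]; [exact: smooth_cst|rewrite mul1r]. Qed.

Lemma necklaceE c : necklace c = biv_field (fun b => hh c (sgn b)).
Proof.
apply/funext => b; apply/funext => w; apply/funext => s.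
have [_ _ e] := embedE b w.
by rewrite /necklace /pi_sphere /biv_field e /hh /zeta /isig /sgn !mulrA.
Qed.

Lemma pi_sphereE : pi_sphere R = biv_field (fun _ _ => 1).
Proof. by do 3 apply/funext => ?; rewrite /pi_sphere /biv_field mul1r. Qed.

Lemma areaE b w i j : area R b w i j = sig w * eps R [:: i; j].
Proof. by []. Qed.

Lemma is_mvf_necklace c : is_mvf 2 (necklace c).
Proof. by rewrite necklaceE; exact: is_mvf_biv (funpair_hh c). Qed.

Lemma is_mvf_pi : is_mvf 2 (pi_sphere R).
Proof. by rewrite pi_sphereE; exact: is_mvf_biv (funpair_cst 1). Qed.

Definition rhow c b w : R := hh c (sgn b) w * isig w.

Lemma smooth_rhow c b : smooth (rhow c b).
Proof. exact: smoothM (smooth_hh c (sgn b)) smooth_isig. Qed.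

Lemma pd_rhow c b l w :
  pd l (rhow c b) w = w 0 l * (sgn b + hh c (sgn b) w * (1 + sqn w)).
Proof.
rewrite (pdM _ (smooth_diff w (smooth_hh c (sgn b))) (smooth_diff w smooth_isig)).
rewrite pd_hh pd_isig.
transitivity (w 0 l * (sgn b * (isig w * sig w) + hh c (sgn b) w * (1 + sqn w))); first by ring.
by rewrite isig_sig mulr1.
Qed.

Lemma graded_mvf k (A : mvfield R) b : is_mvf k A -> graded k (A b).
Proof. by move=> [gA _ _ _] w s; exact: gA. Qed.

Lemma d_poisson2 c (A : mvfield R) : is_mvf 2 A ->
  d_poisson (necklace c) 2 A = fun _ _ _ => 0.
Proof.
move=> mA; apply/funext => b; apply/funext => w; rewrite /d_poisson.
exact: schouten3 (graded_mvf b (is_mvf_necklace c)) (graded_mvf b mA).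
Qed.

Lemma d_poisson1 c (A : mvfield R) b w s : is_mvf 1 A ->
  d_poisson (necklace c) 1 A b w s =
  - (isig w * Lop c (sgn b) (fun w => A b w [:: 0]) (fun w => A b w [:: 1]) w) * eps R s.
Proof.
move=> mA; have [_ _ sA _] := mA.
rewrite /d_poisson necklaceE.
rewrite [LHS](schouten_bivector_vector w s (smooth_rhow c b) (sA b) (graded_mvf b mA)).
congr (_ * _); rewrite !pd_rhow /rhow /Lop /divw /xi.
move: (pd 0 _ w) (pd 1 _ w) (A b w [:: 0]) (A b w [:: 1]) => p q x y.
transitivity (- (isig w * sig w * (sgn b * (w 0 0 * x + w 0 1 * y)) -
   hh c (sgn b) w * (isig w * (p + q) - (1 + sqn w) * (w 0 0 * x + w 0 1 * y)))).
  by rewrite isig_sig mul1r; ring.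
by rewrite /isig; have := sqn1_neq0 w; move: (sig w) (sqn w) (hh c (sgn b) w) => g n h n0; field.
Qed.

Lemma d_poissonE0 c (A : mvfield R) b w s : is_mvf 0 A ->
  d_poisson (necklace c) 0 A b w s =
  vec_field (fun b w => - (rhow c b w * pd 1 (fun w => A b w [::]) w))
            (fun b w => rhow c b w * pd 0 (fun w => A b w [::]) w) b w s.
Proof.
move=> mA; have [s1|ns] := eqVneq (size s) 1; last first.
  rewrite vec_field_size// /d_poisson schouten_graded//.
    exact: graded_mvf (is_mvf_necklace c).
  exact: graded_mvf mA.
move: s s1 => [|i [|]] //= _; rewrite d_poisson0// sum2E necklaceE /biv_field /vec_field /rhow.
move: (pd 0 _ w) (pd 1 _ w) (hh _ _ _) (isig _) => p q x y.
by move: i; apply: ord2P; rewrite ?eps01 ?eps10 ?eps_diag /=; ring.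
Qed.

Lemma mvf0_fun (A : mvfield R) : is_mvf 0 A -> funpair 1 (fun b w => A b w [::]).
Proof.
move=> [gA _ sA cA]; split=> [b|b w w0]; first exact: sA.
by rewrite cA// (sum_tuple0 (fun t => _)) big_ord0.
Qed.

Lemma mvf0E (A : mvfield R) : is_mvf 0 A -> A = fun_field (fun b w => A b w [::]).
Proof.
move=> [gA _ _ _]; apply/funext => b; apply/funext => w; apply/funext => -[|i s] //=.
by rewrite gA.
Qed.

Lemma mvf1E (A : mvfield R) : is_mvf 1 A ->
  A = vec_field (fun b w => A b w [:: 0]) (fun b w => A b w [:: 1]).
Proof.
move=> [gA _ _ _]; apply/funext => b; apply/funext => w; apply/funext => s.
have [s1|ns] := eqVneq (size s) 1; last by rewrite gA// vec_field_size.
by move: s s1 => [|i [|]] //= _; move: i; apply: ord2P.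
Qed.

Lemma mvf2_swap (A : mvfield R) b w (i j : 'I_2) : is_mvf 2 A ->
  A b w [:: j; i] = - A b w [:: i; j].
Proof.
move=> [_ aA _ _]; have := aA b w [:: i; j] (tperm ord0 ord_max).
rewrite permute2 odd_tperm2 expr1 mulN1r.
by rewrite (_ : _ == _ = false)//; apply/eqP => /permP/(_ ord0); rewrite tpermL perm1.
Qed.

Lemma mvf2_diag (A : mvfield R) b w (i : 'I_2) : is_mvf 2 A -> A b w [:: i; i] = 0.
Proof. by move=> mA; have := mvf2_swap b w i i mA; lra. Qed.

Lemma mvf2E (A : mvfield R) : is_mvf 2 A ->
  A = biv_field (fun b w => sig w * A b w [:: 0; 1]).
Proof.
move=> mA; have [gA _ _ _] := mA; apply/funext => b; apply/funext => w; apply/funext => s.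
have [s2|ns] := eqVneq (size s) 2; last by rewrite gA// /biv_field eps_size ?mulr0.
have E : sig w * A b w [:: 0; 1] * isig w = A b w [:: 0; 1].
  by rewrite mulrAC [sig w * _]mulrC isig_sig mul1r.
move: s s2 => [|i [|j [|]]] //= _; rewrite /biv_field E.
move: i j; apply: ord2P; apply: ord2P;
  rewrite ?eps01 ?eps10 ?eps_diag ?mulr1 ?mulr0 ?mvf2_diag//.
by rewrite mvf2_swap// mulrN1.
Qed.

Lemma mvf2_fun (A : mvfield R) : is_mvf 2 A -> funpair 1 (fun b w => sig w * A b w [:: 0; 1]).
Proof.
move=> mA; have [gA _ sA cA] := mA; split=> [b|b w w0].
  exact: smoothM smooth_sig (sA b _).
pose D a k := pd a (fun v => transition v 0 k) w.
rewrite cA// (sum_compat2 D (A b w)) !sum2E !mvf2_diag// (mvf2_swap b w 0 1 mA) sig_transition//.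
have [p00 p10 p01 p11] := pd_transition w0.
have {p00}d00 : D 0 0 = (w 0 1 ^+ 2 - w 0 0 ^+ 2) / sqn w ^+ 2 := p00.
have {p01}d01 : D 0 1 = (2 * w 0 0 * w 0 1) / sqn w ^+ 2 := p01.
have {p10}d10 : D 1 0 = - (2 * w 0 0 * w 0 1) / sqn w ^+ 2 := p10.
have {p11}d11 : D 1 1 = (w 0 1 ^+ 2 - w 0 0 ^+ 2) / sqn w ^+ 2 := p11.
rewrite d00 d01 d10 d11; clear d00 d01 d10 d11; clearbody D.
rewrite -sqn_eq0 in w0; move: (sig w) (A b w [:: 0; 1]) => g x.
by move: w0; rewrite /sqn => w0; field.
Qed.

Lemma vecpairB X Y X' Y' : vecpair X Y -> vecpair X' Y' ->
  vecpair (fun b w => X b w - X' b w) (fun b w => Y b w - Y' b w).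
Proof.
move=> [sX sY XY] [sX' sY' XY']; split=> [b|b|b w w0].
- exact: smoothB (sX b) (sX' b).
- exact: smoothB (sY b) (sY' b).
have [E1 E2] := XY b w w0; have [E1' E2'] := XY' b w w0.
split.
  rewrite (_ : xi _ _ _ = xi (X (~~ b)) (Y (~~ b)) (transition w)
    - xi (X' (~~ b)) (Y' (~~ b)) (transition w)); last by rewrite /xi; ring.
  by rewrite mulrBr E1 E1' /xi; ring.
rewrite (_ : tau _ _ _ = tau (X (~~ b)) (Y (~~ b)) (transition w)
  - tau (X' (~~ b)) (Y' (~~ b)) (transition w)); last by rewrite /tau; ring.
by rewrite mulrBr E2 E2' /tau; ring.
Qed.

(** The partial derivatives of a Casimir function vanish after multiplication by [h], hence
    everywhere by density, and the constants of the two charts agree at a point of the overlap. *)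
Lemma cohomology0 c : `|c| < 1 -> cohomology_basis (necklace c) 0 [tuple one_field R].
Proof.
move=> hc.
have oneE : one_field R = fun_field (fun _ _ => 1) by [].
have mone : is_mvf 0 (one_field R) by rewrite oneE; exact: is_mvf_fun (funpair_cst 1).
split.
  move=> i; rewrite ord1; split=> //.
  apply/funext => b; apply/funext => w; apply/funext => s.
  rewrite d_poissonE0// /vec_field /one_field !pd_cst !mulr0 oppr0.
  by case: s => [|j [|]]//; case: (j == 0).
move=> A [mA dA]; have [sA cA] := mvf0_fun mA.
pose f b w := A b w [::].
have f0 b l v : pd l (f b) v = 0.
  have s0 : smooth (pd l (f b)) by exact: smooth_pd (sA b).
  apply: (@hh_dense _ c (sgn b) (pd l (f b)) (fun=> 0)) => // [|||w].
  - exact: sgnP.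
  - exact: smooth_continuous.
  - exact: cst_continuous.
  have E j : d_poisson (necklace c) 0 A b w [:: j] = 0 by rewrite dA.
  have E0 := E 0; have E1 := E 1; rewrite !d_poissonE0 //= in E0 E1.
  rewrite mulr0; apply: (mulfI (_ : isig w != 0)).
    by apply/eqP => i0; have /eqP := isig_sig w; rewrite i0 mul0r eq_sym oner_eq0.
  rewrite mulr0 mulrA [isig w * _]mulrC.
  move: l {s0}; apply: ord2P; first exact: E1.
  by move/eqP: E0; rewrite oppr_eq0 => /eqP.
have fc b w : f b w = f b 0 by apply: pd0_cst => //; exact: sA.
have ft w : f true w = f false 0.
  have w1 : pt 1 0 != 0 :> 'rV[R]_2.
    by rewrite -sqn_eq0 sqn_pt expr1n [0 ^+ 2]expr2 mulr0 addr0 oner_eq0.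
  by rewrite fc -(fc true (transition (pt 1 0))) /f (cA false)// mul1r -/(f false _) fc.
exists (\row_(i < 1) f false 0); split.
  apply/funext => b; apply/funext => w; apply/funext => s.
  rewrite big_ord1 mxE (mvf0E mA) /= /one_field; case: s => [|i s] /=; last by rewrite mulr0 subrr.
  by rewrite mulr1 -/(f b w); case: b; rewrite ?ft ?fc subrr.
move=> t /= E; apply/rowP => i; rewrite mxE ord1.
have := congr1 (fun F : mvfield R => F false 0 [::]) E.
by rewrite big_ord1 /= mulr1 => /eqP; rewrite subr_eq0 => /eqP.
Qed.

(** The rotation field about the [x_3]-axis; the sign is there because the two charts measure the
    angle in opposite directions. *)
Definition modular : mvfield R :=
  vec_field (fun b => polarX (fun=> 0) (fun=> sgn b)) (fun b => polarY (fun=> 0) (fun=> sgn b)).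

Lemma is_mvf_modular : is_mvf 1 modular.
Proof.
apply: (@is_mvf_polar R (fun _ _ => 0) (fun b _ => sgn b)).
  by split=> [b|b w _]; [exact: smooth_cst|rewrite mulr0].
by split=> [b|b w _]; [exact: smooth_cst|rewrite sgnN mulN1r].
Qed.

Lemma modularE b w : modular b w [:: 0] = - (sgn b * w 0 1) /\
  modular b w [:: 1] = sgn b * w 0 0.
Proof. by rewrite /modular /= /polarX /polarY !mul0r sub0r add0r. Qed.

Lemma modular_cocycle c : cocycle (necklace c) 1 modular.
Proof.
split; first exact: is_mvf_modular.
apply/funext => b; apply/funext => w; apply/funext => s; rewrite d_poisson1; last exact: is_mvf_modular.
rewrite (_ : (fun w => modular b w [:: 0]) = polarX (fun=> 0) (fun=> sgn b))//.
rewrite (_ : (fun w => modular b w [:: 1]) = polarY (fun=> 0) (fun=> sgn b))//.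
rewrite Lop_polar; [|exact: smooth_cst|exact: smooth_cst].
have -> : dtheta (fun=> sgn b) w = 0 :> R by rewrite /dtheta !pd_cst !mulr0 subrr.
by rewrite euler_cst !mulr0 !addr0 mulr0 subrr mulr0 oppr0 mul0r.
Qed.

(** The factor is the divergence of the Hamiltonian field. The second derivatives of [f] cancel in
    it by [pd_swap], which leaves a derivation of [f]. *)
Lemma lie_area c (f : mvfield R) b w i j : is_mvf 0 f ->
  lie_form2 (hamiltonian (necklace c b) (f b)) (area R b) w i j =
  (sgn b * dtheta (fun v => f b v [::]) w) * area R b w i j.
Proof.
move=> mf; have [sf _] := mvf0_fun mf; have {}sf := sf b.
set g := (fun v => f b v [::]) in sf *.
have X0 : (fun v => hamiltonian (necklace c b) (f b) v [:: 0]) = (fun v => rhow c b v * pd 1 g v).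
  apply/funext => v; rewrite /hamiltonian sum2E necklaceE /biv_field eps_diag eps01 /rhow -/g.
  by move: (pd 0 g v) (pd 1 g v) => x y; ring.
have X1 : (fun v => hamiltonian (necklace c b) (f b) v [:: 1]) = (fun v => - (rhow c b v * pd 0 g v)).
  apply/funext => v; rewrite /hamiltonian sum2E necklaceE /biv_field eps_diag eps10 /rhow -/g.
  by move: (pd 0 g v) (pd 1 g v) => x y; ring.
have s0 := smooth_pd 0 sf; have s1 := smooth_pd 1 sf; have sr := smooth_rhow c b.
have p0 l : pd l (fun v => hamiltonian (necklace c b) (f b) v [:: 0]) w =
    rhow c b w * pd l (pd 1 g) w + pd 1 g w * pd l (rhow c b) w.
  by rewrite X0 (pdM _ (smooth_diff w sr) (smooth_diff w s1)).
have p1 l : pd l (fun v => hamiltonian (necklace c b) (f b) v [:: 1]) w =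
    - (rhow c b w * pd l (pd 0 g) w + pd 0 g w * pd l (rhow c b) w).
  by rewrite X1 (pdN _ (smooth_diff w (smoothM sr s0))) (pdM _ (smooth_diff w sr) (smooth_diff w s0)).
have h0 : hamiltonian (necklace c b) (f b) w [:: 0] = rhow c b w * pd 1 g w.
  by rewrite -[LHS]/((fun v => hamiltonian (necklace c b) (f b) v [:: 0]) w) X0.
have h1 : hamiltonian (necklace c b) (f b) w [:: 1] = - (rhow c b w * pd 0 g w).
  by rewrite -[LHS]/((fun v => hamiltonian (necklace c b) (f b) v [:: 1]) w) X1.
have po l k k' : pd l (fun v => area R b v k k') w = eps R [:: k; k'] * pd l sig w.
  rewrite (_ : (fun v => _) = (fun v => eps R [:: k; k'] * sig v)).
    by rewrite (pdZ _ _ (smooth_diff w smooth_sig)).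
  by apply/funext => v; rewrite areaE mulrC.
rewrite /lie_form2 sum2E !po !areaE h0 h1.
pose H0 l := pd l (fun v => hamiltonian (necklace c b) (f b) v [:: 0]) w.
pose H1 l := pd l (fun v => hamiltonian (necklace c b) (f b) v [:: 1]) w.
rewrite -!/(H0 _) -!/(H1 _).
have {p0}H0E l : H0 l = rhow c b w * pd l (pd 1 g) w + pd 1 g w * pd l (rhow c b) w := p0 l.
have {p1}H1E l : H1 l = - (rhow c b w * pd l (pd 0 g) w + pd 0 g w * pd l (rhow c b) w) := p1 l.
have div : H0 0 + H1 1 = pd 1 g w * pd 0 (rhow c b) w - pd 0 g w * pd 1 (rhow c b) w.
  rewrite H0E H1E (pd_swap w sf).
  by move: (pd 1 (pd 0 g) w) (pd 1 g w) (pd 0 g w) (pd 0 _ w) (pd 1 _ w) => *; ring.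
clearbody H0 H1; clear H0E H1E X0 X1 h0 h1 po.
move: div; rewrite !pd_rhow !pd_sig /dtheta /rhow.
move: (pd 1 g w) (pd 0 g w) => x y div.
have {}div : H1 1 = x * (w 0 0 * (sgn b + hh c (sgn b) w * (1 + sqn w))) -
    y * (w 0 1 * (sgn b + hh c (sgn b) w * (1 + sqn w))) - H0 0.
  by rewrite -div addrC addKr.
have n0 := sqn1_neq0 w; rewrite /isig.
move: (H0) (H1) div; move: (sig w) (hh c (sgn b) w) (sgn b) (sqn w) n0 => g' h s n n0 h0 h1 div.
by move: i j; apply: ord2P; apply: ord2P;
  rewrite ?eps01 ?eps10 ?eps_diag ?div; field.
Qed.

Lemma modular_is_modular c : is_modular (necklace c) (area R) modular.
Proof.
split=> [|f mf b w i j]; first exact: is_mvf_modular.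
rewrite lie_area//; congr (_ * _); rewrite sum2E; have [-> ->] := modularE b w.
rewrite /dtheta.
by move: (pd 1 _ w) (pd 0 _ w) => x y; ring.
Qed.

End necklace_cohomology.

(** * Uniqueness of the modular field and the bases in degrees 1 and 2 *)

Section necklace_theorem.
Context {R : realType}.
Implicit Types (w v : 'rV[R]_2) (c : R).

(** A vector field is determined by its action on [x_3], [x_1] and [x_2], which [pz] and [pX]
    provide up to constant factors: the first kills the radial component of the difference, and the
    other two then kill the rest. *)
Lemma modular_unique c (D : mvfield R) :
  is_modular (necklace c) (area R) D -> modular = D.
Proof.
move=> [mD DP]; rewrite (mvf1E mD) [LHS](mvf1E is_mvf_modular).
have [mM MP] := @modular_is_modular R c.
pose a b w := D b w [:: 0] - modular b w [:: 0].
pose d b w := D b w [:: 1] - modular b w [:: 1].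
have E f b w : funpair 1 f -> a b w * pd 0 (f b) w + d b w * pd 1 (f b) w = 0.
  move=> pf; have mf := is_mvf_fun pf.
  have pE l : pd l (fun v => fun_field f b v [::]) w = pd l (f b) w by [].
  have := MP _ mf b w 0 1; rewrite (DP _ mf b w 0 1) !sum2E !pE.
  have n0 : area R b w 0 1 != 0 by rewrite areaE eps01 mulr1 sig_neq0.
  move/(mulIf n0) => /eqP; rewrite -subr_eq0 => /eqP E.
  by rewrite /a /d -[RHS]E; move: (pd 0 (f b) w) (pd 1 (f b) w) => x y; ring.
have pz : funpair 1 (fun b w => sgn b * zeta w).
  split=> [b|b w w0]; first exact: smoothZ _ smooth_zeta.
  by rewrite sgnN zeta_transition// mulrNN mul1r.
have pX (i : 'I_2) : funpair 1 (fun b w => (if i == 0 then 1 else sgn b) * (w 0 i * (1 + sqn w)^-1)).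
  split=> [b|b w w0].
    exact: smoothZ _ (smoothM (smooth_coord i) smooth_inv1sqn).
  have n0 := sqn1_neq0 w; rewrite sqn_transition mul1r sgnN; rewrite -sqn_eq0 in w0.
  move: i; apply: ord2P => /=; rewrite ?transition0 ?transition1;
    by move: (sqn w) w0 n0 => q q0 n0; field; rewrite q0 n0.
have pdX (i l : 'I_2) k w : pd l (fun w => k * (w 0 i * (1 + sqn w)^-1)) w =
    k * (w 0 i * (- (1 + sqn w) ^- 2 * (2 * w 0 l)) + (1 + sqn w)^-1 * (i == l)%:R).
  rewrite (pdZ _ _ (smooth_diff w (smoothM (smooth_coord i) smooth_inv1sqn))).
  by rewrite (pdM _ (smooth_diff w (smooth_coord i)) (smooth_diff w smooth_inv1sqn)) pd_inv1sqn pd_coord.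
have ad b w : a b w = 0 /\ d b w = 0.
  have Ez := E _ b w pz; have E0 := E _ b w (pX 0); have E1 := E _ b w (pX 1).
  rewrite !(pdZ _ _ (smooth_diff w smooth_zeta)) !pd_zeta in Ez.
  rewrite !pdX /= in E0 E1.
  have n0 := sqn1_neq0 w; have g0 := sig_neq0 w.
  have s0 : sgn b != 0 :> R by rewrite /sgn signr_eq0.
  have F : a b w * w 0 0 + d b w * w 0 1 = 0.
    apply: (mulfI s0); apply: (mulfI g0); rewrite !mulr0 -[RHS]oppr0 -[in RHS]Ez; ring.
  have i0 : (1 + sqn w)^-1 != 0 by rewrite invr_eq0.
  split.
    apply: (mulfI i0); rewrite mulr0 -[RHS]E0.
    transitivity ((1 + sqn w)^-1 * a b w -
      2 * w 0 0 * (1 + sqn w) ^- 2 * (a b w * w 0 0 + d b w * w 0 1)).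
      by rewrite F mulr0 subr0.
    by ring.
  apply: (mulfI s0); apply: (mulfI i0); rewrite !mulr0 -[RHS]E1.
  transitivity ((1 + sqn w)^-1 * (sgn b * d b w) -
    2 * sgn b * w 0 1 * (1 + sqn w) ^- 2 * (a b w * w 0 0 + d b w * w 0 1)).
    by rewrite F mulr0 subr0.
  by ring.
have e0 b w : modular b w [:: 0] = D b w [:: 0].
  by have [/eqP] := ad b w; rewrite subr_eq0 => /eqP ->.
have e1 b w : modular b w [:: 1] = D b w [:: 1].
  by have [_ /eqP] := ad b w; rewrite subr_eq0 => /eqP ->.
by congr vec_field; apply/funext => b; apply/funext => w.
Qed.

Lemma cohomology1 c : `|c| < 1 -> cohomology_basis (necklace c) 1 [tuple modular : mvfield R].
Proof.
move=> hc; split=> [i|A [mA dA]].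
  by rewrite ord1; exact: modular_cocycle.
have vA := vecpair_mvf mA.
have LA b w : Lop c (sgn b) (fun w => A b w [:: 0]) (fun w => A b w [:: 1]) w = 0.
  have := congr1 (fun F : mvfield R => F b w [:: 0; 1]) dA; rewrite d_poisson1// eps01 mulr1.
  move/eqP; rewrite oppr_eq0 mulf_eq0 => /orP[|/eqP//].
  by move=> /eqP i0; have /eqP := isig_sig w; rewrite i0 mul0r eq_sym oner_eq0.
have [f [t [pf fE]]] := cocycle1_decomposition hc vA LA.
have mf := is_mvf_fun pf.
exists (\row_(i < 1) t); split.
  exists (fun_field f) => //.
  apply/funext => b; apply/funext => w; apply/funext => s.
  rewrite big_ord1 mxE (_ : tnth [tuple modular] ord0 = modular)// d_poissonE0//.
  have [s1|ns] := eqVneq (size s) 1; last first.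
    have [gA _ _ _] := mA; have [gM _ _ _] := @is_mvf_modular R.
    by rewrite gA// gM// vec_field_size// mulr0 subr0.
  have [E0 E1] := fE b w; have [M0 M1] := modularE b w.
  move: s s1 => [|i [|j s]] // _; rewrite /rhow.
  move: i; apply: ord2P; rewrite ?E0 ?E1 ?M0 ?M1 /=.
    by move: (pd 1 (f b) w) => x; ring.
  by move: (pd 0 (f b) w) => x; ring.
(* Coboundaries vanish on the circle and the modular field does not, so evaluation at one point of
   the circle determines the coefficient. *)
move=> t' [B mB E]; have [r r0 hr] := hh_zero_ex hc (sgnP false).
have V (t0 : 'rV[R]_1) (B0 : mvfield R) : is_mvf 0 B0 ->
    (fun b w s => A b w s - \sum_(i < 1) t0 0 i * tnth [tuple modular] i b w s) =
    d_poisson (necklace c) 0 B0 -> A false (pt r 0) [:: 1] = t0 0 0 * r.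
  move=> mB0 E0; have := congr1 (fun F : mvfield R => F false (pt r 0) [:: 1]) E0.
  cbv beta; rewrite big_ord1 (_ : tnth [tuple modular] ord0 = modular)//.
  have [_ ->] := modularE false (pt r 0).
  rewrite (d_poissonE0 c _ _ _ mB0) /vec_field /rhow /= hr.
  by rewrite !mul0r /sgn expr0 mul1r pt0 => /eqP; rewrite subr_eq0 => /eqP.
have [E0 E1] := fE false (pt r 0).
have At : A false (pt r 0) [:: 1] = t * r.
  by rewrite E1 hr !mul0r add0r pt0 mul1r.
apply/rowP => i; rewrite mxE ord1; apply: (mulIf (lt0r_neq0 r0)).
by rewrite -At (V t' B mB E).
Qed.

Lemma cohomology2 c : `|c| < 1 ->
  cohomology_basis (necklace c) 2 [tuple necklace c; pi_sphere R].
Proof.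
move=> hc; split=> [i|A [mA _]].
  have mi : is_mvf 2 (tnth [tuple necklace c; pi_sphere R] i).
    by move: i; apply: ord2P; [exact: is_mvf_necklace|exact: is_mvf_pi].
  by split=> //; exact: d_poisson2.
have pu := mvf2_fun mA; pose u b w := sig w * A b w [:: 0; 1].
have [t1 [t2 [phi [psi [pphi ppsi uE]]]]] := cocycle2_decomposition hc pu.
have sumE (t : 'rV[R]_2) b w s :
    \sum_(i < 2) t 0 i * tnth [tuple necklace c; pi_sphere R] i b w s =
    (t 0 0 * hh c (sgn b) w + t 0 1) * isig w * eps R s.
  by rewrite sum2E !(tnth_nth (necklace c)) /= necklaceE pi_sphereE /biv_field; ring.
have AE b w s : A b w s = u b w * isig w * eps R s by rewrite (mvf2E mA).
have npair e f : @funpair R e f -> funpair e (fun b w => - f b w).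
  by move=> [sf fT]; split=> [b|b w w0]; [exact: smoothN|rewrite fT// mulrN].
exists (pt t1 t2); split.
  (* The sign in [d_poisson1] calls for the opposite of the field that the decomposition
     provides. *)
  have mB := is_mvf_polar (npair _ _ pphi) (npair _ _ ppsi).
  eexists; first exact: mB.
  apply/funext => b; apply/funext => w; apply/funext => s.
  rewrite d_poisson1// sumE AE pt0 pt1 /u uE /=.
  have [sphi _] := pphi; have [spsi _] := ppsi.
  rewrite (_ : (fun w => polarX (fun w => - phi b w) (fun w => - psi b w) w) =
    polarX (fun w => - phi b w) (fun w => - psi b w))//.
  rewrite (_ : (fun w => polarY (fun w => - phi b w) (fun w => - psi b w) w) =
    polarY (fun w => - phi b w) (fun w => - psi b w))//.
  rewrite !Lop_polar//; [|exact: smoothN|exact: smoothN].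
  rewrite (_ : (fun w => - phi b w) = (fun w => -1 * phi b w)); last first.
    by apply/funext => v; rewrite mulN1r.
  rewrite eulerZ// /dtheta !(pdN _ (smooth_diff w (spsi b))).
  by move: (euler _ w) (pd 0 _ w) (pd 1 _ w) (phi b w) (hh _ _ _) => x y z p h; ring.
move=> t' [B mB E]; have vB := vecpair_mvf mB.
(* The difference of two fields whose images under [Lop] agree with [u] up to combinations of [hh]
   and [1]; [Lop_avg] forces the two combinations to be equal. *)
pose X b w := polarX (phi b) (psi b) w - (- B b w [:: 0]).
pose Y b w := polarY (phi b) (psi b) w - (- B b w [:: 1]).
have mP := is_mvf_polar pphi ppsi; have vP := vecpair_mvf mP.
have vN : vecpair (fun b w => - B b w [:: 0]) (fun b w => - B b w [:: 1]).
  have [sX sY XY] := vB; split=> [b|b|b w w0]; [exact: smoothN|exact: smoothN|].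
  have [E1 E2] := XY b w w0; rewrite /xi /tau in E1 E2 *; split.
    by rewrite !mulrN -opprD mulrN E1; ring.
  by rewrite !mulrN opprK addrC -opprB mulrN E2; ring.
have vXY : vecpair X Y := vecpairB vP vN.
have [sX sY _] := vP; have [sX' sY' _] := vN; have [sB0 sB1 _] := vB.
have LB b w : Lop c (sgn b) (fun w => - B b w [:: 0]) (fun w => - B b w [:: 1]) w =
    u b w - (t' 0 0 * hh c (sgn b) w + t' 0 1).
  have := congr1 (fun F : mvfield R => F b w [:: 0; 1]) E.
  rewrite /= d_poisson1// sumE AE eps01 !mulr1 => EL.
  have i0 : isig w != 0.
    by apply/eqP => i0; have /eqP := isig_sig w; rewrite i0 mul0r eq_sym oner_eq0.
  have LN : Lop c (sgn b) (fun w => - B b w [:: 0]) (fun w => - B b w [:: 1]) w =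
      - Lop c (sgn b) (fun w => B b w [:: 0]) (fun w => B b w [:: 1]) w.
    rewrite /Lop /divw /xi (pdN _ (smooth_diff w (sB0 b))) (pdN _ (smooth_diff w (sB1 b))).
    by move: (pd 0 _ w) (pd 1 _ w) => x y; ring.
  by apply: (mulfI i0); rewrite LN mulrN -EL; ring.
have LXY b w : Lop c (sgn b) (X b) (Y b) w =
    (t' 0 0 - t1) * hh c (sgn b) w + (t' 0 1 - t2).
  have -> : Lop c (sgn b) (X b) (Y b) w = Lop c (sgn b) (polarX (phi b) (psi b)) (polarY (phi b) (psi b)) w
     - Lop c (sgn b) (fun w => - B b w [:: 0]) (fun w => - B b w [:: 1]) w.
    by rewrite -(LopB _ _ _ (sX b) (sY b) (sX' b) (sY' b)).
  by rewrite LB /u uE; move: (Lop _ _ _ _ w) => x; ring.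
have [/eqP z1 /eqP z2 _] := Lop_avg hc vXY LXY.
rewrite subr_eq0 in z1; rewrite subr_eq0 in z2.
rewrite [RHS]row2E; congr pt; apply/eqP; rewrite eq_sym; [exact: z1|exact: z2].
Qed.

End necklace_theorem.

Theorem theorem3p2 (R : realType) (c : R) (hc : `|c| < 1) :
  [/\ cohomology_basis (necklace c) 0 [tuple one_field R],
      exists D : mvfield R,
        unique (is_modular (necklace c) (area R)) D /\
        cohomology_basis (necklace c) 1 [tuple D] &
      cohomology_basis (necklace c) 2 [tuple necklace c; pi_sphere R]].
Proof.
split; [exact: cohomology0| |exact: cohomology2].
exists modular; split; last exact: cohomology1.
by split; [exact: modular_is_modular|exact: modular_unique].
Qed.
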